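(* Let $\kappa\ge1$, $0<\varepsilon\le1$ and $A>0$ be constants. There exist $n_0$ and a function $\tau(n)$ with $\tau(n)=o(n)$ as $n\to\infty$, both depending only on $\kappa,\varepsilon,A$, such that the following holds for all $n\ge n_0$. Let $x$ be a complex random variable with $\kappa$-controlled second moment, let $\beta\ge\exp(-n^{\varepsilon/2})$ and let $n^{-A}\le p\le 1$. Then there is a set $S'\subset\mathbf{C}^n$ of cardinality at most $$n^{(-1/2+\varepsilon)n}\,p^{-n}+\exp(\tau(n))$$ such that for every $\mathbf{v}\in S_{n,x,\beta,p}$ there is $\mathbf{v}'\in S'$ with $\|\mathbf{v}-\mathbf{v}'\|_\infty\le\beta$.
   Context: For $\kappa\ge1$, a complex random variable $x$ has $\kappa$-controlled second moment if $\mathbf{E}|x|^2\le\kappa$ and, for all complex numbers $z,w$, $\mathbf{E}\big[(\mathrm{Re}(zx-w))^2\,\mathbf{1}_{|x|\le\kappa}\big]\ge\frac1\kappa(\mathrm{Re}\,z)^2$. For a tuple $\mathbf{v}=(v_1,\dots,v_n)\in\mathbf{C}^n$, the random walk is $W_x(\mathbf{v})=v_1x_1+\dots+v_nx_n$ with $x_1,\dots,x_n$ i.i.d. copies of $x$, and the small ball probability is $p_{r,x}(\mathbf{v})=\sup_{z\in\mathbf{C}}\mathbf{P}(W_x(\mathbf{v})\in B(z,r))$, where $B(z,r)$ is the closed disk of radius $r$ centred at $z$. $S_{n,x,\beta,p}$ is the set of all unit vectors (in Euclidean norm) $\mathbf{v}\in\mathbf{C}^n$ with $p_{\beta,x}(\mathbf{v})\ge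 p$. $\|(v_1,\dots,v_n)\|_\infty=\sup_i|v_i|$. *)

(* Defs.v *)
From HB Require Import structures.
From mathcomp Require Import all_boot all_order all_algebra finmap.
From mathcomp Require Import all_classical all_reals all_analysis.
From mathcomp Require Import complex.

Set Implicit Arguments.
Unset Strict Implicit.
Unset Printing Implicit Defensive.

Import Order.TTheory GRing.Theory Num.Theory.
Import numFieldTopology.Exports numFieldNormedType.Exports.
Import ComplexField.Normc.

Local Open Scope classical_set_scope.
Local Open Scope ring_scope.
Local Open Scope complex_scope.

(* [R[i]] carries the Borel sigma-algebra of its usual topology (the one of
   [R[i]^o], the field seen as a normed module over itself), so that
   [{RV P >-> R[i]}] is the type of complex random variables. *)
Section complex_borel.
Variable R : realType.

Definition complexBorel := g_sigma_algebraType (@open R[i]^o).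

HB.instance Definition _ := isPointed.Build R[i] 0.
HB.instance Definition complex_isMeasurable :
    isMeasurable default_measure_display R[i] :=
  @isMeasurable.Build _ complexBorel (@measurable _ complexBorel)
    measurable0 (@measurableC _ _) (@bigcupT_measurable _ _).

End complex_borel.

(* The norm of [R[i]] takes its values in [R[i]]; [normc] is the modulus as an
   element of [R]. *)
Definition controlled_second_moment {R : realType} {d : measure_display}
    {T : measurableType d} (P : probability T R) (kappa : R)
    (x : {RV P >-> R[i]}) : Prop :=
  ('E_P[fun t => (normc (x t) ^+ 2)%R] <= kappa%:E)%E /\
  forall z w : R[i],
    ((kappa^-1 * complex.Re z ^+ 2)%:E <=
     'E_P[fun t => (complex.Re (z * x t - w) ^+ 2 *
                    \1_[set s | normc (x s) <= kappa] t)%R])%E.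

Definition identically_distributed {R : realType} {d d' : measure_display}
    {T : measurableType d} {T' : measurableType d'}
    (P : probability T R) (P' : probability T' R)
    (x : {RV P >-> R[i]}) (y : {RV P' >-> R[i]}) : Prop :=
  forall A : set R[i], measurable A -> distribution P x A = distribution P' y A.

Definition mutually_independent {R : realType} {d : measure_display}
    {T : measurableType d} (P : probability T R) (I : finType)
    (X : I -> {RV P >-> R[i]}) : Prop :=
  forall (J : {set I}) (A : I -> set R[i]), (forall i, measurable (A i)) ->
    P (\bigcap_(i in [set` J]) (X i @^-1` A i)) =
    (\prod_(i in J) P (X i @^-1` A i))%E.

Definition iid_copies {R : realType} {d d' : measure_display}
    {T : measurableType d} {T' : measurableType d'}
    (P : probability T R) (P' : probability T' R) (n : nat)
    (x : {RV P >-> R[i]}) (X : 'I_n -> {RV P' >-> R[i]}) : Prop :=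
  mutually_independent X /\ forall i, identically_distributed (X i) x.

Definition random_walk {R : realType} {T : Type} (n : nat)
    (X : 'I_n -> T -> R[i]) (v : 'rV[R[i]]_n) (t : T) : R[i] :=
  \sum_(i < n) v 0 i * X i t.

Definition closed_disk {R : realType} (z : R[i]) (r : R) : set R[i] :=
  [set u | normc (u - z) <= r].

Definition small_ball {R : realType} {d : measure_display}
    {T : measurableType d} (P : probability T R) (n : nat) (r : R)
    (X : 'I_n -> {RV P >-> R[i]}) (v : 'rV[R[i]]_n) : \bar R :=
  ereal_sup [set P (random_walk X v @^-1` closed_disk z r) | z in [set: R[i]]].

Definition euclidean_norm {R : realType} (n : nat) (v : 'rV[R[i]]_n) : R :=
  Num.sqrt (\sum_(i < n) normc (v 0 i) ^+ 2).

Definition sup_norm {R : realType} (n : nat) (v : 'rV[R[i]]_n) : R :=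
  \big[Num.max/0]_(i < n) normc (v 0 i).

(* The set $S_{n,x,\beta,p}$, computed from i.i.d. copies [X] of [x]; it does not
   depend on the choice of the copies. *)
Definition concentrated_vectors {R : realType} {d : measure_display}
    {T : measurableType d} (P : probability T R) (n : nat)
    (X : 'I_n -> {RV P >-> R[i]}) (beta p : R) : set 'rV[R[i]]_n :=
  [set v | euclidean_norm v = 1 /\ (p%:E <= small_ball beta X v)%E].

(* Main.v *)
(** Rescale so that the precision becomes a constant, round the coordinates of
    [v] to a grid, sending the small ones to 0, and replace the step by one with
    finitely many values. Conditionally on the set of indices where the step is
    bounded, the walk has bounded and nondegenerate steps.

    Consider coordinates of [v] of nearly equal values, split into [m] blocks of
    length a small power of [n]. Given two independent copies of the steps, a fair
    coin in each block decides which copy is used there; the walk then becomes a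
    sum over a random set of blocks, and an LYM inequality bounds its small ball
    probability by [m^(-1/2)] times the average of those of the single blocks.
    Symmetrising a block [b] shows that a random linear relation between the
    coordinates in [b] holds with probability at least [p * m^(1/2)], up to small
    powers of [n]. Since each such relation determines, up to few grid points, one
    coordinate from the others, on average this coordinate is one of at most
    [n^(-1/2 + eps) / p] popular values.

    Removing the coordinates one by one and averaging over the orders of removal,
    this bounds the number of roundings. When fewer than [n^(1-eps/100)]
    coordinates are left (or when the rounding has so few nonzero coordinates), a
    single pair of blocks is used, and the count is [exp (o(n))]. *)

(* Comparing a sum with an independent copy of itself bounds only the square of its small ball
   probability. Each block is therefore split into two halves: a collision of one half with the
   other is bounded by the mean of the two self-collisions, which is linear in [p]. Moreover, the
   factor m^(-1/2) must multiply the small ball probability of a block, not replace it: the LYM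
   bound is applied to sets of blocks avoiding one block [j], whose own randomness stays available
   for the second factor.

   The rule choosing the coordinates to remove may not depend on the vector being counted. It sees
   the remaining set and one label per coordinate, recording dyadic size and position up to constant
   relative precision. Fixing all labels in advance costs the n-th power of their number, which is
   of order log(1/beta) and so at most n^(eps/2) up to constants. When few coordinates remain the
   rule ignores labels, as this cost would exceed exp(o(n)). *)
Require Import Defs.
From mathcomp Require Import all_boot all_order all_algebra finmap.
From mathcomp Require Import all_classical all_reals all_analysis.
From mathcomp Require Import complex.
From mathcomp Require Import measurable_realfun.
From mathcomp Require Import ring lra zify.

Set Implicit Arguments.
Unset Strict Implicit.
Unset Printing Implicit Defensive.

Import Order.TTheory GRing.Theory Num.Theory.
Import numFieldTopology.Exports numFieldNormedType.Exports.
Import ComplexField.Normc.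

Local Open Scope ring_scope.

(** * Finite product laws *)

Section FiniteExpectation.
Variables (R : realFieldType) (I F : finType).
Implicit Types (mu : F -> R) (w : I -> F -> R) (phi psi : {ffun I -> F}).
Implicit Types (B : {set I}).

Definition merge B phi psi : {ffun I -> F} :=
  [ffun i => if i \in B then phi i else psi i].

Lemma mergeK B phi psi :
  merge B (merge B phi psi) (merge B psi phi) = phi.
Proof. by apply/ffunP => i; rewrite !ffunE; case: (i \in B). Qed.

(** Exchanging the coordinates in [B] is an involution on pairs, and it preserves the weights when
    [w1 i] and [w2 i] are proportional for [i] in [B]. They are equal in [Ex_swap]; in [truncate]
    the second is the first one normalised. *)
Lemma merge_swap_sum B w1 w2 (G : {ffun I -> F} -> {ffun I -> F} -> R) :
  (forall i, i \in B -> forall a b, w1 i a * w2 i b = w1 i b * w2 i a) ->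
  \sum_(phi : {ffun I -> F}) \sum_(psi : {ffun I -> F}) (\prod_i w1 i (phi i)) * (\prod_i w2 i (psi i)) * G phi psi =
  \sum_(phi : {ffun I -> F}) \sum_(psi : {ffun I -> F}) (\prod_i w1 i (phi i)) * (\prod_i w2 i (psi i)) *
     G (merge B psi phi) (merge B phi psi).
Proof.
move=> w12; rewrite !pair_bigA /=.
pose h (p : {ffun I -> F} * {ffun I -> F}) := (merge B p.2 p.1, merge B p.1 p.2).
have hK : involutive h.
  by case=> a b; rewrite /h /= !mergeK.
rewrite (reindex_inj (inv_inj hK)) /=; apply: eq_bigr => -[phi psi] _ /=.
congr (_ * _); rewrite -!big_split /=; apply: eq_bigr => i _; rewrite !ffunE.
by case: ifP => // iB; rewrite w12.
Qed.

Definition Ex mu (g : {ffun I -> F} -> R) : R :=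
  \sum_(phi : {ffun I -> F}) (\prod_i mu (phi i)) * g phi.

Variable mu : F -> R.
Hypothesis mu0 : forall a, 0 <= mu a.
Hypothesis mu1 : \sum_a mu a = 1.
Implicit Types g : {ffun I -> F} -> R.

Lemma Ex_prod (h : I -> F -> R) :
  Ex mu (fun phi => \prod_i h i (phi i)) = \prod_i \sum_a mu a * h i a.
Proof.
rewrite bigA_distr_bigA; apply: eq_bigr => phi _.
by rewrite -big_split.
Qed.

Lemma Ex_const c : Ex mu (fun=> c) = c.
Proof.
rewrite /Ex -mulr_suml -[RHS]mul1r; congr (_ * _).
by rewrite -(bigA_distr_bigA (fun=> mu)) /= big1.
Qed.

Lemma Ex_le g1 g2 : (forall phi, g1 phi <= g2 phi) -> Ex mu g1 <= Ex mu g2.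
Proof.
by move=> le12; apply: ler_sum => phi _; apply: ler_wpM2l => //; apply: prodr_ge0.
Qed.

Lemma Ex_ge0 g : (forall phi, 0 <= g phi) -> 0 <= Ex mu g.
Proof. by move=> g0; apply: sumr_ge0 => phi _; rewrite mulr_ge0 // prodr_ge0. Qed.

Lemma Ex_le_const g c : (forall phi, g phi <= c) -> Ex mu g <= c.
Proof. by move=> gc; rewrite -[leRHS]Ex_const; apply: Ex_le. Qed.

Lemma eq_Ex g1 g2 : g1 =1 g2 -> Ex mu g1 = Ex mu g2.
Proof. by move=> e; apply: eq_bigr => phi _; rewrite e. Qed.

Lemma ExD g1 g2 : Ex mu (fun phi => g1 phi + g2 phi) = Ex mu g1 + Ex mu g2.
Proof. by rewrite -big_split; apply: eq_bigr => phi _; rewrite mulrDr. Qed.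

Lemma ExZ c g : Ex mu (fun phi => c * g phi) = c * Ex mu g.
Proof. by rewrite /Ex mulr_sumr; apply: eq_bigr => phi _; rewrite mulrCA. Qed.

Lemma ExZr c g : Ex mu (fun phi => g phi * c) = Ex mu g * c.
Proof. by rewrite /Ex mulr_suml; apply: eq_bigr => phi _; rewrite mulrA. Qed.

Lemma Ex_sum (J : Type) (r : seq J) (P : pred J) (g : J -> {ffun I -> F} -> R) :
  Ex mu (fun phi => \sum_(j <- r | P j) g j phi) = \sum_(j <- r | P j) Ex mu (g j).
Proof. by rewrite exchange_big; apply: eq_bigr => phi _; rewrite mulr_sumr. Qed.

Lemma Ex_exchange (G : {ffun I -> F} -> {ffun I -> F} -> R) :
  Ex mu (fun phi => Ex mu (G phi)) = Ex mu (fun psi => Ex mu (G^~ psi)).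
Proof.
rewrite /Ex; under eq_bigr do rewrite mulr_sumr.
rewrite exchange_big; apply: eq_bigr => psi _; rewrite mulr_sumr.
by apply: eq_bigr => phi _; rewrite mulrCA.
Qed.

Lemma Ex_swap B (G : {ffun I -> F} -> {ffun I -> F} -> R) :
  Ex mu (fun phi => Ex mu (G phi)) =
  Ex mu (fun phi => Ex mu (fun psi => G (merge B psi phi) (merge B phi psi))).
Proof.
have E (G' : {ffun I -> F} -> {ffun I -> F} -> R) :
    Ex mu (fun phi => Ex mu (G' phi)) =
    \sum_(phi : {ffun I -> F}) \sum_(psi : {ffun I -> F}) (\prod_i mu (phi i)) * (\prod_i mu (psi i)) * G' phi psi.
  rewrite /Ex; apply: eq_bigr => phi _; rewrite mulr_sumr.
  by apply: eq_bigr => psi _; rewrite mulrA.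
rewrite !E; apply: (@merge_swap_sum B (fun=> mu) (fun=> mu)) => i _ a b.
by rewrite mulrC.
Qed.

(** A substitute for conditioning on the coordinates outside [B]: those inside are redrawn
    independently. *)
Lemma Ex_resample B g :
  Ex mu g = Ex mu (fun phi => Ex mu (fun psi => g (merge B psi phi))).
Proof.
rewrite -(Ex_swap B (fun phi _ => g phi)); apply: eq_Ex => phi.
by rewrite Ex_const.
Qed.

Lemma Ex2_resample B (G : {ffun I -> F} -> {ffun I -> F} -> R) :
  Ex mu (fun phi => Ex mu (G phi)) =
  Ex mu (fun phi => Ex mu (fun psi => Ex mu (fun phi' => Ex mu (fun psi' =>
    G (merge B phi' phi) (merge B psi' psi))))).
Proof.
rewrite (Ex_resample B); apply: eq_Ex => phi.
rewrite [RHS](Ex_exchange (fun psi phi' => Ex mu (fun psi' =>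
  G (merge B phi' phi) (merge B psi' psi)))).
by apply: eq_Ex => phi'; rewrite (Ex_resample B).
Qed.

Lemma Ex2_le (G1 G2 : {ffun I -> F} -> {ffun I -> F} -> R) :
  (forall phi psi, G1 phi psi <= G2 phi psi) ->
  Ex mu (fun phi => Ex mu (G1 phi)) <= Ex mu (fun phi => Ex mu (G2 phi)).
Proof. by move=> G12; apply: Ex_le => phi; apply: Ex_le. Qed.

End FiniteExpectation.

(** * An LYM inequality *)

Lemma leq_bin_mid m t : ('C(m.*2, t) <= 'C(m.*2, m))%N.
Proof.
have low s : (s <= m)%N -> ('C(m.*2, m - s) <= 'C(m.*2, m))%N.
  elim: s => [|s IHs] sm; first by rewrite subn0.
  apply: leq_trans (IHs (ltnW sm)).
  have := mul_bin_left m.*2 (m - s.+1).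
  have -> : (m - s.+1).+1 = (m - s)%N by lia.
  move: ('C(_, _)) ('C(_, _)) => x y e.
  have lt : (m - s <= m.*2 - (m - s.+1))%N by lia.
  rewrite -(@leq_pmul2l (m - s)); last by lia.
  by rewrite e leq_mul2r lt orbT.
case: (leqP t m) => tm; first by rewrite -(subKn tm) low // leq_subr.
case: (leqP t m.*2) => t2; last by rewrite bin_small.
rewrite -(bin_sub t2); have -> : (m.*2 - t = m - (t - m))%N by lia.
by apply: low; lia.
Qed.

(** Consecutive central coefficients have ratio 2(2m+1)/(m+1), and the induction closes by
    (2m+1)(2m+3) <= 4(m+1)^2. *)
Lemma central_bin_bound m : (m.*2.+1 * 'C(m.*2, m) ^ 2 <= 4 ^ m.*2)%N.
Proof.
elim: m => [|m IHm] //.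
have e : (m.+1 * 'C(m.+1.*2, m.+1) = 2 * m.*2.+1 * 'C(m.*2, m))%N.
  have := mul_bin_down m.*2.+1 m; have := mul_bin_diag m.*2.+2 m.
  rewrite doubleS /= => <-; have -> : (m.*2.+1 - m = m.+1)%N by lia.
  by move=> e; rewrite -[in RHS]mulnA e -mul2n; nia.
rewrite -(@leq_pmul2l (m.+1 ^ 2)) ?expn_gt0 // mulnCA -expnMn e.
rewrite doubleS 2!(expnS 4).
move: ('C(_, _)) IHm => c; set N := (4 ^ m.*2)%N => IHm.
have : (m.*2.+1 * m.*2.+3 <= 4 * m.+1 ^ 2)%N by rewrite -mul2n; nia.
move=> h; apply: (@leq_trans (4 * (4 * m.+1 ^ 2) * N)); last by rewrite -!mulnA mulnC; lia.
apply: (@leq_trans (4 * (m.*2.+1 * m.*2.+3) * N)); last by rewrite leq_mul2r leq_mul2l h !orbT.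
have -> : (m.*2.+3 * (2 * m.*2.+1 * c) ^ 2 = 4 * (m.*2.+1 * m.*2.+3) * (m.*2.+1 * c ^ 2))%N.
  by rewrite -!mulnn; ring.
by rewrite leq_mul2l IHm orbT.
Qed.

(** The bound 2^n / sqrt n on a binomial coefficient, squared to stay in [nat]. Odd [n] reduces to n
    - 1 by Pascal's rule. *)
Lemma bin_sqr_bound n t : (n * 'C(n, t) ^ 2 <= 4 ^ n)%N.
Proof.
have [e|o] := boolP (odd n); last first.
  have -> : n = (n./2).*2 by rewrite even_halfK.
  move: (n./2) => m; apply: leq_trans (central_bin_bound m).
  by apply: leq_mul; rewrite ?leq_exp2r ?leq_bin_mid.
have -> : n = (n./2).*2.+1 by rewrite -[LHS]odd_double_half e.
move: (n./2) => m; case: t => [|t].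
  rewrite bin0 muln1; apply: (leq_trans (ltnW (ltn_expl _ (ltnSn 1)))).
  by rewrite leq_exp2r.
rewrite binS; apply: (@leq_trans (m.*2.+1 * (2 * 'C(m.*2, m)) ^ 2)).
  rewrite leq_mul2l leq_exp2r //; apply/orP; right.
  by have := leq_bin_mid m t; have := leq_bin_mid m t.+1; lia.
by rewrite expnMn mulnCA (expnS 4) leq_mul2l central_bin_bound.
Qed.

Section LubellSum.
Variables (R : realFieldType) (K : finType).
Implicit Types (G T : {set K}) (g : {set K} -> R).

(* The expected value of [\sum_T g T], the sum being over a uniformly random
   maximal chain of subsets of [G]. *)
Definition lubell G g : R :=
  \sum_(T : {set K} | T \subset G) g T / ('C(#|G|, #|T|))%:R.

(** A random maximal chain read from the top: it contains [G], then continues below [G :\ j] for a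
    uniform [j]. *)
Lemma lubellE G g N : #|G| = N.+1 ->
  lubell G g = g G + (N.+1%:R)^-1 * \sum_(j in G) lubell (G :\ j) g.
Proof.
move=> cG; rewrite /lubell.
have -> : \sum_(j in G) \sum_(T : {set K} | T \subset G :\ j)
      g T / 'C(#|G :\ j|, #|T|)%:R =
    \sum_(T : {set K} | T \subset G) (N.+1 - #|T|)%:R * (g T / 'C(N, #|T|)%:R).
  rewrite (exchange_big_dep (fun T : {set K} => T \subset G)) /=; last first.
    by move=> j T _ TG; apply: fintype.subset_trans TG (finset.subD1set _ _).
  apply: eq_bigr => T TG; rewrite -cG -(cardsDS TG) mulr_natl -sumr_const.
  apply: eq_big => [j|j /andP[jG _]]; first by rewrite subsetD1 TG inE andbC.
  have : #|G :\ j|.+1 = N.+1 by rewrite -cG (cardsD1 j G) jG.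
  by case=> ->.
rewrite (bigD1 G) //= cG binn divr1; congr (_ + _).
rewrite [in RHS](bigD1 G) //= cG subnn mul0r add0r mulr_sumr.
apply: eq_bigr => T /andP[TG TnG].
have tN : (#|T| <= N)%N.
  by rewrite -ltnS -cG proper_card // finset.properEneq TnG.
have := mul_bin_down N.+1 #|T|; rewrite /= => /(congr1 (fun m => m%:R : R)).
rewrite !natrM => e.
have p1 : 'C(N, #|T|)%:R != 0 :> R by rewrite pnatr_eq0 -lt0n bin_gt0.
have p2 : 'C(N.+1, #|T|)%:R != 0 :> R by rewrite pnatr_eq0 -lt0n bin_gt0 leqW.
have p3 : N.+1%:R != 0 :> R by rewrite pnatr_eq0.
apply: (mulfI p1); apply: (mulfI p3); rewrite mulrA e; field.
by rewrite p1 p2 nat1r p3.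
Qed.

Lemma lubell0 g : lubell finset.set0 g = g finset.set0.
Proof.
rewrite /lubell (big_pred1 finset.set0) => [|T]; last by rewrite finset.subset0.
by rewrite cards0 bin0 divr1.
Qed.

Lemma le_lubell G g1 g2 :
  (forall T, T \subset G -> g1 T <= g2 T) -> lubell G g1 <= lubell G g2.
Proof. by move=> le12; apply: ler_sum => T TG; rewrite ler_wpM2r ?le12. Qed.

Variables (d : K -> R) (lam h0 a b : R).
Hypothesis d0 : forall k, 0 <= d k.
Hypothesis lam0 : 0 < lam.

Let h T := h0 + \sum_(k in T) d k.
(** Potential for [lubell_strip]: it bounds the number of steps of size at least [lam] that a
    descending path at height [x] can still start inside the strip. The cap makes it constant above
    [b]. *)
Let kk x : R := if x < a then 0 else Num.min ((x - a) / lam + 1) ((b - a) / lam + 1).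
Hypothesis ab : a <= b.

Let kk_ge0 x : 0 <= kk x.
Proof.
rewrite /kk; case: ltP => // ax; rewrite le_min !addr_ge0 ?ler01 ?divr_ge0 ?subr_ge0 //.
all: exact: ltW.
Qed.

Let kk_mono x y : x <= y -> kk x <= kk y.
Proof.
move=> xy; have := kk_ge0 y; rewrite /kk; case: (ltP x a) => // ax.
rewrite ltNge (le_trans ax xy) /= => _.
rewrite le_min !ge_min lexx orbT andbT lerD2r ler_pM2r ?invr_gt0 //.
by rewrite lerB.
Qed.

Let kk_drop x e : a <= x <= b -> lam <= e -> kk (x - e) <= kk x - 1.
Proof.
move=> /andP[ax xb] le; rewrite /kk (ltNge x) ax /=.
have -> : Num.min ((x - a) / lam + 1) ((b - a) / lam + 1) = (x - a) / lam + 1.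
  by apply: min_l; rewrite lerD2r ler_pM2r ?invr_gt0 // lerB.
rewrite addrK; case: ltP => h1; first by rewrite divr_ge0 ?subr_ge0 // ltW.
rewrite ge_min; apply/orP; left.
rewrite -lerBrDr -[leRHS](mulfK (lt0r_neq0 lam0)) ler_pM2r ?invr_gt0 //.
by rewrite mulrBl divfK ?lt0r_neq0 // mul1r; lra.
Qed.

(* A chain spends, between two consecutive steps of size at least [lam], about
   [#|G| / r] steps in place; a strip of width [b - a] is crossed by at most
   [(b - a) / lam + 1] large steps. *)
Lemma lubell_strip G :
  lubell G (fun T => (a <= h0 + \sum_(k in T) d k <= b)%R%:R) <=
  ((b - a) / lam + 1) * (#|G|.+1%:R / (#|[set k in G | lam <= d k]|.+1)%:R).
Proof.
pose r G := #|[set k in G | lam <= d k]|.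
(* A large step takes the indicator of the strip away from [kk] and lowers [r] by one. Added to the
   small steps, this gives back [kk (h G)] times ([#|G|] + 1) / ([r G] + 1). *)
have key : lubell G (fun T => (a <= h T <= b)%R%:R) <=
    kk (h G) * (#|G|.+1%:R / (r G).+1%:R).
  have [N] := ubnP #|G|; elim: N G => // N IHN G; rewrite ltnS => GN.
  have gk : ((a <= h G <= b)%R%:R : R) <= kk (h G).
    rewrite /kk; case: (boolP (a <= h G <= b)) => [/andP[ha hb]|_] /=; last exact: kk_ge0.
    rewrite ltNge ha /= le_min !lerDr !divr_ge0 ?subr_ge0 //; exact: ltW.
  case cG: #|G| => [|M].
    have /eqP -> : G == finset.set0 by rewrite -cards_eq0 cG.
    have -> : r finset.set0 = 0%N.
      by apply/eqP; rewrite cards_eq0; apply/eqP/setP => k; rewrite !inE.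
    rewrite lubell0 divr1 mulr1.
    by move/eqP: cG gk; rewrite cards_eq0 => /eqP ->.
  rewrite (lubellE _ cG).
  pose gG : R := (a <= h G <= b)%R%:R.
  have hD j : j \in G -> h (G :\ j) = h G - d j.
    by move=> jG; rewrite /h [in RHS](big_setD1 j jG) /=; ring.
  have IH j : j \in G -> lubell (G :\ j) (fun T => (a <= h T <= b)%R%:R) <=
      M.+1%:R * (kk (h G - d j) / (r (G :\ j)).+1%:R).
    move=> jG; have cD : #|G :\ j| = M.
      by apply/eqP; rewrite -eqSS -cG (cardsD1 j G) jG.
    apply: le_trans (IHN _ _) _; first by rewrite cD -cG.
    by rewrite cD hD // mulrCA.
  have rD j : j \in G -> (r (G :\ j) + (lam <= d j)%R)%N = r G.
    move=> jG; rewrite /r; case: (boolP (lam <= d j)) => lj.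
      rewrite (cardsD1 j [set k in G | lam <= d k]) inE jG lj /= addnC; congr (_ + _)%N.
      by apply: eq_card => k; rewrite !inE andbA.
    rewrite /= addn0; apply: eq_card => k; rewrite !inE.
    by case: eqP => [->|] //=; rewrite (negPf lj) andbF.
  apply: le_trans (_ : gG + \sum_(j in G) kk (h G - d j) / (r (G :\ j)).+1%:R <= _).
    rewrite lerD2l ler_pdivrMl ?ltr0n // mulr_sumr; exact: ler_sum.
  rewrite (bigID (fun j => lam <= d j)) /=.
  have cgood : #|[pred j | (j \in G) && (lam <= d j)]| = r G.
    by apply: eq_card => j; rewrite !inE.
  have cbad : #|[pred j | (j \in G) && ~~ (lam <= d j)]| = (M.+1 - r G)%N.
    rewrite -cG /r -cardsDS; last by apply/fintype.subsetP => k; rewrite inE => /andP[].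
    apply: eq_card => k; rewrite !inE; case: (k \in G) => //=.
    by rewrite andbT.
  have rM : (r G <= M.+1)%N.
    by rewrite -cG subset_leq_card //; apply/fintype.subsetP => k; rewrite inE => /andP[].
  have bad : \sum_(j in G | ~~ (lam <= d j)) kk (h G - d j) / (r (G :\ j)).+1%:R <=
      (M.+1 - r G)%:R * (kk (h G) / (r G).+1%:R).
    rewrite -cbad mulr_natl -sumr_const; apply: ler_sum => j /andP[jG lj].
    have := rD _ jG; rewrite (negPf lj) addn0 => ->.
    by rewrite ler_wpM2r // kk_mono // gerBl.
  have good : \sum_(j in G | lam <= d j) kk (h G - d j) / (r (G :\ j)).+1%:R <=
      (r G)%:R * ((kk (h G) - gG) / (r G)%:R).
    rewrite -[X in X%:R * _]cgood mulr_natl -sumr_const; apply: ler_sum => j /andP[jG lj].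
    have := rD _ jG; rewrite lj addn1 => ->.
    rewrite ler_wpM2r //; rewrite /gG; case: (boolP (a <= h G <= b)) => hG /=.
      exact: kk_drop.
    by rewrite subr0 kk_mono // gerBl.
  apply: le_trans (_ : gG + ((r G)%:R * ((kk (h G) - gG) / (r G)%:R) +
     (M.+1 - r G)%:R * (kk (h G) / (r G).+1%:R)) <= _).
    by rewrite lerD2l lerD.
  rewrite natrB //.
  have p : (r G).+1%:R != 0 :> R by rewrite pnatr_eq0.
  have [r0|rn0] := eqVneq (r G) 0%N.
    rewrite r0 mul0r add0r subr0 !divr1.
    move: gk; rewrite -/gG -[M.+2%:R]nat1r; nra.
  have p' : (r G)%:R != 0 :> R by rewrite pnatr_eq0.
  rewrite le_eqVlt; apply/orP; left; apply/eqP.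
  rewrite -[M.+2%:R]nat1r -[(r G).+1%:R]nat1r in p *; field.
  by rewrite p p'.
apply: le_trans key _; rewrite ler_wpM2r ?divr_ge0 //.
rewrite /kk; case: ltP => _; last by rewrite ge_min lexx orbT.
by rewrite addr_ge0 ?divr_ge0 ?subr_ge0 // ltW.
Qed.

End LubellSum.

(** Since m + 1 <= 2m, a Bernoulli increment of parameter [q'] lowers the mean of the inverse at
    least as much as the fixed increment [q / 2]. *)
Lemma neg_moment_step (R : realFieldType) (q q' m : R) :
  0 <= q -> q <= q' -> q' <= 1 -> 1 <= m ->
  (1 - q') / m + q' / (m + 1) <= (m + q / 2)^-1.
Proof.
move=> q0 qq' q1 m1.
have m0 : 0 < m by lra.
rewrite -[leRHS]mul1r ler_pdivlMr; last by lra.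
rewrite -subr_ge0.
have -> : 1 - ((1 - q') / m + q' / (m + 1)) * (m + q / 2) =
   (q' * m - q * m / 2 - q / 2 + q' * q / 2) / (m * (m + 1)).
  field; apply/andP; split; lra.
apply: divr_ge0; nra.
Qed.

(** * Small ball probability of a sum of blocks *)

Section BlockChain.
Variables (R : rcfType) (I F K : finType) (V : zmodType).
Variables (mu : F -> R) (blk : I -> K) (X : K -> {ffun I -> F} -> V).
Variables (prj : V -> R) (hit : pred V) (a b Lam lam q : R) (Q : K -> R).
Hypothesis mu0 : forall c, 0 <= mu c.
Hypothesis mu1 : \sum_c mu c = 1.
Hypothesis X_blk : forall k (phi psi : {ffun I -> F}),
  (forall i, blk i = k -> phi i = psi i) -> X k phi = X k psi.
Hypothesis prjD : {morph prj : x y / x + y}.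
Hypothesis hit_strip : forall w, hit w -> a <= prj w <= b.
Hypothesis Lam_bound : forall k phi, `|prj (X k phi)| <= Lam.
Hypothesis lam0 : 0 < lam.
Hypothesis ab : a <= b.
Hypothesis Lam0 : 0 <= Lam.
Hypothesis Q_bound : forall k w, Ex mu (fun phi => (hit (w + X k phi))%:R) <= Q k.
Hypothesis q0 : 0 < q.
Hypothesis K0 : (0 < #|K|)%N.
Let gd phi psi k := lam <= `|prj (X k phi) - prj (X k psi)|.
Hypothesis q_bound : forall k,
  q <= Ex mu (fun phi => Ex mu (fun psi => (gd phi psi k)%:R)).

Implicit Types (phi psi : {ffun I -> F}) (T : {set K}) (k : K).

Let B T := [set i | blk i \in T].

Let X_merge T phi psi k :
  X k (merge (B T) phi psi) = if k \in T then X k phi else X k psi.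
Proof.
by case: ifP => kT; apply: X_blk => i ik; rewrite ffunE inE ik kT.
Qed.

(** Negative first moment of the number of blocks where the two copies differ by at least [lam].
    Blocks are independent, so one is redrawn at a time; [s] stands for the good ones already
    met. *)
Let good_moment s T : 1 <= s ->
  Ex mu (fun phi => Ex mu (fun psi => (s + #|[set k in T | gd phi psi k]|%:R)^-1)) <=
  (s + q * #|T|%:R / 2)^-1.
Proof.
have [N] := ubnP #|T|; elim: N T s => // N IHN T s; rewrite ltnS => TN s1.
have [->|[k kT]] := set_0Vmem T.
  rewrite cards0 mulr0 mul0r addr0; apply: Ex_le_const => // phi.
  apply: Ex_le_const => // psi; 
  have -> : [set k in finset.set0 | gd phi psi k] = finset.set0.
    by apply/setP => k; rewrite !inE.
  by rewrite cards0 addr0.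
have cT : #|T| = #|T :\ k|.+1 by rewrite (cardsD1 k T) kT.
have TN' : (#|T :\ k| < N)%N by rewrite -cT.
pose r phi psi : R := #|[set l in T :\ k | gd phi psi l]|%:R.
pose e phi psi : R := (gd phi psi k)%:R.
have rE phi psi : #|[set l in T | gd phi psi l]|%:R = r phi psi + e phi psi.
  rewrite /r /e (cardsD1 k) inE kT /= natrD addrC; congr (_%:R + _).
  by apply: eq_card => l; rewrite !inE andbA.
pose q' := Ex mu (fun phi => Ex mu (fun psi => e phi psi)).
have q'1 : q' <= 1.
  by do 2![apply: Ex_le_const => // ?]; rewrite /e; case: (gd _ _ _).
have step : Ex mu (fun phi => Ex mu (fun psi => (s + #|[set k in T | gd phi psi k]|%:R)^-1))
   = (1 - q') * Ex mu (fun phi => Ex mu (fun psi => (s + r phi psi)^-1))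
     + q' * Ex mu (fun phi => Ex mu (fun psi => (s + 1 + r phi psi)^-1)).
  rewrite (Ex2_resample mu1 (B [set k])).
  rewrite -!ExZ -ExD; apply: eq_Ex => phi; rewrite -!ExZ -ExD; apply: eq_Ex => psi.
  transitivity (Ex mu (fun phi' => Ex mu (fun psi' =>
     (s + r phi psi)^-1 + e phi' psi' * ((s + 1 + r phi psi)^-1 - (s + r phi psi)^-1)))).
    apply: eq_Ex => phi'; apply: eq_Ex => psi'; rewrite rE.
    have -> : r (merge (B [set k]) phi' phi) (merge (B [set k]) psi' psi) = r phi psi.
      rewrite /r; congr (_%:R); apply: eq_card => l; rewrite !inE /gd !X_merge inE.
      by case: eqP.
    have -> : e (merge (B [set k]) phi' phi) (merge (B [set k]) psi' psi) = e phi' psi'.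
      by rewrite /e /gd !X_merge !inE eqxx.
    rewrite /e; case: (gd _ _ _) => /=; last by rewrite mul0r !addr0.
    by rewrite mul1r [RHS]addrC subrK; congr (_^-1); ring.
  under eq_Ex do rewrite ExD Ex_const // ExZr.
  by rewrite ExD Ex_const // ExZr -/q'; ring.
rewrite step.
have q'0 : q <= q' by exact: q_bound.
apply: le_trans (_ : (1 - q') / (s + q * #|T :\ k|%:R / 2) +
   q' / (s + 1 + q * #|T :\ k|%:R / 2) <= _).
  apply: lerD; apply: ler_wpM2l; rewrite ?subr_ge0 //.
  - exact: IHN.
  - exact: le_trans (ltW q0) q'0.
  - by apply: IHN => //; rewrite ler_wpDr.
have t0 : 0 <= q * #|T :\ k|%:R / 2 by rewrite mulr_ge0 // mulr_ge0 // ltW.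
rewrite cT -[#|_|.+1%:R]nat1r.
have -> : s + q * (1 + #|T :\ k|%:R) / 2 = s + q * #|T :\ k|%:R / 2 + q / 2.
  by ring.
rewrite [s + 1 + _]addrAC; apply: neg_moment_step => //; first exact: ltW.
by rewrite (le_trans s1) // lerDl.
Qed.

Let m := #|K|.
Let khat := (b - a + 2 * Lam) / lam + 1.

Let lo phi psi k := if prj (X k phi) <= prj (X k psi) then X k phi else X k psi.
Let hi phi psi k := if prj (X k phi) <= prj (X k psi) then X k psi else X k phi.
Let Z phi psi T := \sum_k (if k \in T then hi phi psi k else lo phi psi k).
Let Zj j phi psi T := \sum_(k | k != j) (if k \in T then hi phi psi k else lo phi psi k).

(** For fixed [phi] and [psi], the symmetric difference with the set of wrongly ordered blocks
    permutes the sets [T]. A fair choice between the copies is thus a fair choice between the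
    smaller and the larger value. *)
Let oriented phi psi :
  \sum_(T : {set K}) (hit (\sum_k X k (merge (B T) psi phi)))%:R =
  \sum_(T : {set K}) (hit (Z phi psi T))%:R :> R.
Proof.
pose O := [set k | ~~ (prj (X k phi) <= prj (X k psi))].
pose f T := [set k | (k \in T) (+) (k \in O)].
have fK : involutive f.
  by move=> T; apply/setP => k; rewrite !inE -addbA addbb addbF.
rewrite (reindex_inj (inv_inj fK)) /=; apply: eq_bigr => T _.
congr (_ (hit _))%:R; apply: eq_bigr => k _; rewrite X_merge !inE /hi /lo.
by case: (_ <= _); case: (_ \in _).
Qed.

Let sqrt_bin t : (2 ^ m)%:R^-1 <= (Num.sqrt m%:R)^-1 / 'C(m, t)%:R :> R \/ 'C(m, t) = 0%N.
Proof.
have [->|c0] := eqVneq 'C(m, t) 0%N; [by right|left].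
rewrite -invfM lef_pV2 ?posrE ?mulr_gt0 ?sqrtr_gt0 ?ltr0n ?expn_gt0 ?lt0n //.
rewrite -ler_sqr ?nnegrE ?mulr_ge0 // ?sqrtr_ge0 //.
rewrite exprMn sqr_sqrtr // -!natrX -natrM ler_nat -expnM.
  by rewrite [(m * 2)%N]mulnC expnM (_ : 2 ^ 2 = 4)%N ?bin_sqr_bound.
by rewrite -lt0n.
Qed.

(** The full set avoids no block and is paid separately by 2^-m. For any other [T] the uniform
    weight is at most m^(-1/2) / ['C(m, #|T|)], and the first step of the chain chooses the avoided
    block [j]. *)
Let subsets_avg (g : pred {set K}) :
  (2 ^ m)%:R^-1 * \sum_(T : {set K}) (g T)%:R <=
  (2 ^ m)%:R^-1 + (Num.sqrt m%:R)^-1 *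
    (m%:R^-1 * \sum_j lubell (finset.setT :\ j) (fun T => (g T)%:R)) :> R.
Proof.
have cT : #|[set: K]| = m.-1.+1 by rewrite cardsT prednK.
have := lubellE (fun T => (g T)%:R : R) cT; rewrite prednK //.
under [in X in _ = X -> _]eq_bigl do rewrite inE.
rewrite {1}/lubell (bigD1 finset.setT) //= cT binn divr1 => /addrI <-.
rewrite (bigD1 finset.setT) //= mulrDr; apply: lerD.
  by rewrite -[leRHS]mulr1 ler_wpM2l ?invr_ge0 // lern1 leq_b1.
rewrite !mulr_sumr; under [leRHS]eq_bigl do rewrite finset.subsetT /=.
apply: ler_sum => T _; rewrite mulrCA [leLHS]mulrC ler_wpM2l // prednK //.
case: (sqrt_bin #|T|) => // /eqP; rewrite -leqn0 leqNgt bin_gt0.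
by rewrite max_card.
Qed.

(** Neither [H] nor [st] reads block [j] of [phi]; redrawing this block bounds the hit by [Q j],
    uniformly in the shift [H]. *)
Let pull_block j G (H : {ffun I -> F} -> {ffun I -> F} -> {set K} -> V)
    (st : {ffun I -> F} -> {ffun I -> F} -> {set K} -> R) :
  (forall phi psi T, 0 <= st phi psi T) ->
  (forall phi' phi psi T, H (merge (B [set j]) phi' phi) psi T = H phi psi T) ->
  (forall phi' phi psi T, st (merge (B [set j]) phi' phi) psi T = st phi psi T) ->
  Ex mu (fun phi => Ex mu (fun psi =>
    lubell G (fun T => st phi psi T * (hit (H phi psi T + X j phi))%:R))) <=
  Q j * Ex mu (fun phi => Ex mu (fun psi => lubell G (st phi psi))).
Proof.
move=> st0 Hm stm; rewrite (Ex_resample mu1 (B [set j])) -ExZ.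
apply: Ex_le => // phi; rewrite Ex_exchange -ExZ; apply: Ex_le => // psi.
rewrite /lubell Ex_sum mulr_sumr; apply: ler_sum => T _.
rewrite ExZr mulrA ler_wpM2r ?invr_ge0 //.
under eq_Ex => phi' do rewrite Hm stm X_merge inE eqxx.
by rewrite ExZ mulrC ler_wpM2r.
Qed.

(* In each block, order the values of the two independent copies by their
   projections: choosing the larger one in the blocks of a set [T] makes the
   projection a nondecreasing function of [T], to which [lubell_strip] applies. *)
Lemma block_chain :
  Ex mu (fun phi => (hit (\sum_k X k phi))%:R) <=
  (2 ^ m)%:R^-1 +
  (Num.sqrt m%:R)^-1 * (m%:R^-1 * \sum_k Q k) * (4 / q * khat).
Proof.
have -> : Ex mu (fun phi => (hit (\sum_k X k phi))%:R) =
    Ex mu (fun phi => Ex mu (fun psi =>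
       (2 ^ m)%:R^-1 * \sum_(T : {set K}) (hit (Z phi psi T))%:R)).
  transitivity ((2 ^ m)%:R^-1 * \sum_(T : {set K}) Ex mu (fun phi => Ex mu (fun psi =>
      (hit (\sum_k X k (merge (B T) psi phi)))%:R))).
    under eq_bigr do rewrite -(Ex_resample mu1 _ (fun phi => (hit (\sum_k X k phi))%:R)).
    rewrite sumr_const -[X in _ * X]mulr_natl mulrA.
    have -> : #|{set K}| = (2 ^ m)%N by rewrite -cardsT -powersetT card_powerset cardsT.
    by rewrite mulVf ?mul1r // pnatr_eq0 -lt0n expn_gt0.
  rewrite -Ex_sum -ExZ; apply: eq_Ex => phi; rewrite -Ex_sum -ExZ; apply: eq_Ex => psi.
  by rewrite oriented.
have khat0 : 0 <= khat.
  by rewrite /khat addr_ge0 // divr_ge0 ?(ltW lam0) //; move: ab Lam0; lra.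
(* Dropping block [j] moves the projection by at most [Lam], so the widened strip keeps what a hit
   implies without reading that block. *)
pose st j phi psi T : R := (a - Lam <= prj (Zj j phi psi T) <= b + Lam)%R%:R.
(* Block [j] lies outside [T] and carries the smaller value. Which copy this is depends on block [j]
   itself, hence the sum over both copies. *)
apply: le_trans (_ : (2 ^ m)%:R^-1 + (Num.sqrt m%:R)^-1 * (m%:R^-1 * \sum_j
   Ex mu (fun phi => Ex mu (fun psi => lubell (finset.setT :\ j) (fun T =>
     st j phi psi T * (hit (Zj j phi psi T + X j phi))%:R)
   + lubell (finset.setT :\ j) (fun T =>
     st j phi psi T * (hit (Zj j phi psi T + X j psi))%:R)))) <= _).
  rewrite -Ex_sum -!ExZ -[leRHS]addrC -[X in _ + X](Ex_const I mu1) -ExD.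
  apply: Ex_le => // phi.
  rewrite -Ex_sum -!ExZ -[X in _ + X](Ex_const I mu1) -ExD.
  apply: Ex_le => // psi; apply: le_trans (subsets_avg _) _.
  rewrite addrC lerD2r !ler_wpM2l ?invr_ge0 ?sqrtr_ge0 //.
  apply: ler_sum => j _; rewrite /lubell -big_split; apply: ler_sum => T /= TG.
  rewrite -mulrDl ler_wpM2r ?invr_ge0 //.
  have jT : j \notin T by apply/negP => /(fintype.subsetP TG); rewrite !inE eqxx.
  have -> : Z phi psi T = Zj j phi psi T + lo phi psi j.
    by rewrite /Z (bigD1 j) //= (negPf jT) addrC.
  case: (boolP (hit _)) => [hZ|_] /=; last first.
    by rewrite addr_ge0 // mulr_ge0.
  have st1 : st j phi psi T = 1.
    have := hit_strip hZ; rewrite prjD /st => /andP[h1 h2].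
    have : `|prj (lo phi psi j)| <= Lam by rewrite /lo; case: ifP.
    rewrite ler_norml => /andP[h3 h4].
    have -> : a - Lam <= prj (Zj j phi psi T) <= b + Lam by apply/andP; split; lra.
    by [].
  rewrite st1 !mul1r; move: hZ; rewrite /lo; case: ifP => _ ->.
    by rewrite lerDl.
  by rewrite lerDr.
rewrite lerD2l -[leRHS]mulrA ler_wpM2l ?invr_ge0 ?sqrtr_ge0 //.
rewrite -[leRHS]mulrA ler_wpM2l ?invr_ge0 // mulr_suml; apply: ler_sum => j _.
under eq_Ex do rewrite ExD.
rewrite ExD.
have Zm1 phi' phi psi T : Zj j (merge (B [set j]) phi' phi) psi T = Zj j phi psi T.
  apply: eq_bigr => k kj; rewrite /lo /hi X_merge inE (negPf kj) //.
have Zm2 phi psi' psi T : Zj j phi (merge (B [set j]) psi' psi) T = Zj j phi psi T.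
  apply: eq_bigr => k kj; rewrite /lo /hi X_merge inE (negPf kj) //.
have st0 phi psi T : 0 <= st j phi psi T by [].
have Q0 : 0 <= Q j by apply: le_trans (Q_bound j 0); apply: Ex_ge0.
pose M := Ex mu (fun phi => Ex mu (fun psi => lubell (finset.setT :\ j) (st j phi psi))).
(* The widened strip allows [khat] large steps, and the mean of 1 / (1 + number of good blocks) is
   at most 2 / (q m), because q <= 1 makes up for the missing block [j]. *)
have M_le : M <= 2 / q * khat.
  apply: le_trans (_ : Ex mu (fun phi => Ex mu (fun psi => khat * m%:R *
     (1 + #|[set k in finset.setT :\ j | gd phi psi k]|%:R)^-1)) <= _).
    apply: Ex2_le => // phi psi.
    pose d k := prj (hi phi psi k) - prj (lo phi psi k).
    have d_ge0 k : 0 <= d k.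
      by rewrite /d subr_ge0 /hi /lo; case: (leP (prj (X k phi))) => // /ltW.
    have ab' : a - Lam <= b + Lam by move: ab Lam0; lra.
    have := lubell_strip (\sum_(k | k != j) prj (lo phi psi k)) d_ge0 lam0 ab'
      (finset.setT :\ j).
    have -> : (#|[set: K] :\ j|).+1 = m.
      by rewrite /m -cardsT (cardsD1 j [set: K]) inE.
    have -> : [set k in [set: K] :\ j | lam <= d k] =
              [set k in [set: K] :\ j | gd phi psi k].
      apply/setP => k; rewrite !inE; case: (k == j) => //=.
      rewrite /gd /d /hi /lo; case: (leP (prj (X k phi))) => h.
        by rewrite distrC ger0_norm // subr_ge0.
      by rewrite gtr0_norm // subr_gt0.
    rewrite -nat1r mulrA /khat; have -> : b + Lam - (a - Lam) = b - a + 2 * Lam by ring.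
    apply: le_trans; apply: le_lubell => T TG; rewrite /st.
    have -> // : prj (Zj j phi psi T) =
       \sum_(k | k != j) prj (lo phi psi k) + \sum_(k in T) d k.
    have prj0 : prj 0 = 0 by apply: (addrI (prj 0)); rewrite -prjD !addr0.
    have -> : \sum_(k in T) d k = \sum_(k | k != j) (if k \in T then d k else 0).
      rewrite -big_mkcondr /=; apply: eq_bigl => k.
      case: eqP => [->|] //=; apply/negP => /(fintype.subsetP TG).
      by rewrite !inE eqxx.
    rewrite -big_split /= /Zj (big_morph prj prjD prj0); apply: eq_bigr => k _.
    by rewrite /d; case: ifP => _; rewrite ?addr0 // addrC subrK.
  under eq_Ex do rewrite ExZ.
  rewrite ExZ; have := good_moment (finset.setT :\ j) (lexx 1).
  set E := Ex _ _ => hE.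
  have -> : 2 / q * khat = khat * m%:R * (q * m%:R / 2)^-1.
    have mn0 : m%:R != 0 :> R by rewrite pnatr_eq0 -lt0n.
    by field; rewrite mn0 lt0r_neq0.
  apply: ler_wpM2l; first by rewrite mulr_ge0.
  apply: le_trans hE _.
  have qm : 0 < q * m%:R / 2 by rewrite divr_gt0 // mulr_gt0 // ltr0n.
  rewrite lef_pV2 ?posrE //; last by rewrite ltr_wpDr ?ltr01 // !mulr_ge0 // ltW.
  have : m%:R = #|[set: K] :\ j|%:R + 1 :> R.
    by rewrite natr1 -add1n /m -cardsT (cardsD1 j [set: K]) inE.
  move=> ->; have q1 : q <= 1.
    apply: le_trans (q_bound j) _; apply: Ex_le_const => // phi.
    by apply: Ex_le_const => // psi; rewrite lern1 leq_b1.
  by rewrite mulrDr; lra.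
apply: le_trans (_ : Q j * M + Q j * M <= _).
  apply: lerD; first by apply: pull_block => // *; rewrite ?Zm1 /st ?Zm1.
  rewrite /M Ex_exchange [X in _ * X]Ex_exchange.
  by apply: (@pull_block j _ (fun psi phi T => Zj j phi psi T)
    (fun psi phi T => st j phi psi T)) => // *; rewrite ?Zm2 /st ?Zm2.
by rewrite -mulrDr ler_wpM2l //; move: M_le; lra.
Qed.

End BlockChain.

(** * Symmetrisation and popular values *)

Section ComplexModulus.
Variable R : rcfType.
Implicit Types x y : R[i].

Lemma normc_ge0 x : 0 <= normc x.
Proof. by case: x => a b; rewrite /= sqrtr_ge0. Qed.

Lemma ler_normcD x y : normc (x + y) <= normc x + normc y.
Proof. exact: le_normcD. Qed.

Lemma normcB_sym x y : normc (x - y) = normc (y - x).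
Proof. by rewrite -normcN opprB. Qed.

Lemma normc_Re x : `|complex.Re x| <= normc x.
Proof.
case: x => a b /=; rewrite -sqrtr_sqr ler_wsqrtr // lerDl; exact: sqr_ge0.
Qed.

Lemma normc_Im x : `|complex.Im x| <= normc x.
Proof.
case: x => a b /=; rewrite -sqrtr_sqr ler_wsqrtr // lerDr; exact: sqr_ge0.
Qed.

Lemma normc_le_ReIm x : normc x <= `|complex.Re x| + `|complex.Im x|.
Proof.
case: x => a b /=; rewrite -[leRHS]ger0_norm ?addr_ge0 // -[leRHS]sqrtr_sqr ler_wsqrtr //.
rewrite sqrrD !real_normK ?num_real //.
have : 0 <= `|a| * `|b| by rewrite mulr_ge0.
by lra.
Qed.

Lemma ReD x y : complex.Re (x + y) = complex.Re x + complex.Re y.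
Proof. by case: x; case: y. Qed.
Lemma ImD x y : complex.Im (x + y) = complex.Im x + complex.Im y.
Proof. by case: x; case: y. Qed.
Lemma ReN x : complex.Re (- x) = - complex.Re x.
Proof. by case: x. Qed.
Lemma ImN x : complex.Im (- x) = - complex.Im x.
Proof. by case: x. Qed.

Lemma normc_sum (J : Type) (r : seq J) (P : pred J) (g : J -> R[i]) :
  normc (\sum_(i <- r | P i) g i) <= \sum_(i <- r | P i) normc (g i).
Proof.
elim/big_rec2: _ => [|i y x _ h]; first by rewrite normc0.
by apply: le_trans (ler_normcD _ _) _; rewrite lerD2l.
Qed.

End ComplexModulus.

Section Collision.
Variables (R : realFieldType) (I F : finType) (mu : F -> R).

(** For each value, 2xy <= x^2 + y^2 with x and y its two probabilities; only finitely many values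
    occur. *)
Lemma collision_le (E : eqType) (g1 g2 : {ffun I -> F} -> E) :
  Ex mu (fun phi => Ex mu (fun psi => (g1 phi == g2 psi)%:R)) <=
  (Ex mu (fun phi => Ex mu (fun psi => (g1 phi == g1 psi)%:R)) +
   Ex mu (fun phi => Ex mu (fun psi => (g2 phi == g2 psi)%:R))) / 2.
Proof.
pose s := undup ([seq g1 phi | phi <- enum {ffun I -> F}] ++
                 [seq g2 phi | phi <- enum {ffun I -> F}]).
have s1 phi : g1 phi \in s.
  by rewrite mem_undup mem_cat; apply/orP; left; apply: map_f; rewrite mem_enum.
have s2 phi : g2 phi \in s.
  by rewrite mem_undup mem_cat; apply/orP; right; apply: map_f; rewrite mem_enum.
pose P (g : {ffun I -> F} -> E) c := Ex mu (fun phi => (g phi == c)%:R).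
have key (g h : {ffun I -> F} -> E) : (forall phi, g phi \in s) ->
    Ex mu (fun phi => Ex mu (fun psi => (g phi == h psi)%:R)) = \sum_(c <- s) P g c * P h c.
  move=> gs; transitivity (Ex mu (fun phi => Ex mu (fun psi =>
     \sum_(c <- s) (g phi == c)%:R * (h psi == c)%:R))).
    apply: eq_Ex => phi; apply: eq_Ex => psi.
    rewrite (bigD1_seq (g phi)) ?undup_uniq //= eqxx mul1r eq_sym big1 ?addr0 //.
    by move=> c; rewrite eq_sym => /negPf ->; rewrite mul0r.
  under eq_Ex => phi do rewrite Ex_sum.
  rewrite Ex_sum; apply: eq_bigr => c _.
  by under eq_Ex do rewrite ExZ; rewrite ExZr.
rewrite !key // -big_split /= ler_pdivlMr // mulr_suml; apply: ler_sum => c _.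
by have := sqr_ge0 (P g1 c - P g2 c); nra.
Qed.

End Collision.

Section Walk.
Variables (R : realType) (I F : finType) (mu : F -> R) (f : F -> R[i]).
Hypothesis mu0 : forall c, 0 <= mu c.
Hypothesis mu1 : \sum_c mu c = 1.
Implicit Types (phi psi : {ffun I -> F}) (b S : {set I}) (a : I -> R[i]).

Definition walk a b phi : R[i] := \sum_(i in b) a i * f (phi i).

Lemma walk_merge_in a b (B : {set I}) phi psi : b \subset B ->
  walk a b (merge B phi psi) = walk a b phi.
Proof.
move=> bB; apply: eq_bigr => i ib; rewrite ffunE.
by rewrite (fintype.subsetP bB _ ib).
Qed.

Lemma walk_merge_out a b (B : {set I}) phi psi : [disjoint b & B] ->
  walk a b (merge B phi psi) = walk a b psi.
Proof.
move=> bB; apply: eq_bigr => i ib; rewrite ffunE.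
by rewrite (disjointFr bB ib).
Qed.

Lemma walkU a b1 b2 phi : [disjoint b1 & b2] ->
  walk a (b1 :|: b2) phi = walk a b1 phi + walk a b2 phi.
Proof. by move=> b12; rewrite /walk -bigU //; apply: eq_bigl => i; rewrite !inE. Qed.

(** The steps outside [b] are frozen and absorbed in the shift. *)
Lemma small_ball_mono a S b (B : R) (rho : R) : b \subset S ->
  (forall z, Ex mu (fun phi => (normc (z + walk a b phi) <= rho)%R%:R) <= B) ->
  forall z, Ex mu (fun phi => (normc (z + walk a S phi) <= rho)%R%:R) <= B.
Proof.
move=> bS hB z; rewrite (Ex_resample mu1 b); apply: Ex_le_const => // phi.
have -> : S = (S :\: b) :|: b.
  by apply/setP => i; rewrite !inE; case: (boolP (i \in b)) => [/(fintype.subsetP bS) ->|_]; rewrite ?orbT ?orbF.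
have dis : [disjoint S :\: b & b].
  by rewrite finset.disjoints_subset; apply/fintype.subsetP => i; rewrite !inE => /andP[].
under eq_Ex => psi do rewrite (walkU _ _ dis) walk_merge_out // walk_merge_in // addrA.
exact: hB.
Qed.

(** With square cells of side [rho], points at distance at most [rho] lie in equal or adjacent
    cells. This gives 9 offsets, each costing half the sum of two self-collisions; points in one
    cell are at distance at most 2 [rho]. *)
Lemma symmetrize a b1 b2 (rho : R) z : 0 < rho -> [disjoint b1 & b2] ->
  Ex mu (fun phi => (normc (z + walk a (b1 :|: b2) phi) <= rho)%R%:R) <=
  9 / 2 * (Ex mu (fun phi => Ex mu (fun psi =>
             (normc (walk a b1 phi - walk a b1 psi) <= 2 * rho)%R%:R)) +
           Ex mu (fun phi => Ex mu (fun psi =>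
             (normc (walk a b2 phi - walk a b2 psi) <= 2 * rho)%R%:R))).
Proof.
move=> rho0 dis.
pose cell (w : R[i]) := (Num.floor (complex.Re w / rho), Num.floor (complex.Im w / rho)).
have floor_lt (x : R) : (Num.floor x)%:~R <= x < (Num.floor x)%:~R + 1.
  by have := floor_itv x; rewrite intrD.
have cell_near w w' : cell w = cell w' -> normc (w - w') <= 2 * rho.
  move=> [e1 e2]; apply: le_trans (normc_le_ReIm _) _.
  rewrite ReD ImD ReN ImN mulr_natl mulr2n.
  have near (x y : R) : Num.floor (x / rho) = Num.floor (y / rho) -> `|x - y| <= rho.
    move=> e; have /andP[h1 h2] := floor_lt (x / rho).
    have /andP[h3 h4] := floor_lt (y / rho).
    have -> : x - y = (x / rho - y / rho) * rho by rewrite mulrBl !divfK ?lt0r_neq0.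
    rewrite normrM (gtr0_norm rho0) -[leRHS]mul1r ler_wpM2r ?(ltW rho0) //.
    by rewrite ler_norml; move: h1 h2 h3 h4; rewrite e; lra.
  by apply: lerD; apply: near.
pose sg : seq int := [:: -1; 0; 1].
have floor_near (x y : R) : `|x - y| <= rho ->
    exists2 e, e \in sg & Num.floor (x / rho) = Num.floor (y / rho) + e.
  move=> xy; exists (Num.floor (x / rho) - Num.floor (y / rho)); last by rewrite addrC subrK.
  have /andP[h1 h2] := floor_lt (x / rho); have /andP[h3 h4] := floor_lt (y / rho).
  have : `|x / rho - y / rho| <= 1.
    by rewrite -mulrBl normrM normfV (gtr0_norm rho0) ler_pdivrMr // mul1r.
  rewrite ler_norml => /andP[h5 h6].
  have h7 : -2%:~R < (Num.floor (x / rho) - Num.floor (y / rho))%:~R :> R.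
    by rewrite intrB; lra.
  have h8 : (Num.floor (x / rho) - Num.floor (y / rho))%:~R < 2%:~R :> R.
    by rewrite intrB; lra.
  move: h7 h8; rewrite -intrN !ltr_int => h7 h8; rewrite !inE; lia.
pose c2 (e : int * int) psi := ((cell (- z - walk a b2 psi)).1 + e.1,
  (cell (- z - walk a b2 psi)).2 + e.2).
pose ee := [seq (e1, e2) | e1 <- sg, e2 <- sg].
set E1 := Ex _ _ in |- *; set E2 := Ex _ (fun phi => Ex _ _) in |- *.
set E3 := Ex _ (fun phi => Ex _ _) in |- *.
have h1 : E1 <= \sum_(e <- ee) Ex mu (fun phi => Ex mu (fun psi =>
    (cell (walk a b1 phi) == c2 e psi)%:R)).
  rewrite /E1 (Ex_resample mu1 b1) Ex_exchange -Ex_sum; apply: Ex_le => // phi.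
  rewrite -Ex_sum; apply: Ex_le => // psi.
  rewrite walkU // walk_merge_in // walk_merge_out; last by rewrite disjoint_sym.
  case: (boolP (_ <= rho)) => hit; last exact: sumr_ge0.
  have hit' : normc (walk a b1 phi - (- z - walk a b2 psi)) <= rho.
    by rewrite opprD !opprK addrCA.
  have [e1 e1s he1] : exists2 e, e \in sg & (cell (walk a b1 phi)).1 =
      (cell (- z - walk a b2 psi)).1 + e.
    apply: floor_near; rewrite -ReN -ReD; exact: le_trans (normc_Re _) hit'.
  have [e2 e2s he2] : exists2 e, e \in sg & (cell (walk a b1 phi)).2 =
      (cell (- z - walk a b2 psi)).2 + e.
    apply: floor_near; rewrite -ImN -ImD; exact: le_trans (normc_Im _) hit'.
  have ie : (e1, e2) \in ee by apply/allpairsP; exists (e1, e2).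
  rewrite (big_rem _ ie) /= /c2 -he1 -he2 -surjective_pairing eqxx lerDl.
  by apply: sumr_ge0.
apply: le_trans h1 _.
have h2 e : Ex mu (fun phi => Ex mu (fun psi => (cell (walk a b1 phi) == c2 e psi)%:R)) <=
    (E2 + E3) / 2.
  apply: le_trans (collision_le mu _ _) _.
  rewrite ler_wpM2r ?invr_ge0 // lerD //; apply: Ex2_le => // phi psi.
    by case: eqP => // /cell_near ->.
  case: eqP => // -[] /addIr h3 /addIr h4.
  have /cell_near : cell (- z - walk a b2 phi) = cell (- z - walk a b2 psi).
    by rewrite /cell h3 h4.
  have -> // : - z - walk a b2 phi - (- z - walk a b2 psi) = walk a b2 psi - walk a b2 phi.
    by ring.
  by rewrite normcB_sym => ->.
apply: le_trans (ler_sum _ (fun e _ => h2 e)) _.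
by rewrite big_const_seq /=; lra.
Qed.

End Walk.

(** * Popularity of a value in random relations *)

Section Popularity.
Variables (R : realType) (I F : finType) (mu : F -> R) (f : F -> R[i]).
Variables (kap c0 q : R).
Hypothesis mu0 : forall c, 0 <= mu c.
Hypothesis mu1 : \sum_c mu c = 1.
Hypothesis f_bound : forall c, normc (f c) <= kap.
Hypothesis nondeg : forall c', q <= \sum_c mu c * (c0 <= `|complex.Re (f c' - f c)|)%R%:R.
Implicit Types (phi psi : {ffun I -> F}) (b S : {set I}) (a : I -> R[i]).

(* The probability that a random relation [\sum_(i in b) a i * (f (phi i) - f (psi i))]
   of small size, with a substantial coefficient at [j], is satisfied by the
   value [u] in place of [a j]. *)
Definition pop (rho : R) b j a (u : R[i]) : R :=
  Ex mu (fun phi => Ex mu (fun psi =>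
    (c0 <= `|complex.Re (f (phi j) - f (psi j))|)%R%:R *
    (normc (u * (f (phi j) - f (psi j)) +
       \sum_(i in b :\ j) a i * (f (phi i) - f (psi i))) <= rho)%R%:R)).

Lemma pop_ge0 rho b j a u : 0 <= pop rho b j a u.
Proof. by apply: Ex_ge0 => // phi; apply: Ex_ge0 => // psi; rewrite mulr_ge0. Qed.

Lemma eq_pop rho b j a a' u : {in b :\ j, a =1 a'} -> pop rho b j a u = pop rho b j a' u.
Proof.
move=> aa'; apply: eq_Ex => phi; apply: eq_Ex => psi.
by congr (_ * (normc (_ + _) <= _)%R%:R); apply: eq_bigr => i /aa' ->.
Qed.

(** Once [phi] is fixed, the coordinates of [psi] are independent and each is degenerate with
    probability at most 1 - q; this is why [nondeg] is asked for every [c']. *)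
Lemma all_degenerate b :
  Ex mu (fun phi => Ex mu (fun psi =>
    \prod_i (if i \in b then (`|complex.Re (f (phi i) - f (psi i))| < c0)%R%:R else 1))) <=
  (1 - q) ^+ #|b|.
Proof.
apply: Ex_le_const => // phi.
rewrite (Ex_prod mu (fun i c =>
  if i \in b then (`|complex.Re (f (phi i) - f c)| < c0)%R%:R else 1)).
rewrite (bigID (mem b)) /= [X in _ * X]big1 ?mulr1; last first.
  by move=> i /negPf ->; under eq_bigr do rewrite mulr1.
rewrite -prodr_const; apply: ler_prod => i ib; rewrite ib.
rewrite sumr_ge0 /=; last by move=> c _; rewrite mulr_ge0.
rewrite lerBrDr -[leRHS]mu1; apply: le_trans (lerD (lexx _) (nondeg (phi i))) _.
rewrite -big_split /= ler_sum // => c _.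
by rewrite -mulrDr -[leRHS]mulr1 ler_wpM2l // ltNge -natrD lern1; case: (_ <= _).
Qed.

(** Unless all differences in [b] are degenerate, some [j] has a substantial coefficient. The
    relation survives rounding [a] to [a']: each coordinate moves by at most 1, and it multiplies a
    difference of modulus at most 2 [kap]. *)
Lemma collision_pop (rho rho' : R) b a a' :
  (forall i, i \in b -> normc (a i - a' i) <= 1) ->
  rho + #|b|%:R * (2 * kap) <= rho' ->
  Ex mu (fun phi => Ex mu (fun psi =>
     (normc (walk f a b phi - walk f a b psi) <= rho)%R%:R)) <=
  (1 - q) ^+ #|b| + \sum_(j in b) pop rho' b j a' (a' j).
Proof.
move=> aa' hrho; apply: le_trans (lerD (all_degenerate b) (lexx _)).
rewrite -Ex_sum -ExD; apply: Ex_le => // phi.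
rewrite -Ex_sum -ExD; apply: Ex_le => // psi.
case: (boolP (_ <= rho)) => hit; last first.
  apply: addr_ge0; first by apply: prodr_ge0 => i _; case: ifP.
  by apply: sumr_ge0 => i _; rewrite mulr_ge0.
case: (boolP [forall i in b, `|complex.Re (f (phi i) - f (psi i))| < c0]) => [/forall_inP good|].
  rewrite big1 => [|i _]; last by case: ifP => // /good ->.
  by rewrite lerDl sumr_ge0 // => i _; rewrite mulr_ge0.
rewrite negb_forall_in => /exists_inP[j jb]; rewrite -leNgt => gj.
apply: (@le_trans _ _ (\sum_(j in b) (c0 <= `|complex.Re (f (phi j) - f (psi j))|)%R%:R *
    (normc (a' j * (f (phi j) - f (psi j)) +
       \sum_(i in b :\ j) a' i * (f (phi i) - f (psi i))) <= rho')%R%:R)); last first.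
  by rewrite lerDr prodr_ge0 // => i _; case: ifP.
rewrite (bigD1 j) //= gj mul1r.
have -> : normc (a' j * (f (phi j) - f (psi j)) +
       \sum_(i in b :\ j) a' i * (f (phi i) - f (psi i))) <= rho'.
  rewrite -(big_setD1 j jb (F := fun i => a' i * (f (phi i) - f (psi i)))) /=.
  apply: le_trans hrho.
  have -> : \sum_(i in b) a' i * (f (phi i) - f (psi i)) =
     walk f a b phi - walk f a b psi + \sum_(i in b) (a' i - a i) * (f (phi i) - f (psi i)).
    by rewrite /walk -sumrB -big_split; apply: eq_bigr => i _ /=; ring.
  apply: le_trans (ler_normcD _ _) (lerD hit _).
  apply: le_trans (normc_sum _ _ _) _; rewrite mulr_natl -sumr_const.
  apply: ler_sum => i ib; rewrite normcM -[leRHS]mul1r ler_pM ?normc_ge0 //.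
    by rewrite normcB_sym aa'.
  apply: le_trans (ler_normcD _ _) _; rewrite normcN mulr_natl mulr2n.
  exact: lerD.
by rewrite lerDl sumr_ge0 // => i _; rewrite mulr_ge0.
Qed.

End Popularity.

Section GridCount.
Variable R : realType.

Lemma card_near (N : nat) (x r : R) : 0 <= r ->
  #|[set s : 'I_N | `|s%:R - x| <= r]|%:R <= 2 * r + 1.
Proof.
move=> r0; set A := [set s | _].
have [->|[s1 s1A]] := set_0Vmem A; first by rewrite cards0; lra.
case: (arg_minnP (fun s : 'I_N => s : nat) s1A) => s0 s0A s0min.
pose k := Num.truncn (2 * r).
have r20 : 0 <= 2 * r by rewrite mulr_ge0.
have sub s : s \in A -> (s0 <= s <= s0 + k)%N.
  move=> sA; rewrite s0min //=.
  have /andP[kl ku] := truncn_itv r20.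
  have := sA; rewrite inE ler_norml => /andP[h1 h2].
  have : s0 \in A by []. rewrite inE ler_norml => /andP[h3 h4].
  rewrite -ltnS -addnS -(ltr_nat R) natrD.
  by rewrite -/k in kl ku; lra.
have : (#|A| <= k.+1)%N.
  rewrite cardE -(size_map val) -(size_iota s0 k.+1).
  apply: uniq_leq_size; first by rewrite map_inj_uniq ?enum_uniq //; apply: val_inj.
  move=> y /mapP[s]; rewrite mem_enum => /sub sk ->.
  by rewrite mem_iota addnS ltnS.
rewrite -(ler_nat R) => /le_trans; apply.
have /andP[kl _] := truncn_itv r20.
by rewrite -/k in kl; rewrite -natr1; lra.
Qed.

End GridCount.

(** * The random set of bounded steps, and conditioning on it *)

Section RandomSubset.
Variables (R : realFieldType) (I : finType) (th : R).
Hypothesis th01 : 0 <= th <= 1.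
Implicit Types (b S : {set I}) (g : {set I} -> R).

Definition ES g : R := \sum_(S : {set I}) (\prod_i (if i \in S then th else 1 - th)) * g S.

Let wt_ge0 S : 0 <= \prod_i (if i \in S then th else 1 - th).
Proof. by apply: prodr_ge0 => i _; case: ifP => _; case/andP: th01; lra. Qed.

Lemma ES_le g1 g2 : (forall S, g1 S <= g2 S) -> ES g1 <= ES g2.
Proof. by move=> g12; apply: ler_sum => S _; rewrite ler_wpM2l. Qed.

Lemma ESD g1 g2 : ES (fun S => g1 S + g2 S) = ES g1 + ES g2.
Proof. by rewrite -big_split; apply: eq_bigr => S _; rewrite mulrDr. Qed.

Lemma ESZ c g : ES (fun S => c * g S) = c * ES g.
Proof. by rewrite /ES mulr_sumr; apply: eq_bigr => S _; rewrite mulrCA. Qed.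

Lemma ES_sum (J : Type) (r : seq J) (P : pred J) (g : J -> {set I} -> R) :
  ES (fun S => \sum_(j <- r | P j) g j S) = \sum_(j <- r | P j) ES (g j).
Proof. by rewrite exchange_big; apply: eq_bigr => S _; rewrite mulr_sumr. Qed.

Lemma ES_pow x b : ES (fun S => x ^+ #|S :&: b|) = (1 - th + th * x) ^+ #|b|.
Proof.
transitivity (\prod_(i in I) ((if i \in b then th * x else th) + (1 - th))).
  rewrite bigA_distr; apply: eq_bigr => S _.
  rewrite -[X in _ * X]prodr_const [X in _ * X]big_mkcond /= -big_split /=; apply: eq_bigr => i _.
  by rewrite !inE; case: (i \in S); case: (i \in b); rewrite /= ?mulr1.
rewrite (bigID (mem b)) /= [X in _ * X]big1 ?mulr1; last first.
  by move=> i /negPf ->; rewrite addrC subrK.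
by rewrite -prodr_const; apply: eq_bigr => i ->; rewrite addrC.
Qed.

Lemma ES_const c : ES (fun=> c) = c.
Proof.
have := ES_pow 1 finset.set0; rewrite cards0 expr0 => h.
rewrite -[RHS]mulr1 -h -ESZ; apply: eq_bigr => S _.
by rewrite finset.setI0 cards0 expr0 mulr1.
Qed.

End RandomSubset.

Section Truncation.
Variables (R : realType) (I F : finType) (w : F -> R) (f : F -> R[i]) (bd : pred F).
Hypothesis w0 : forall c, 0 <= w c.
Hypothesis w1 : \sum_c w c = 1.
Let th := \sum_(c | bd c) w c.
Hypothesis th0 : 0 < th.
Definition cond_law c : R := if bd c then w c / th else 0.
Definition trunc_val c : R[i] := if bd c then f c else 0.

Lemma cond_law_ge0 c : 0 <= cond_law c.
Proof. by rewrite /cond_law; case: ifP => // _; apply: divr_ge0 => //; apply: ltW. Qed.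

Lemma cond_law_sum : \sum_c cond_law c = 1.
Proof. by rewrite -big_mkcond /= -mulr_suml divff // lt0r_neq0. Qed.

(* Conditionally on the set of bounded steps and on the values of the other
   steps, the walk is a shifted walk with bounded steps. *)
Lemma truncate (a : I -> R[i]) (B : {set I} -> R) (rho : R) z :
  (forall S z, Ex cond_law (fun phi =>
     (normc (z + walk trunc_val a S phi) <= rho)%R%:R) <= B S) ->
  Ex w (fun phi => (normc (z + \sum_i a i * f (phi i)) <= rho)%R%:R) <= ES th B.
Proof.
move=> hB.
(* The law of step [i] splits into its bounded part, used for [i] in [S], and the rest. Expanding
   the product of these sums over [i] produces the sum over [S]. *)
pose W (S : {set I}) (i : I) c := if i \in S then (if bd c then w c else 0) else (if bd c then 0 else w c).
have sW S i : \sum_c W S i c = if i \in S then th else 1 - th.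
  rewrite /W; case: ifP => _; first by rewrite -big_mkcond.
  rewrite -w1 [in RHS](bigID bd) /= addrAC subrr add0r [RHS]big_mkcond.
  by apply: eq_bigr => c _; case: (bd c).
apply: (@le_trans _ _ (\sum_(S : {set I}) \sum_(phi : {ffun I -> F}) (\prod_i W S i (phi i)) *
   (normc (z + \sum_i a i * f (phi i)) <= rho)%R%:R)).
  rewrite le_eqVlt; apply/orP; left; apply/eqP.
  rewrite exchange_big; apply: eq_bigr => phi _ /=; rewrite -mulr_suml; congr (_ * _).
  transitivity (\prod_i ((if bd (phi i) then w (phi i) else 0) +
                         (if bd (phi i) then 0 else w (phi i)))).
    by apply: eq_bigr => i _; case: ifP; rewrite ?addr0 ?add0r.
  by rewrite bigA_distr; apply: eq_bigr => S _; apply: eq_bigr.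
apply: ler_sum => S _.
pose g (phi : {ffun I -> F}) : R := (normc (z + \sum_i a i * f (phi i)) <= rho)%R%:R.
apply: le_trans (_ : \sum_(phi : {ffun I -> F}) (\prod_i W S i (phi i)) * B S <= _); last first.
  rewrite -mulr_suml -bigA_distr_bigA /=; under eq_bigr do rewrite sW.
  by [].
have -> : \sum_(phi : {ffun I -> F}) (\prod_i W S i (phi i)) * g phi =
  \sum_(phi : {ffun I -> F}) \sum_(psi : {ffun I -> F})
     (\prod_i W S i (phi i)) * (\prod_i cond_law (psi i)) * g (merge S psi phi).
  rewrite -(@merge_swap_sum _ _ _ S (W S) (fun=> cond_law) (fun phi _ => g phi)).
    apply: eq_bigr => phi _; rewrite -mulr_suml -mulr_sumr.
    have -> : \sum_(psi : {ffun I -> F}) \prod_i cond_law (psi i) = 1.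
      rewrite -(bigA_distr_bigA (fun=> cond_law)) /= big1 // => i _.
      exact: cond_law_sum.
    by rewrite mulr1.
  move=> i iS c d; rewrite /W iS /cond_law; case: (bd c); case: (bd d); rewrite ?mul0r ?mulr0 //.
  by rewrite mulrCA mulrC.
apply: ler_sum => phi _.
under [leLHS]eq_bigr do rewrite -mulrA; rewrite -mulr_sumr ler_wpM2l //.
  apply: prodr_ge0 => i _; rewrite /W; case: ifP => _; case: ifP => _ //.
pose z' := z + \sum_(i | i \notin S) a i * f (phi i).
apply: le_trans (hB S z'); rewrite /Ex; apply: ler_sum => psi _.
case: (boolP [forall i in S, bd (psi i)]) => [/forall_inP bS|].
  apply: ler_wpM2l; first by apply: prodr_ge0 => i _; apply: cond_law_ge0.
  have -> // : z' + walk trunc_val a S psi = z + \sum_i a i * f (merge S psi phi i).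
  rewrite /z' /walk -addrA; congr (_ + _); rewrite [in RHS](bigID (mem S)) /= addrC.
  congr (_ + _); apply: eq_bigr => i iS; rewrite ffunE ?iS ?(negPf iS) //.
  by rewrite /trunc_val bS.
rewrite negb_forall_in => /exists_inP[i iS nb].
by rewrite (bigD1 i) //= /cond_law (negPf nb) !mul0r.
Qed.

End Truncation.

(** * Random relations between coordinates *)

Section Relations.
Variables (R : realType) (I F : finType) (mu : F -> R) (f : F -> R[i]).
Variables (kap c0 q th : R).
Hypothesis mu0 : forall c, 0 <= mu c.
Hypothesis mu1 : \sum_c mu c = 1.
Hypothesis f_bound : forall c, normc (f c) <= kap.
Hypothesis c00 : 0 < c0.
Hypothesis q0 : 0 < q.
Hypothesis q1 : q <= 1.
Hypothesis kap0 : 0 <= kap.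
Hypothesis nondeg : forall c', q <= \sum_c mu c * (c0 <= `|complex.Re (f c' - f c)|)%R%:R.
Hypothesis th01 : 0 <= th <= 1.
Implicit Types (phi psi : {ffun I -> F}) (b S : {set I}) (a : I -> R[i]).

Definition grid_point N (o : R) (u : 'I_N * 'I_N) : R[i] :=
  Complex (u.1%:R - o) (u.2%:R - o).

(** For fixed [phi] and [psi], the relation confines [u] to a disk of radius [rho / c0] around -Z /
    y, because |y| >= c0; the grid points of the enclosing square are counted. *)
Lemma sum_pop N o (rho : R) b j a : 0 <= rho ->
  \sum_(u : 'I_N * 'I_N) pop mu f c0 rho b j a (grid_point o u) <=
  (2 * (rho / c0) + 1) ^+ 2.
Proof.
move=> rho0; rewrite -Ex_sum; apply: Ex_le_const => // phi.
rewrite -Ex_sum; apply: Ex_le_const => // psi.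
have r0 : 0 <= rho / c0 by rewrite divr_ge0 // ltW.
rewrite -mulr_sumr; case: (boolP (c0 <= _)) => [gy|_]; last first.
  by rewrite mul0r exprn_ge0 // addr_ge0 // mulr_ge0.
rewrite mul1r; set y := f (phi j) - f (psi j); set Z := \sum_(i in _) _.
have ny : c0 <= normc y by apply: le_trans gy (normc_Re _).
have ny0 : 0 < normc y by apply: lt_le_trans ny.
have yn0 : y != 0 by apply/eqP => y0; move: ny0; rewrite y0 normc0 ltxx.
pose r := rho / c0; pose x := - (Z / y).
apply: (@le_trans _ _ (\sum_(u : 'I_N * 'I_N)
   (`|u.1%:R - (complex.Re x + o)| <= r)%R%:R * (`|u.2%:R - (complex.Im x + o)| <= r)%R%:R)).
  apply: ler_sum => u _; case: (boolP (_ <= rho)) => [h|_]; last by rewrite mulr_ge0.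
  have h' : normc (grid_point o u - x) <= r.
    rewrite /r ler_pdivlMr //; apply: le_trans h.
    have -> : grid_point o u * y + Z = (grid_point o u - x) * y.
      by rewrite mulrBl /x mulNr divfK // opprK.
    by rewrite normcM ler_wpM2l ?normc_ge0.
  have h1 := le_trans (normc_Re _) h'; have h2 := le_trans (normc_Im _) h'.
  move: h1 h2; rewrite ReD ImD ReN ImN /= => h1 h2.
  by rewrite !opprD !addrA ![_ - _ - o]addrAC h1 h2 mulr1.
pose nr z (s : 'I_N) : R := (`|s%:R - z| <= r)%R%:R.
apply: (@le_trans _ _ ((\sum_s nr (complex.Re x + o) s) * (\sum_s nr (complex.Im x + o) s))).
  by rewrite big_distrlr /= pair_bigA.
rewrite expr2.
have cnt z : \sum_s nr z s <= 2 * r + 1.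
  apply: le_trans (card_near N z r0); rewrite -sum1_card natr_sum [leRHS]big_mkcond /=.
  by apply: ler_sum => s _; rewrite inE /nr; case: ifP => //.
by apply: ler_pM; rewrite ?sumr_ge0.
Qed.

Lemma Ex_coord j (h : F -> R) : Ex mu (fun phi : {ffun I -> F} => h (phi j)) = \sum_c mu c * h c.
Proof.
transitivity (Ex mu (fun phi : {ffun I -> F} => \prod_i (if i == j then h (phi i) else 1))).
  apply: eq_Ex => phi; rewrite (bigD1 j) //= eqxx big1 ?mulr1 //.
  by move=> i /negPf ->.
rewrite (Ex_prod mu (fun i c => if i == j then h c else 1)) (bigD1 j) //= eqxx.
by rewrite [X in _ * X]big1 ?mulr1 // => i /negPf ->; under eq_bigr do rewrite mulr1.
Qed.

(** Averaging over [S] makes the popularity a function of the vector alone, as the counting of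
    vectors requires. *)
Definition popS (rho : R) b j a u : R :=
  ES th (fun S => (j \in S)%:R * pop mu f c0 rho (S :&: b) j a u).

Lemma popS_ge0 rho b j a u : 0 <= popS rho b j a u.
Proof.
rewrite -(ES_const I th 0); apply: ES_le => // S.
by rewrite mulr_ge0 // pop_ge0.
Qed.

Lemma eq_popS rho b j a a' u : {in b :\ j, a =1 a'} -> popS rho b j a u = popS rho b j a' u.
Proof.
move=> aa'; apply: eq_bigr => S _; congr (_ * (_ * _)); apply: eq_pop => i.
by rewrite !inE => /and3P[ij iS ib]; apply: aa'; rewrite !inE ij.
Qed.

Lemma sum_popS N o (rho : R) b j a : 0 <= rho ->
  \sum_(u : 'I_N * 'I_N) popS rho b j a (grid_point o u) <= (2 * (rho / c0) + 1) ^+ 2.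
Proof.
move=> rho0; rewrite -ES_sum -[leRHS](ES_const I th); apply: ES_le => // S.
rewrite -mulr_sumr -[leRHS]mul1r; apply: ler_pM => //.
- by rewrite sumr_ge0 // => u _; apply: pop_ge0.
- by rewrite lern1 leq_b1.
- exact: sum_pop.
Qed.

Variables (rho rho' p1 : R) (a a' : I -> R[i]) (L : nat).
Hypothesis rho0 : 0 < rho.
Hypothesis rho'E : 2 * rho + L%:R * (2 * kap) <= rho'.
(** Concentration of the untruncated walk in the form delivered by [truncate]: any bound on the
    conditional small ball probabilities given [S] has mean at least [p1]. *)
Hypothesis p1_bound : forall B : {set I} -> R,
  (forall S z, Ex mu (fun phi => (normc (z + walk f a S phi) <= rho)%R%:R) <= B S) ->
  p1 <= ES th B.

Let sym_bound b1 b2 z :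
  [disjoint b1 & b2] -> (#|b1| <= L)%N -> (#|b2| <= L)%N ->
  (forall i, i \in b1 :|: b2 -> normc (a i - a' i) <= 1) ->
  Ex mu (fun phi => (normc (z + walk f a (b1 :|: b2) phi) <= rho)%R%:R) <=
  9 / 2 * (((1 - q) ^+ #|b1| + \sum_(j in b1) pop mu f c0 rho' b1 j a' (a' j)) +
           ((1 - q) ^+ #|b2| + \sum_(j in b2) pop mu f c0 rho' b2 j a' (a' j))).
Proof.
move=> dis L1 L2 aa'; apply: le_trans (symmetrize _ _ _ _ _ _ _) _ => //.
have lim b : (#|b| <= L)%N -> 2 * rho + #|b|%:R * (2 * kap) <= rho'.
  move=> bL; apply: le_trans rho'E; rewrite lerD2l ler_wpM2r ?ler_nat //.
  by rewrite mulr_ge0.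
rewrite ler_wpM2l // lerD //; apply: (collision_pop (kap := kap)); rewrite ?lim // => i ib.
  by apply: aa'; rewrite inE ib.
by apply: aa'; rewrite inE ib orbT.
Qed.

Let sumI b S (g : I -> R) : \sum_(j in S :&: b) g j = \sum_(j in b) (j \in S)%:R * g j.
Proof.
rewrite big_mkcond [RHS]big_mkcond; apply: eq_bigr => j _; rewrite inE.
by case: (j \in S); case: (j \in b); rewrite ?mul1r ?mul0r.
Qed.

(** All steps outside the two half-blocks are frozen. Averaging (1 - q)^k over the number k of
    bounded steps in a half-block gives (1 - th q)^L by [ES_pow]. *)
Lemma short_relation b1 b2 :
  [disjoint b1 & b2] -> #|b1| = L -> #|b2| = L ->
  (forall i, i \in b1 :|: b2 -> normc (a i - a' i) <= 1) ->
  p1 <= 9 / 2 * (2 * (1 - th * q) ^+ L + (\sum_(j in b1) popS rho' b1 j a' (a' j) +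
                                      \sum_(j in b2) popS rho' b2 j a' (a' j))).
Proof.
move=> dis L1 L2 aa'.
pose B S := 9 / 2 * (((1 - q) ^+ #|S :&: b1| +
    \sum_(j in b1) (j \in S)%:R * pop mu f c0 rho' (S :&: b1) j a' (a' j)) +
  ((1 - q) ^+ #|S :&: b2| +
    \sum_(j in b2) (j \in S)%:R * pop mu f c0 rho' (S :&: b2) j a' (a' j))).
apply: (@le_trans _ _ (ES th B)).
  apply: p1_bound => S; apply: (small_ball_mono mu0 mu1 (b := S :&: (b1 :|: b2))).
    exact: finset.subsetIl.
  move=> z; rewrite /B -!sumI finset.setIUr; apply: sym_bound.
  - apply: disjointWl (finset.subsetIr _ _) _; apply: disjointWr (finset.subsetIr _ _) dis.
  - by rewrite -L1 subset_leq_card // finset.subsetIr.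
  - by rewrite -L2 subset_leq_card // finset.subsetIr.
  - by move=> i; rewrite -finset.setIUr inE => /andP[_]; apply: aa'.
rewrite /B ESZ ler_wpM2l // !ESD !ES_pow // !ES_sum L1 L2.
have -> : 1 - th + th * (1 - q) = 1 - th * q by ring.
by rewrite /popS; lra.
Qed.

Variables (K : finType) (blk : I -> K) (hf : I -> bool) (A : {set I}).
Let b k h := [set i in A | (blk i == k) && (hf i == h)].
Hypothesis bL : forall k h, #|b k h| = L.
Hypothesis K0 : (0 < #|K|)%N.
Hypothesis L0 : (0 < L)%N.
Hypothesis aa' : forall i, i \in A -> normc (a i - a' i) <= 1.
Variables (u0 : R[i]) (del rr : R).
Hypothesis u00 : u0 != 0.
Hypothesis close : forall i, i \in A -> normc (a i / u0 - 1) <= del.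
Hypothesis del1 : del <= 1.
Hypothesis del_c0 : del * (4 * kap) <= c0.
Hypothesis rrE : rho / normc u0 <= rr.

Let m := #|K|.
Let khat := (2 * rr + 8 * L%:R * kap) / (c0 / 2) + 1.
Let QS S k := 9 / 2 *
  (((1 - q) ^+ #|S :&: b k true| +
      \sum_(j in S :&: b k true) pop mu f c0 rho' (S :&: b k true) j a' (a' j)) +
   ((1 - q) ^+ #|S :&: b k false| +
      \sum_(j in S :&: b k false) pop mu f c0 rho' (S :&: b k false) j a' (a' j))).

Let b_disj k : [disjoint b k true & b k false].
Proof.
rewrite finset.disjoints_subset; apply/fintype.subsetP => i; rewrite !inE.
by move=> /and3P[_ _ /eqP ->]; rewrite !andbF.
Qed.

(** Dividing by the common approximate value [u0] makes every coefficient nearly 1. The real parts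
    of the steps, which [nondeg] controls, are then seen by a single real projection. *)
Let prj (w : R[i]) := complex.Re (w / u0).

Let prjD : {morph prj : x y / x + y}.
Proof. by move=> x y; rewrite /prj mulrDl ReD. Qed.

Let prjN x : prj (- x) = - prj x.
Proof. by rewrite /prj mulNr ReN. Qed.

Let step_large j phi psi : j \in A ->
  (c0 <= `|complex.Re (f (phi j) - f (psi j))|)%R ->
  c0 / 2 <= `|prj (a j * (f (phi j) - f (psi j)))|.
Proof.
move=> jA; set y := f _ - f _ => gy.
have yk : normc y <= 2 * kap.
  by apply: le_trans (ler_normcD _ _) _; rewrite normcN mulr_natl mulr2n lerD.
have -> : prj (a j * y) = complex.Re y + complex.Re ((a j / u0 - 1) * y).
  by rewrite -ReD /prj; congr complex.Re; ring.
have e : `|complex.Re ((a j / u0 - 1) * y)| <= c0 / 2.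
  apply: le_trans (normc_Re _) _; rewrite normcM.
  apply: (@le_trans _ _ (del * (2 * kap))); last by move: del_c0; lra.
  by apply: ler_pM; rewrite ?normc_ge0 ?close.
apply: le_trans (lerB_normD _ _).
by move: gy e; lra.
Qed.

(** [block_chain] with [lam] = c0 / 2 and with q / 2 in place of [q]. The bound [Lam] comes from at
    most 2L terms, coefficients of modulus at most 2 after division by [u0], and steps of modulus at
    most [kap]. *)
Let fixed S z : (forall k, S :&: (b k true :|: b k false) != finset.set0) ->
  Ex mu (fun phi => (normc (z + walk f a (S :&: A) phi) <= rho)%R%:R) <=
  (2 ^ m)%:R^-1 +
  (Num.sqrt m%:R)^-1 * (m%:R^-1 * \sum_k QS S k) * (4 / (q / 2) * khat).
Proof.
move=> Sne.
pose bb k := (S :&: b k true) :|: (S :&: b k false).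
have bbP k i : (i \in bb k) = [&& i \in S, i \in A & blk i == k].
  rewrite !inE; case: (i \in S); case: (i \in A); case: (blk i == k) => //=.
  by case: (hf i).
pose X k phi := walk f a (bb k) phi.
have walkE phi : walk f a (S :&: A) phi = \sum_k X k phi.
  rewrite /walk (partition_big blk predT) //=; apply: eq_bigr => k _.
  by apply: eq_bigl => i; rewrite bbP inE andbA.
have u0n : 0 < normc u0.
  rewrite lt_neqAle normc_ge0 andbT eq_sym; apply: contra u00 => /eqP/eq0_normc ->.
  exact: eqxx.
have XblkP k phi psi : (forall i, blk i = k -> phi i = psi i) -> X k phi = X k psi.
  move=> pp; apply: eq_bigr => i; rewrite bbP => /and3P[_ _ /eqP ik].
  by rewrite pp.
have bcard k : (#|bb k| <= 2 * L)%N.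
  apply: (leq_trans (leq_card_setU _ _)); rewrite mul2n -addnn leq_add //.
    by rewrite -[leqRHS](bL k true) subset_leq_card // finset.subsetIr.
  by rewrite -[leqRHS](bL k false) subset_leq_card // finset.subsetIr.
have a_u0 i : i \in A -> normc (a i / u0) <= 2.
  move=> iA; have -> : a i / u0 = (a i / u0 - 1) + 1 by rewrite subrK.
  by apply: le_trans (ler_normcD _ _) _; rewrite normc1; have := close iA; move: del1; lra.
pose Lam := 4 * L%:R * kap.
have Lam0 : 0 <= Lam by rewrite !mulr_ge0.
have XLam k phi : `|prj (X k phi)| <= Lam.
  apply: le_trans (normc_Re _) _; rewrite /X /walk mulr_suml.
  apply: le_trans (normc_sum _ _ _) _.
  apply: (@le_trans _ _ (\sum_(i in bb k) (2 * kap))).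
    apply: ler_sum => i; rewrite bbP => /and3P[_ iA _].
    by rewrite mulrAC normcM ler_pM ?normc_ge0 ?a_u0.
  rewrite sumr_const -[leLHS]mulr_natl.
  have : #|bb k|%:R <= 2 * L%:R :> R by rewrite -natrM ler_nat.
  have -> : Lam = 2 * L%:R * (2 * kap) by rewrite /Lam; ring.
  by move=> h; rewrite ler_wpM2r // mulr_ge0.
pose hit (w : R[i]) := normc (z + w) <= rho.
have rr0 : 0 <= rr by apply: le_trans rrE; rewrite divr_ge0 ?normc_ge0 ?ltW.
have hitP w : hit w -> - prj z - rr <= prj w <= - prj z + rr.
  move=> hw; have : `|prj (z + w)| <= rr.
    apply: le_trans (normc_Re _) _; apply: le_trans rrE.
    by rewrite normcM normcV ler_wpM2r // invr_ge0 normc_ge0.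
  by rewrite prjD ler_norml => /andP[h1 h2]; apply/andP; split; lra.
have ab : - prj z - rr <= - prj z + rr by lra.
have lam0 : 0 < c0 / 2 by rewrite divr_gt0.
have q20 : 0 < q / 2 by rewrite divr_gt0.
have Qb k w : Ex mu (fun phi => (hit (w + X k phi))%:R) <= QS S k.
  rewrite /hit; under eq_Ex do rewrite addrA.
  apply: sym_bound.
  - apply: disjointWl (finset.subsetIr _ _) _; apply: disjointWr (finset.subsetIr _ _) _.
    exact: b_disj.
  - by rewrite -[leqRHS](bL k true) subset_leq_card // finset.subsetIr.
  - by rewrite -[leqRHS](bL k false) subset_leq_card // finset.subsetIr.
  - by move=> i; rewrite bbP => /and3P[_ iA _]; apply: aa'.
(* Swapping the two copies at one index [j] of the block only changes the sign of its contribution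
   t. As |2t| >= c0, one of s + t and s - t has modulus at least c0 / 2; this costs a factor 2 in
   probability. *)
have qb k : q / 2 <= Ex mu (fun phi => Ex mu (fun psi =>
    (c0 / 2 <= `|prj (X k phi) - prj (X k psi)|)%R%:R)).
  have /set0Pn[j] : S :&: (b k true :|: b k false) != finset.set0 by [].
  rewrite finset.setIUr -/(bb k) => jb.
  have jA : j \in A by move: jb; rewrite bbP => /and3P[].
  have h1 : q <= Ex mu (fun phi : {ffun I -> F} => Ex mu (fun psi : {ffun I -> F} =>
      (c0 <= `|complex.Re (f (phi j) - f (psi j))|)%R%:R)).
    rewrite -[leLHS](Ex_const I mu1); apply: Ex_le => // phi.
    by rewrite (Ex_coord j (fun c => (c0 <= `|complex.Re (f (phi j) - f c)|)%R%:R)).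
  pose D phi psi := prj (X k phi) - prj (X k psi).
  pose tau phi psi := prj (a j * (f (phi j) - f (psi j))).
  have DE phi psi : D phi psi = prj (walk f a (bb k :\ j) phi - walk f a (bb k :\ j) psi)
      + tau phi psi.
    rewrite /D /tau /X -prjN -!prjD /walk (big_setD1 j jb) [X in _ - X](big_setD1 j jb) /=.
    by congr prj; ring.
  have wD phi psi : walk f a (bb k :\ j) (merge [set j] phi psi) = walk f a (bb k :\ j) psi.
    apply: walk_merge_out; rewrite disjoint_sym disjoints1 !inE eqxx //.
  have h2 : Ex mu (fun phi => Ex mu (fun psi => (c0 / 2 <= `|D phi psi|)%R%:R)) =
      Ex mu (fun phi => Ex mu (fun psi =>
     (c0 / 2 <= `|prj (walk f a (bb k :\ j) phi - walk f a (bb k :\ j) psi) - tau phi psi|)%R%:R)).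
    rewrite (Ex_swap mu [set j]); apply: eq_Ex => phi; apply: eq_Ex => psi.
    rewrite DE !wD /tau !ffunE !inE eqxx -prjN -mulrN opprB //.
  rewrite ler_pdivrMr // mulr_natr mulr2n -{2}/(D _ _).
  apply: le_trans h1 _; rewrite {2}h2 -ExD; apply: Ex_le => // phi.
  rewrite -ExD; apply: Ex_le => // psi.
  case: (boolP (c0 <= _)) => [/(step_large jA)|_]; last by rewrite addr_ge0.
  rewrite -/(tau phi psi) => ht.
  rewrite -/(D phi psi) DE; set s := prj _; set t := tau _ _ in ht *.
  case: (lerP (c0 / 2) `|s + t|) => [_|h3]; first by rewrite lerDl.
  case: (lerP (c0 / 2) `|s - t|) => [_|h4]; first by rewrite lerDr.
  have := ler_normB (s + t) (s - t).
  have -> : s + t - (s - t) = 2 * t by ring.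
  rewrite normrM ger0_norm // => h5; exfalso.
  by move: ht h3 h4 h5; lra.
have := block_chain mu0 mu1 XblkP prjD hitP XLam lam0 ab Lam0 Qb q20 K0 qb.
have -> : (- prj z + rr - (- prj z - rr) + 2 * Lam) / (c0 / 2) + 1 = khat.
  by rewrite /khat /Lam; congr (_ / _ + 1); ring.
apply: le_trans; rewrite le_eqVlt; apply/orP; left; apply/eqP.
by apply: eq_Ex => phi; rewrite walkE.
Qed.

(** If [S] misses a whole block, the conditional probability is bounded by 1; this accounts for the
    term m (1 - th)^(2L). Otherwise [fixed] applies. *)
Lemma long_relation :
  p1 <= m%:R * (1 - th) ^+ (2 * L) + (2 ^ m)%:R^-1 +
    (Num.sqrt m%:R)^-1 * m%:R^-1 * (4 / (q / 2) * khat) * (9 / 2 * (2 * m%:R * (1 - th * q) ^+ L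
      + \sum_(j in A) popS rho' (b (blk j) (hf j)) j a' (a' j))).
Proof.
pose cst := (Num.sqrt m%:R)^-1 * m%:R^-1 * (4 / (q / 2) * khat).
have rr0 : 0 <= rr by apply: le_trans rrE; rewrite divr_ge0 ?normc_ge0 ?ltW.
have c02 : 0 <= c0 / 2 by rewrite divr_ge0 // ltW.
have khat0 : 0 <= khat.
  by rewrite addr_ge0 // divr_ge0 // addr_ge0 ?mulr_ge0.
have cst0 : 0 <= cst.
  have q20 : 0 <= q / 2 by rewrite divr_ge0 // ltW.
  by rewrite !mulr_ge0 ?invr_ge0 ?sqrtr_ge0.
(* Since 0 ^+ 0 = 1, each power of 0 is the indicator that [S] misses the block. *)
pose B S := \sum_k 0 ^+ #|S :&: (b k true :|: b k false)| + (2 ^ m)%:R^-1 + cst * \sum_k QS S k.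
have QS0 S k : 0 <= QS S k.
  have q1' : 0 <= 1 - q by rewrite subr_ge0.
  by rewrite mulr_ge0 // !addr_ge0 ?exprn_ge0 // sumr_ge0 // => j _; apply: pop_ge0.
have z0 S : 0 <= \sum_k (0 : R) ^+ #|S :&: (b k true :|: b k false)|.
  by rewrite sumr_ge0 // => k _; rewrite exprn_ge0.
apply: (@le_trans _ _ (ES th B)).
  apply: p1_bound => S; apply: (small_ball_mono mu0 mu1 (b := S :&: A)).
    exact: finset.subsetIl.
  move=> z; case: (boolP [forall k, S :&: (b k true :|: b k false) != finset.set0]).
    move=> /forallP Sne; apply: le_trans (fixed z Sne) _.
    rewrite /B -addrA -[leLHS]add0r lerD //= lerD2l le_eqVlt; apply/orP; left; apply/eqP.
    by rewrite /cst; ring.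
  rewrite negb_forall => /existsP[k]; rewrite negbK => /eqP k0.
  apply: (@le_trans _ _ 1).
    by apply: Ex_le_const => // phi; rewrite lern1 leq_b1.
  rewrite /B -addrA -[leLHS]addr0 lerD //.
    rewrite (bigD1 k) //= k0 cards0 expr0 lerDl sumr_ge0 // => l _; apply: exprn_ge0.
  by rewrite addr_ge0 ?invr_ge0 // mulr_ge0 // sumr_ge0.
have thq : 1 - th + th * (1 - q) = 1 - th * q by ring.
rewrite /B !ESD ES_const ESZ !ES_sum lerD ?ler_wpM2l //.
  rewrite lerD2r; under eq_bigr => k _.
    rewrite ES_pow mulr0 addr0 cardsU (disjoint_setI0 (b_disj k)) cards0 subn0 !bL.
    over.
  by rewrite sumr_const -[leLHS]mulr_natl addnn mul2n.
under eq_bigr => k _.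
  rewrite /QS ESZ !ESD !ES_pow thq !bL.
  over.
rewrite -mulr_sumr ler_wpM2l //.
have AE : \sum_(j in A) popS rho' (b (blk j) (hf j)) j a' (a' j) =
   \sum_k (\sum_(j in b k true) popS rho' (b k true) j a' (a' j) +
           \sum_(j in b k false) popS rho' (b k false) j a' (a' j)).
  rewrite (partition_big blk predT) //=; apply: eq_bigr => k _.
  rewrite (bigID hf) /=; congr (_ + _).
    apply: eq_big => [j|j /andP[/andP[_ /eqP ->] ->] //].
    by rewrite !inE; case: (hf j); rewrite ?andbT ?andbF.
  apply: eq_big => [j|j /andP[/andP[_ /eqP ->] /negPf ->] //].
  by rewrite !inE; case: (hf j); rewrite ?andbT ?andbF.
rewrite AE.
have -> : 2 * m%:R * (1 - th * q) ^+ L = \sum_(k : K) (2 * (1 - th * q) ^+ L) :> R.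
  by rewrite sumr_const -[RHS]mulr_natl -/m; ring.
rewrite -big_split /=; apply: ler_sum => k _.
have e h : ES th (fun S => \sum_(j in S :&: b k h) pop mu f c0 rho' (S :&: b k h) j a' (a' j)) =
   \sum_(j in b k h) popS rho' (b k h) j a' (a' j).
  rewrite /popS -ES_sum; apply: eq_bigr => S _; congr (_ * _); exact: sumI.
by rewrite !e; lra.
Qed.

End Relations.

(** * Counting vectors with popular coordinates *)

Section Encoding.
Variables (R : realFieldType) (I G : finType) (g0 : G).
Implicit Types (J D : {set I}) (v : {ffun I -> G}).

Definition upd v j u : {ffun I -> G} := [ffun i => if i == j then u else v i].

Definition supported J v := [forall i, (i \notin J) ==> (v i == g0)].

Lemma supportedP J v : reflect (forall i, i \notin J -> v i = g0) (supported J v).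
Proof.
apply: (iffP forallP) => h i.
  by move=> iJ; have := h i; rewrite iJ => /eqP.
by apply/implyP => /h ->.
Qed.

Lemma sum_supportedD1 J j (h : {ffun I -> G} -> R) : j \in J ->
  \sum_(v | supported J v) h v =
  \sum_(v | supported (J :\ j) v) \sum_u h (upd v j u).
Proof.
move=> jJ; rewrite (partition_big (fun v => upd v j g0) (supported (J :\ j))) /=.
  apply: eq_bigr => v /supportedP vJ.
  rewrite (reindex_onto (upd v j) (fun w => w j)) /=.
    apply: eq_bigl => u; rewrite ffunE eqxx eqxx andbT; apply/andP; split.
      apply/supportedP => i iJ; rewrite ffunE; case: eqP => [ij|/eqP ij].
        by rewrite ij jJ in iJ.
      by apply: vJ; rewrite !inE (negPf iJ) andbF.
    apply/eqP/ffunP => i; rewrite !ffunE; case: eqP => [->|] //.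
    by rewrite vJ // !inE eqxx.
  move=> w /andP[_ /eqP <-]; apply/ffunP => i; rewrite !ffunE.
  by case: eqP => [->|].
move=> v /supportedP vJ; apply/supportedP => i; rewrite !inE negb_and negbK ffunE.
by case: eqP => //= _; apply: vJ.
Qed.

Lemma card_supported J : \sum_(v | supported J v) 1 = #|G|%:R ^+ #|J| :> R.
Proof.
have [N] := ubnP #|J|; elim: N J => // N IHN J; rewrite ltnS => JN.
have [J0|[j jJ]] := set_0Vmem J.
  rewrite J0 cards0 expr0 (big_pred1 [ffun=> g0]) // => v /=.
  apply/supportedP/eqP => [h|-> i _]; last by rewrite ffunE.
  by apply/ffunP => i; rewrite ffunE h // inE.
rewrite (sum_supportedD1 _ jJ); under eq_bigr do rewrite sumr_const -[_ *+ _]mulr1.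
have cJ : #|J| = #|J :\ j|.+1 by rewrite (cardsD1 j J) jJ.
by rewrite -mulr_sumr IHN -?cJ // cJ exprS.
Qed.

Variables (P : {set I} -> I -> {ffun I -> G} -> R) (Sel : {set I} -> {set I}).
Variables (C : R) (base : nat) (delta : nat -> R).
Hypothesis P_ge0 : forall J j v, 0 <= P J j v.
Hypothesis P_local : forall J j v v', j \in Sel J -> {in J, v =1 v'} -> P J j v = P J j v'.
Hypothesis Sel_sub : forall J, Sel J \subset J.
Hypothesis Sel_n0 : forall J, (base < #|J|)%N -> (0 < #|Sel J|)%N.
Hypothesis C0 : 0 <= C.
Hypothesis P_sum : forall J j v, (base < #|J|)%N -> j \in Sel J ->
  \sum_u P J j (upd v j u) <= C.
Hypothesis delta0 : forall k, 0 <= delta k.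

Definition popular D v : Prop := forall J, J \subset D -> (base < #|J|)%N ->
  delta #|J| * #|Sel J|%:R <= \sum_(j in Sel J) P J j v.

(* The average, over the orders in which the coordinates of [J] are removed,
   of the product of the popularities of the removed coordinates. *)
Fixpoint weight n J v : R :=
  if n is n'.+1 then
    #|Sel J|%:R^-1 * \sum_(j in Sel J) P J j v * weight n' (J :\ j) v
  else 1.

Lemma weight_ge0 n J v : 0 <= weight n J v.
Proof.
elim: n J => [|n IHn] J //=; rewrite mulr_ge0 ?invr_ge0 // sumr_ge0 // => j _.
by rewrite mulr_ge0.
Qed.

Lemma weight_local n J v v' : {in J, v =1 v'} -> weight n J v = weight n J v'.
Proof.
elim: n J => [|n IHn] J vv //=; congr (_ * _); apply: eq_bigr => j jS.
rewrite (P_local jS vv) (IHn (J :\ j)) // => i; rewrite inE => /andP[_]; exact: vv.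
Qed.

(** [popular] bounds the mean popularity at every subset of [D], so each removal contributes its
    factor whatever was removed before. *)
Lemma weight_lower D v n J : popular D v -> J \subset D -> #|J| = (base + n)%N ->
  \prod_(k < n) delta (base + k.+1) <= weight n J v.
Proof.
move=> pv; elim: n J => [|n IHn] J JD cJ /=; first by rewrite big_ord0.
have bJ : (base < #|J|)%N by rewrite cJ addnS ltnS leq_addr.
have S0 : 0 < #|Sel J|%:R :> R by rewrite ltr0n Sel_n0.
rewrite big_ord_recr /= mulrC -cJ ler_pdivlMl // mulrA [_%:R * _]mulrC.
apply: (@le_trans _ _ ((\sum_(j in Sel J) P J j v) * \prod_(k < n) delta (base + k.+1))).
  by rewrite ler_wpM2r ?pv // prodr_ge0.
rewrite mulr_suml; apply: ler_sum => j jS; rewrite ler_wpM2l //.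
have jJ := fintype.subsetP (Sel_sub J) _ jS.
apply: IHn; first by apply: fintype.subset_trans JD; apply: finset.subD1set.
by apply/eqP; rewrite -eqSS -addnS -cJ (cardsD1 j J) jJ.
Qed.

(** The value at the first removed [j] is summed out first, which costs at most [C], since the
    remaining weight only reads [J :\ j]. The last [base] coordinates are counted trivially. *)
Lemma weight_sum n J : #|J| = (base + n)%N ->
  \sum_(v | supported J v) weight n J v <= C ^+ n * #|G|%:R ^+ base.
Proof.
elim: n J => [|n IHn] J cJ /=; first by rewrite expr0 mul1r card_supported cJ addn0.
have bJ : (base < #|J|)%N by rewrite cJ addnS ltnS leq_addr.
have S0 : 0 < #|Sel J|%:R :> R by rewrite ltr0n Sel_n0.
rewrite -mulr_sumr ler_pdivrMl // exchange_big /=.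
rewrite mulr_natl -sumr_const; apply: ler_sum => j jS.
have jJ := fintype.subsetP (Sel_sub J) _ jS.
rewrite (sum_supportedD1 _ jJ) exprS -mulrA.
apply: (@le_trans _ _ (\sum_(v | supported (J :\ j) v) C * weight n (J :\ j) v)); last first.
  rewrite -mulr_sumr ler_wpM2l // IHn //.
  by apply/eqP; rewrite -eqSS -addnS -cJ (cardsD1 j J) jJ.
apply: ler_sum => v _.
apply: (@le_trans _ _ ((\sum_u P J j (upd v j u)) * weight n (J :\ j) v)); last first.
  by rewrite ler_wpM2r ?weight_ge0 // P_sum.
rewrite mulr_suml le_eqVlt; apply/orP; left; apply/eqP; apply: eq_bigr => u _.
congr (_ * _); apply: weight_local => i; rewrite !inE ffunE => /andP[/negPf ->] //.
Qed.

Lemma popular_count (V : {set {ffun I -> G}}) D n :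
  (forall v, v \in V -> supported D v /\ popular D v) -> #|D| = (base + n)%N ->
  #|V|%:R * \prod_(k < n) delta (base + k.+1) <= C ^+ n * #|G|%:R ^+ base.
Proof.
move=> hV cD; apply: le_trans (weight_sum cD).
rewrite mulr_natl -sumr_const big_mkcond [leRHS]big_mkcond /=; apply: ler_sum => v _.
case: (boolP (v \in V)) => [/hV[-> pv]|_]; first exact: weight_lower pv _ cD.
by case: ifP => // _; apply: weight_ge0.
Qed.

End Encoding.

(** * Partitions of finite sets and the number of small sets *)

Lemma prod_two_levels (R : realFieldType) (x y : R) (n b M N : nat) :
  0 < x -> x <= 1 -> 0 < y -> y <= 1 -> (n <= N)%N ->
  x ^+ M * y ^+ N <= \prod_(k < n) (if (b + k.+1 < M)%N then x else y).
Proof.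
move=> x0 x1 y0 y1 nN.
apply: (@le_trans _ _ (x ^+ M * y ^+ n)).
  by rewrite ler_pM2l ?exprn_gt0 // ler_wiXn2l // ltW.
apply: (@le_trans _ _ (x ^+ minn n M * y ^+ n)).
  by rewrite ler_pM2r ?exprn_gt0 // ler_wiXn2l ?geq_minr // ltW.
elim: n {nN} => [|n IHn]; first by rewrite min0n big_ord0 mul1r.
rewrite big_ord_recr /=; have y0' := ltW y0; have x0' := ltW x0.
case: ifP => [lM|_].
  have [-> e] : minn n.+1 M = n.+1 /\ minn n M = n by lia.
  rewrite e in IHn; rewrite exprS [y ^+ _]exprS.
  have -> : x * x ^+ n * (y * y ^+ n) = y * (x ^+ n * y ^+ n * x) by ring.
  rewrite -[leRHS]mul1r; apply: ler_pM => //; last by rewrite ler_wpM2r.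
  by rewrite !mulr_ge0 ?exprn_ge0.
rewrite exprS mulrCA [leRHS]mulrC ler_wpM2l //; apply: le_trans IHn.
by rewrite ler_wpM2r ?exprn_ge0 // ler_wiXn2l //; lia.
Qed.

Lemma subset_of_card (I : finType) (A : {set I}) m : (m <= #|A|)%N ->
  exists2 B : {set I}, B \subset A & #|B| = m.
Proof.
elim: m => [|m IHm] mA; first by exists finset.set0; rewrite ?finset.sub0set ?cards0.
have [B BA cB] := IHm (ltnW mA).
have /subsetPn[j jA jB] : ~~ (A \subset B).
  by apply: contraL mA => /subset_leq_card; rewrite cB -leqNgt.
exists (j |: B); last by rewrite cardsU1 jB cB.
by apply/fintype.subsetP => i; rewrite !inE => /orP[/eqP ->|/(fintype.subsetP BA)].
Qed.

Lemma equipartition (I K : finType) (k0 : K) (A : {set I}) (D : {set K}) L :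
  #|A| = (#|D| * L)%N ->
  exists c : {ffun I -> K}, (forall i, i \in A -> c i \in D) /\
    forall k, k \in D -> #|[set i in A | c i == k]| = L.
Proof.
have [N] := ubnP #|D|; elim: N A D => // N IHN A D; rewrite ltnS => DN cA.
have [D0|[k kD]] := set_0Vmem D.
  exists [ffun=> k0]; split => [i|k]; last by rewrite D0 inE.
  by move/eqP: cA; rewrite D0 cards0 mul0n cards_eq0 => /eqP ->; rewrite inE.
have cD : #|D| = #|D :\ k|.+1 by rewrite (cardsD1 k D) kD.
have [B BA cB] : exists2 B : {set I}, B \subset A & #|B| = L.
  by apply: subset_of_card; rewrite cA cD mulSn leq_addr.
have [||c [cin cfib]] := IHN (A :\: B) (D :\ k).
- by rewrite -cD.
- by rewrite cardsDS // cA cB cD mulSn addKn.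
exists [ffun i => if i \in B then k else c i]; split => [i iA|l lD].
  rewrite ffunE; case: ifP => iB //.
  by have := cin i; rewrite !inE iB iA => /(_ isT) /andP[].
have [->|lk] := eqVneq l k.
  rewrite -cB; apply: eq_card => i; rewrite !inE ffunE.
  case: ifP => iB; first by rewrite eqxx (fintype.subsetP BA).
  apply/negP => /andP[iA /eqP ck].
  by have := cin i; rewrite !inE iB iA ck eqxx => /(_ isT).
rewrite -(cfib l); last by rewrite !inE lk.
apply: eq_card => i; rewrite !inE ffunE; case: ifP => iB //.
by rewrite eq_sym (negPf lk) andbF.
Qed.

Lemma pigeonhole_class (I K : finType) (lab : I -> K) (J : {set I}) m :
  (#|K| * m <= #|J|)%N -> (0 < #|K|)%N ->
  exists2 A : {set I}, (A \subset J) && (#|A| == m) &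
    exists c, forall i, i \in A -> lab i = c.
Proof.
move=> KJ K0.
have [c hc] : exists c, (m <= #|[set i in J | lab i == c]|)%N.
  have /card_gt0P[k0 _] := K0.
  apply/existsP; apply: contraLR KJ; rewrite negb_exists => /forallP h.
  have [m0|mn0] := posnP m; first by have := h k0; rewrite m0.
  rewrite -ltnNge -sum1_card (partition_big lab predT) //=.
  apply: (@leq_ltn_trans (\sum_(k : K) m.-1)).
    apply: leq_sum => k _; rewrite sum1_card; have := h k; rewrite -ltnNge.
    rewrite -(ltn_predK mn0) ltnS; apply: leq_trans; apply: subset_leq_card.
    by apply/fintype.subsetP => i; rewrite !inE.
  by rewrite sum_nat_const ltn_pmul2l // prednK.
have [A AJ cA] := subset_of_card hc.
exists A; last by exists c => i /(fintype.subsetP AJ); rewrite inE => /andP[_ /eqP].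
rewrite cA eqxx andbT; apply: fintype.subset_trans AJ _.
by apply/fintype.subsetP => i; rewrite inE => /andP[].
Qed.

(** Such a set is the range of a partial function on [m] places: its enumeration, padded by
    [None]. *)
Lemma card_small_sets (n m : nat) :
  (#|[set D : {set 'I_n} | #|D| <= m]| <= n.+1 ^ m)%N.
Proof.
have -> : (n.+1 ^ m = #|{ffun 'I_m -> option 'I_n}|)%N.
  by rewrite card_ffun card_option !card_ord.
pose g (phi : {ffun 'I_m -> option 'I_n}) := [set i | [exists k, phi k == Some i]].
rewrite -[leqRHS]cardsT; apply: leq_trans (leq_imset_card g _).
apply: subset_leq_card; apply/fintype.subsetP => D; rewrite inE => Dm.
apply/imsetP; exists [ffun k : 'I_m => onth (enum D) k]; rewrite ?inE //.
apply/setP => i; rewrite inE; apply/idP/existsP => [iD|[k]].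
  have iD' : (index i (enum D) < size (enum D))%N by rewrite index_mem mem_enum.
  have im : (index i (enum D) < m)%N by apply: leq_trans iD' _; rewrite -cardE.
  exists (Ordinal im); rewrite ffunE /= onthE (nth_map i) //.
  by rewrite nth_index // mem_enum.
rewrite ffunE onthE; case: (ltnP k (size (enum D))) => kD.
  rewrite (nth_map i) // => /eqP[<-].
  by rewrite -mem_enum mem_nth.
by rewrite nth_default // size_map.
Qed.

(** * Rounding and classes of comparable coordinates *)

Section Rounding.
Variables (R : realType) (M h : nat).
Local Notation N := (M.*2.+1).
Implicit Types (u : 'I_N * 'I_N) (a : R[i]).

Definition gp u : R[i] := grid_point M%:R u.

Definition offset (s : 'I_N) : nat := (s - M) + (M - s).

Lemma offsetE (s : 'I_N) : `|s%:R - M%:R : R| = (offset s)%:R.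
Proof.
rewrite /offset; case: (leqP M s) => Ms.
  by rewrite (eqP Ms) addn0 natrB // ger0_norm // subr_ge0 ler_nat.
have /eqP -> : (s - M == 0)%N by rewrite subn_eq0 ltnW.
by rewrite add0n natrB ?(ltnW Ms) // distrC ger0_norm // subr_ge0 ler_nat ltnW.
Qed.

Lemma offset_le (s : 'I_N) : (offset s <= M)%N.
Proof. by case: s => s /=; rewrite /offset /=; lia. Qed.

Definition gsize u := maxn (offset u.1) (offset u.2).
Definition tiny u := (gsize u < 2 ^ h)%N.
Definition level u := trunc_log 2 (gsize u).
(** Cells of length 2^(l - h), hence of relative size 2^-h at level [l]. The shift by 2^(l + 1)
    keeps the natural subtraction exact for offsets below 2^(l + 1). *)
Definition cell l (s : 'I_N) : nat := (s + 2 ^ l.+1 - M) %/ 2 ^ (l - h).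

Definition label : finType :=
  ('I_(trunc_log 2 M).+1 * ('I_(2 ^ h.+2).+1 * 'I_(2 ^ h.+2).+1))%type.

Definition class u : label :=
  (inord (level u), (inord (cell (level u) u.1), inord (cell (level u) u.2))).

Lemma gsize_le_normc u : (gsize u)%:R <= normc (gp u).
Proof.
rewrite /gsize /gp; case: (leqP (offset u.1) (offset u.2)) => _; rewrite -offsetE.
  exact: normc_Im (grid_point M%:R u).
exact: normc_Re (grid_point M%:R u).
Qed.

Lemma normc_le_gsize u : normc (gp u) <= 2 * (gsize u)%:R.
Proof.
apply: le_trans (normc_le_ReIm _) _; rewrite /= !offsetE -natrD -natrM ler_nat.
by rewrite /gsize; lia.
Qed.

Lemma level_bounds u : ~~ tiny u ->
  [/\ (2 ^ level u <= gsize u)%N, (gsize u < 2 ^ (level u).+1)%N & (h <= level u)%N].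
Proof.
rewrite /tiny -leqNgt => hu.
have g0 : (0 < gsize u)%N by apply: leq_trans hu; rewrite expn_gt0.
have /andP[h1 h2] := trunc_log_bounds (isT : (1 < 2)%N) g0.
by split => //; rewrite -ltnS -(ltn_exp2l _ _ (isT : 1 < 2)%N); apply: leq_ltn_trans h2.
Qed.

Lemma cell_lt l (s : 'I_N) : (h <= l)%N -> (offset s < 2 ^ l.+1)%N ->
  (cell l s < 2 ^ h.+2)%N.
Proof.
move=> hl sl; rewrite /cell ltn_divLR ?expn_gt0 // -expnD.
have -> : (h.+2 + (l - h) = l.+2)%N by lia.
by rewrite [(2 ^ l.+2)%N]expnS; move: sl; rewrite /offset; lia.
Qed.

Lemma cell_eq l (s t : 'I_N) : (offset s < 2 ^ l.+1)%N -> (offset t < 2 ^ l.+1)%N ->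
  cell l s = cell l t -> `|s%:R - t%:R| <= (2 ^ (l - h))%:R :> R.
Proof.
move=> sl tl; rewrite /cell => e; have p : (0 < 2 ^ (l - h))%N by rewrite expn_gt0.
have := divn_eq (s + 2 ^ l.+1 - M) (2 ^ (l - h)).
have := divn_eq (t + 2 ^ l.+1 - M) (2 ^ (l - h)).
have := ltn_pmod (s + 2 ^ l.+1 - M) p; have := ltn_pmod (t + 2 ^ l.+1 - M) p.
rewrite e; move: (_ %% _)%N (_ %% _)%N (_ %/ _ * _)%N => x y z hx hy ez ez'.
move: sl tl; rewrite /offset => sl tl.
have [h1 h2] : (s <= t + 2 ^ (l - h))%N /\ (t <= s + 2 ^ (l - h))%N by split; lia.
rewrite ler_norml -(ler_nat R) natrD in h1 *; rewrite -(ler_nat R) natrD in h2.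
by apply/andP; split; lra.
Qed.

(** At level [l], [gp u'] has modulus at least 2^l, and [a] is within 1 + 2 * 2^(l - h) of it: 1 for
    the rounding and one cell length in each direction. *)
Lemma class_close a u u' : ~~ tiny u -> ~~ tiny u' -> class u = class u' ->
  normc (a - gp u) <= 1 ->
  normc (a / gp u' - 1) <= 3 / (2 ^ h)%:R /\ (2 ^ h)%:R <= normc (gp u').
Proof.
move=> tu tu' [] e1 e2 e3 au.
have [a1 a2 a3] := level_bounds tu; have [b1 b2 b3] := level_bounds tu'.
have lM (w : _) : (level w < (trunc_log 2 M).+1)%N.
  by rewrite ltnS leq_trunc_log // /gsize geq_max !offset_le.
have lvE : level u = level u'.
  by rewrite -(inordK (lM u)) -(inordK (lM u')) e1.
have [oa ob] : (offset u.1 < 2 ^ (level u).+1)%N /\ (offset u.2 < 2 ^ (level u).+1)%N.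
  by move: a2; rewrite /gsize; lia.
have [oc od] : (offset u'.1 < 2 ^ (level u').+1)%N /\ (offset u'.2 < 2 ^ (level u').+1)%N.
  by move: b2; rewrite /gsize; lia.
have c1 : cell (level u) u.1 = cell (level u) u'.1.
  rewrite -[LHS](@inordK (2 ^ h.+2)) ?e2 ?lvE ?inordK // ltnS ltnW // cell_lt // -?lvE //.
have c2 : cell (level u) u.2 = cell (level u) u'.2.
  rewrite -[LHS](@inordK (2 ^ h.+2)) ?e3 ?lvE ?inordK // ltnS ltnW // cell_lt // -?lvE //.
rewrite -lvE in oc od b1 b3.
have d1 := cell_eq oa oc c1; have d2 := cell_eq ob od c2.
set l := level u in d1 d2 a3 b1 *.
have lg : (2 ^ l)%:R <= normc (gp u').
  by apply: le_trans (gsize_le_normc u'); rewrite ler_nat.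
have hl : (2 ^ h)%:R * (2 ^ (l - h))%:R = (2 ^ l)%:R :> R.
  by rewrite -natrM -expnD subnKC.
have h0 : 0 < (2 ^ h)%:R :> R by rewrite ltr0n expn_gt0.
have k1 : 1 <= (2 ^ (l - h))%:R :> R by rewrite ler1n expn_gt0.
have g0 : 0 < normc (gp u') by apply: lt_le_trans lg; rewrite ltr0n expn_gt0.
split; last by apply: le_trans lg; rewrite ler_nat leq_exp2l.
have gn0 : gp u' != 0 by apply/eqP => e; move: g0; rewrite e normc0 ltxx.
have -> : a / gp u' - 1 = (a - gp u') / gp u' by rewrite mulrBl divff.
rewrite normcM normcV ler_pdivrMr // mulrAC ler_pdivlMr //.
have : normc (a - gp u') <= 3 * (2 ^ (l - h))%:R.
  have -> : a - gp u' = (a - gp u) + (gp u - gp u') by ring.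
  apply: le_trans (ler_normcD _ _) _.
  apply: (@le_trans _ _ (1 + (2 ^ (l - h))%:R + (2 ^ (l - h))%:R)); last by lra.
  rewrite -addrA lerD //; apply: le_trans (normc_le_ReIm _) _.
  rewrite ReD ImD ReN ImN /=.
  have sub (x y z : R) : x - z - (y - z) = x - y by ring.
  by rewrite !sub lerD.
by move=> k2; nra.
Qed.

(** Nearest integer, shifted to an index. [absz] and [inord] change nothing when |x| <= M. *)
Definition rnd (x : R) : 'I_N := inord (absz (Num.floor (x + 1 / 2) + M%:Z)).

Lemma rndP (x : R) : `|x| <= M%:R -> `|x - ((rnd x)%:R - M%:R)| <= 1 / 2.
Proof.
rewrite ler_norml => /andP[x1 x2]; rewrite /rnd.
have := floor_itv (x + 1 / 2); rewrite intrD mulr1z; set k := Num.floor _ => /andP[k1 k2].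
have k3 : (- (M%:Z) - 1 < k)%R.
  by rewrite -(ltr_int R) intrB intrN mulr1z -pmulrn; lra.
have k4 : (k < M%:Z + 1)%R.
  by rewrite -(ltr_int R) intrD mulr1z -pmulrn; lra.
rewrite inordK; last by lia.
have -> : (absz (k + M%:Z))%:R = k%:~R + M%:R :> R.
  rewrite pmulrn abszE ger0_norm; last by lia.
  by rewrite rmorphD.
by rewrite addrK ler_norml; apply/andP; split; lra.
Qed.

Definition round a := (rnd (complex.Re a), rnd (complex.Im a)).

Lemma round_near a : normc a <= M%:R -> normc (a - gp (round a)) <= 1.
Proof.
move=> aM; apply: le_trans (normc_le_ReIm _) _; rewrite ReD ImD ReN ImN /=.
have h1 := rndP (le_trans (normc_Re a) aM); have h2 := rndP (le_trans (normc_Im a) aM).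
by move: (lerD h1 h2); rewrite -mulrDl divff.
Qed.

Definition origin : 'I_N * 'I_N := (inord M, inord M).

Lemma gp_origin : gp origin = 0.
Proof.
rewrite /gp /grid_point /origin /= inordK ?subrr // -addnn; lia.
Qed.

(** A coordinate of size below 2^h is not known to relative precision 2^-h after a rounding error of
    1, so its class would carry no information. *)
Definition encode a := if tiny (round a) then origin else round a.

Lemma encode_near a : normc a <= M%:R -> normc (a - gp (encode a)) <= (2 ^ h.+2)%:R.
Proof.
move=> /round_near aM; have h0 : 1 <= (2 ^ h)%:R :> R by rewrite ler1n expn_gt0.
have e : (2 ^ h.+2)%:R = 4 * (2 ^ h)%:R :> R by rewrite !expnS mulnA natrM.
rewrite /encode; case: ifP => t; last by apply: le_trans aM _; rewrite e; lra.
rewrite gp_origin subr0 -[a](subrK (gp (round a))).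
apply: le_trans (ler_normcD _ _) _.
have t' : (gsize (round a))%:R <= (2 ^ h)%:R :> R by rewrite ler_nat ltnW.
by move: (normc_le_gsize (round a)); rewrite e; lra.
Qed.

End Rounding.

(** * Counting the roundings *)

Section Counting.
Variables (R : realType) (n : nat) (F : finType) (mu : F -> R) (f : F -> R[i]).
Variables (kap c0 q th rho p1 : R) (M h L r m1 : nat).
Local Notation I := 'I_n.
Local Notation G := ('I_(M.*2.+1) * 'I_(M.*2.+1))%type.
Local Notation K := ('I_r.+1 * bool)%type.
Hypothesis mu0 : forall c, 0 <= mu c.
Hypothesis mu1 : \sum_c mu c = 1.
Hypothesis f_bound : forall c, normc (f c) <= kap.
Hypothesis c00 : 0 < c0.
Hypothesis q0 : 0 < q.
Hypothesis q1 : q <= 1.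
Hypothesis kap0 : 0 <= kap.
Hypothesis nondeg : forall c', q <= \sum_c mu c * (c0 <= `|complex.Re (f c' - f c)|)%R%:R.
Hypothesis th01 : 0 <= th <= 1.
Hypothesis rho0 : 0 < rho.
Hypothesis rho_h : rho <= 5 * (2 ^ h)%:R.
Hypothesis h3 : 3 / (2 ^ h)%:R <= 1 :> R.
Hypothesis h_c0 : 3 / (2 ^ h)%:R * (4 * kap) <= c0.
Hypothesis L0 : (0 < L)%N.
Hypothesis m1_large : (#|label M h| * (2 * r.+1 * L) <= m1)%N.
Hypothesis p10 : 0 < p1.
Hypothesis p11 : p1 <= 1.

Let rho' := 2 * rho + L%:R * (2 * kap).
Definition relation_cost : R :=
  (Num.sqrt r.+1%:R)^-1 * r.+1%:R^-1 *
  (4 / (q / 2) * ((2 * 5 + 8 * L%:R * kap) / (c0 / 2) + 1)).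
Definition choice_bound : R := (2 * ((2 * rho + L%:R * (2 * kap)) / c0) + 1) ^+ 2.
(** Both gains are mean popularities: the error terms take at most half of [p1], and what remains,
    at least p1 / (9 [relation_cost]) or p1 / 9, is shared by 2L(r + 1) or 2L coordinates. *)
Definition long_gain : R := p1 / (9 * relation_cost * (2 * L%:R * r.+1%:R)).
Definition short_gain : R := p1 / (18 * L%:R).
Let delta k : R := if (k < m1)%N then short_gain else long_gain.

Hypothesis err_long : r.+1%:R * (1 - th) ^+ (2 * L) + (2 ^ r.+1)%:R^-1 <= p1 / 4.
Hypothesis err_mid : relation_cost * (9 / 2 * (2 * r.+1%:R * (1 - th * q) ^+ L)) <= p1 / 4.
Hypothesis err_short : 9 * (1 - th * q) ^+ L <= p1 / 2.

Definition concentrated (a : I -> R[i]) := forall B : {set I} -> R,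
  (forall S z, Ex mu (fun phi : {ffun I -> F} =>
     (normc (z + walk f a S phi) <= rho)%R%:R) <= B S) ->
  p1 <= ES th B.

Definition admissible (a : I -> R[i]) :=
  (forall i, normc (a i) <= M%:R) /\ concentrated a.

Implicit Types (J D A : {set I}) (lab : {ffun I -> label M h}) (v e : {ffun I -> G}).

Let fiber A (c : {ffun I -> K}) k := [set i in A | c i == k].

(* [Ac.1] is the set of coordinates among which one is removed, and [Ac.2] splits
   it into half-blocks of length [L], two for each index in ['I_r.+1]. *)
Definition selects lab J (Ac : {set I} * {ffun I -> K}) : bool :=
  (Ac.1 \subset J) && if (#|J| < m1)%N then
    [&& #|Ac.1| == (2 * L)%N, [forall i in Ac.1, (Ac.2 i).1 == ord0] &
        [forall hf : bool, #|fiber Ac.1 Ac.2 (ord0, hf)| == L]]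
  else [&& #|Ac.1| == (2 * r.+1 * L)%N, [forall k, #|fiber Ac.1 Ac.2 k| == L] &
        [exists c, [forall i in Ac.1, lab i == c]]].

(** A choice fixed by [lab] and [J], hence common to all vectors with these labels. The default [J]
    keeps the first component inside [J] even when nothing can be selected. *)
Definition selection lab J : {set I} * {ffun I -> K} :=
  odflt (J, [ffun=> (ord0, true)]) [pick Ac | selects lab J Ac].

Let Sel lab J := (selection lab J).1.
Let part lab J := (selection lab J).2.

Lemma Sel_subset lab J : Sel lab J \subset J.
Proof.
by rewrite /Sel /selection; case: pickP => [Ac /andP[]|_] /=.
Qed.

Lemma selectionP lab J : (2 * L <= #|J|)%N -> selects lab J (selection lab J).
Proof.
move=> LJ; suff [Ac hAc] : exists Ac, selects lab J Ac.
  by rewrite /selection; case: pickP => [//|/(_ Ac)]; rewrite hAc.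
rewrite /selects; case: (ltnP #|J| m1) => Jm.
  have [A AJ cA] := subset_of_card LJ.
  have [|c [cin cfib]] := @equipartition I K (ord0, true) A
      [set (ord0, true); (ord0, false)] L.
    by rewrite cards2 cA.
  exists (A, c); rewrite /= AJ cA eqxx /=; apply/andP; split.
    by apply/forall_inP => i /cin; rewrite !inE => /orP[] /eqP ->.
  by apply/forallP => -[]; rewrite cfib // !inE ?eqxx ?orbT.
have lab0 : (0 < #|label M h|)%N.
  by apply/card_gt0P; exists (class h (origin M)).
have [A /andP[AJ /eqP cA] [c hc]] := pigeonhole_class lab (leq_trans m1_large Jm) lab0.
have [|d [din dfib]] := @equipartition I K (ord0, true) A [set: K] L.
  by rewrite cA cardsT card_prod card_ord card_bool [(r.+1 * 2)%N]mulnC.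
exists (A, d); rewrite /= AJ cA eqxx /=; apply/andP; split.
  by apply/forallP => k; rewrite dfib ?inE.
by apply/existsP; exists c; apply/forall_inP => i /hc ->.
Qed.

Let gv v (i : I) : R[i] := gp R (v i).
Let blk lab J j := fiber (Sel lab J) (part lab J) (part lab J j).
Definition popularity lab J j v : R :=
  popS mu f c0 th rho' (blk lab J j) j (gv v) (gv v j).

Let rho'0 : 0 <= rho'.
Proof. by rewrite addr_ge0 ?mulr_ge0 // ltW. Qed.

Lemma choice_bound_ge1 : 1 <= choice_bound.
Proof.
rewrite /choice_bound -[leLHS](expr1n R 2) lerXn2r ?nnegrE ?addr_ge0 //.
all: have h0 : 0 <= 2 * (rho' / c0) by rewrite mulr_ge0 // divr_ge0 // ltW.
  by [].
by rewrite lerDr.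
Qed.

Lemma popularity_ge0 lab J j v : 0 <= popularity lab J j v.
Proof. exact: popS_ge0. Qed.

Lemma popularity_le1 lab J j v : popularity lab J j v <= 1.
Proof.
rewrite /popularity /popS -[leRHS](ES_const I th); apply: ES_le => // S.
rewrite -[leRHS]mul1r; apply: ler_pM; rewrite ?pop_ge0 ?lern1 ?leq_b1 //.
apply: Ex_le_const => // phi; apply: Ex_le_const => // psi.
by rewrite -[leRHS]mul1r; apply: ler_pM; rewrite ?lern1 ?leq_b1.
Qed.

Lemma popularity_local lab J j v v' : j \in Sel lab J -> {in J, v =1 v'} ->
  popularity lab J j v = popularity lab J j v'.
Proof.
move=> jS vv; rewrite /popularity /gv -(vv j) ?(fintype.subsetP (Sel_subset lab J)) //.
apply: eq_popS => i; rewrite !inE => /and3P[_ iS _].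
by rewrite vv // (fintype.subsetP (Sel_subset lab J)).
Qed.

Lemma popularity_sum lab J j v :
  \sum_u popularity lab J j (upd v j u) <= choice_bound.
Proof.
apply: le_trans (sum_popS f mu0 mu1 c00 th01 M.*2.+1 M%:R (blk lab J j) j (gv v) rho'0).
apply: ler_sum => u _; rewrite /popularity le_eqVlt; apply/orP; left; apply/eqP.
rewrite {2}/gv /upd ffunE eqxx; apply: eq_popS => i.
by rewrite !inE /gv ffunE => /andP[/negPf ->].
Qed.

Definition enc (a : I -> R[i]) : {ffun I -> G} := [ffun i => encode M h (a i)].
Definition supp v := [set i | v i != origin M].

Lemma relation_cost_gt0 : 0 < relation_cost.
Proof.
have q20 : 0 < q / 2 by rewrite divr_gt0.
have c02 : 0 <= c0 / 2 by rewrite divr_ge0 // ltW.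
have k0 : 0 <= (2 * 5 + 8 * L%:R * kap) / (c0 / 2).
  by rewrite divr_ge0 // addr_ge0 ?mulr_ge0.
apply: mulr_gt0; first by apply: mulr_gt0; rewrite invr_gt0 ?sqrtr_gt0 ltr0n.
by apply: mulr_gt0; [rewrite divr_gt0 | rewrite ltr_wpDl].
Qed.

Let costP := relation_cost_gt0.

(** Coordinates in the support are not tiny, so each is within 1 of its code. From [m1] coordinates
    on, the selected ones share a class, and the code of any of them, [i0], serves as [u0]. *)
Lemma enc_popular a lab : admissible a ->
  (forall i, i \in supp (enc a) -> lab i = class h (enc a i)) ->
  popular (popularity lab) (Sel lab) (2 * L).-1 delta (supp (enc a)) (enc a).
Proof.
move=> [aM conc] hlab J JD; rewrite prednK ?muln_gt0 ?L0 // => LJ.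
set e := enc a.
have eP i : i \in J -> ~~ tiny h (e i) /\ normc (a i - gv e i) <= 1.
  move/(fintype.subsetP JD); rewrite inE /gv /e /enc ffunE /encode.
  case: ifP => [|/negbT t]; first by rewrite eqxx.
  by move=> _; split => //; apply: round_near.
have := selectionP lab LJ; rewrite /selects /delta -/(Sel lab J) -/(part lab J).
set A := Sel lab J; set c := part lab J => /andP[AJ].
have eA i : i \in A -> normc (a i - gv e i) <= 1.
  by move/(fintype.subsetP AJ)/eP => [].
case: (ltnP #|J| m1) => Jm /and3P[/eqP cA].
  move=> /forall_inP c0A /forallP cfib.
  have dis : [disjoint fiber A c (ord0, true) & fiber A c (ord0, false)].
    rewrite finset.disjoints_subset; apply/fintype.subsetP => i; rewrite !inE.
    by move=> /andP[_ /eqP ->]; rewrite andbF.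
  have AE : A = fiber A c (ord0, true) :|: fiber A c (ord0, false).
    apply/setP => i; rewrite !inE; case: (boolP (i \in A)) => //= iA.
    by have := c0A _ iA; case: (c i) => x [] /= /eqP ->; rewrite !eqxx ?orbT.
  have := short_relation mu0 mu1 f_bound kap0 nondeg rho0 (lexx _) conc dis
    (eqP (cfib true)) (eqP (cfib false)).
  rewrite -AE => /(_ _ eA).
  have SE : \sum_(j in fiber A c (ord0, true)) popS mu f c0 th rho' (fiber A c (ord0, true)) j (gv e) (gv e j) +
     \sum_(j in fiber A c (ord0, false)) popS mu f c0 th rho' (fiber A c (ord0, false)) j (gv e) (gv e j)
     = \sum_(j in A) popularity lab J j e.
    transitivity (\sum_(j in fiber A c (ord0, true)) popularity lab J j e +
                  \sum_(j in fiber A c (ord0, false)) popularity lab J j e).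
      congr (_ + _); apply: eq_bigr => j; rewrite inE => /andP[_ /eqP cj];
      by rewrite /popularity /blk -/A -/c cj.
    rewrite -bigU; last exact: dis.
    by apply: eq_bigl => j; rewrite [in RHS]AE !inE.
  rewrite -/rho' SE => hp; rewrite cA /short_gain natrM.
  have Lp : 0 < L%:R :> R by rewrite ltr0n.
  have -> : p1 / (18 * L%:R) * (2 * L%:R) = p1 / 9 by field; rewrite lt0r_neq0.
  by move: hp err_short; lra.
move=> /forallP cfib /existsP[cl /forall_inP hcl].
have /card_gt0P[i0 i0A] : (0 < #|A|)%N by rewrite cA !muln_gt0 L0.
have closeA i : i \in A -> normc (a i / gv e i0 - 1) <= 3 / (2 ^ h)%:R /\
    (2 ^ h)%:R <= normc (gv e i0).
  move=> iA; have iJ := fintype.subsetP AJ _ iA; have i0J := fintype.subsetP AJ _ i0A.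
  have [t1 n1] := eP _ iJ; have [t2 _] := eP _ i0J.
  apply: (class_close (u := e i)) => //.
  have := hlab i (fintype.subsetP JD _ iJ); have := hlab i0 (fintype.subsetP JD _ i0J).
  by rewrite (eqP (hcl _ iA)) (eqP (hcl _ i0A)) -/e => <- <-.
have [_ u0h] := closeA _ i0A.
have h0 : 0 < (2 ^ h)%:R :> R by rewrite ltr0n expn_gt0.
have u0n : 0 < normc (gv e i0) by apply: lt_le_trans u0h.
have u00 : gv e i0 != 0 by apply/eqP => z; move: u0n; rewrite z normc0 ltxx.
have rrE : rho / normc (gv e i0) <= 5.
  by rewrite ler_pdivrMr //; apply: le_trans rho_h _; rewrite ler_pM2l.
have fibE k hf : [set i in A | ((c i).1 == k) && ((c i).2 == hf)] = fiber A c (k, hf).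
  by apply/setP => i; rewrite !inE.
have bL k hf : #|[set i in A | ((c i).1 == k) && ((c i).2 == hf)]| = L.
  by rewrite fibE; apply/eqP.
have := @long_relation _ _ _ mu f kap c0 q th mu0 mu1 f_bound c00 q0 q1 kap0 nondeg
  rho rho' p1 a (gv e) L rho0 (lexx _) conc 'I_r.+1 (fun i => (c i).1) (fun i => (c i).2) A bL.
rewrite card_ord => /(_ isT eA (gv e i0) (3 / (2 ^ h)%:R) 5 u00 (fun i iA => (closeA i iA).1) h3 h_c0 rrE).
rewrite -/relation_cost.
have -> : \sum_(j in A) popS mu f c0 th rho'
   [set i in A | ((c i).1 == (c j).1) && ((c i).2 == (c j).2)] j (gv e) (gv e j) =
   \sum_(j in A) popularity lab J j e.
  by apply: eq_bigr => j _; rewrite fibE -surjective_pairing.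
move=> hp.
have {}hp : p1 <= p1 / 4 + (p1 / 4 + relation_cost * (9 / 2 * \sum_(j in A) popularity lab J j e)).
  apply: le_trans hp _.
  rewrite lerD // [9 / 2 * (_ + _)]mulrDr [relation_cost * (_ + _)]mulrDr lerD //.
rewrite cA /long_gain.
have -> : (2 * r.+1 * L)%:R = 2 * L%:R * r.+1%:R :> R by rewrite !natrM; ring.
have Lr0 : 2 * L%:R * r.+1%:R != 0 :> R.
  by rewrite !mulf_neq0 // pnatr_eq0 -?lt0n.
have cn0 : relation_cost != 0 by rewrite lt0r_neq0.
have cancel (x y z : R) : y != 0 -> z != 0 -> x / (y * z) * z = x / y.
  by move=> y0 z0; field; rewrite y0 z0.
have c9 : 9 * relation_cost != 0 by rewrite mulf_neq0 // pnatr_eq0.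
rewrite cancel // ler_pdivrMr; last by rewrite mulr_gt0.
move: hp; rewrite mulrCA; lra.
Qed.

Let base := (2 * L).-1.

Let Sel_nonempty lab J : (base < #|J|)%N -> (0 < #|Sel lab J|)%N.
Proof.
rewrite /base prednK ?muln_gt0 ?L0 // => LJ.
have := selectionP lab LJ; rewrite /selects -/(Sel lab J) => /andP[_].
by case: ifP => _ /andP[/eqP -> _]; rewrite !muln_gt0 L0.
Qed.

Let short0 : 0 < short_gain.
Proof. by rewrite divr_gt0 // mulr_gt0 // ltr0n. Qed.

Let short1 : short_gain <= 1.
Proof.
rewrite /short_gain ler_pdivrMr ?mulr_gt0 ?ltr0n // mul1r.
by apply: le_trans p11 _; rewrite -natrM ler1n muln_gt0 L0.
Qed.

Let long0 : 0 < long_gain.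
Proof.
have L0' : 0 < L%:R :> R by rewrite ltr0n.
apply: divr_gt0 => //; apply: mulr_gt0; first exact: mulr_gt0.
by apply: mulr_gt0; [exact: mulr_gt0 | rewrite ltr0n].
Qed.

Let selection_short lab lab' J : (#|J| < m1)%N -> selection lab J = selection lab' J.
Proof.
by move=> Jm; congr odflt; apply: eq_pick => Ac; rewrite /selects Jm.
Qed.

Let delta_ge0 k : 0 <= delta k.
Proof. by rewrite /delta; case: ifP => _; apply: ltW. Qed.

Let Cn := choice_bound.
Let Cn1 : 1 <= Cn := choice_bound_ge1.

(** The [base] last coordinates are free, and at most [m1] removals are paid at the low gain. *)
Definition short_count : R := (#|{: G}|%:R) ^+ base * (Cn / short_gain) ^+ m1.

Let card_G1 : 1 <= #|{: G}|%:R :> R.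
Proof. by rewrite ler1n; apply/card_gt0P; exists (origin M). Qed.

Lemma short_count_ge0 : 0 <= short_count.
Proof. by rewrite mulr_ge0 // exprn_ge0 // divr_ge0 // ?ltW // (lt_le_trans ltr01). Qed.

Lemma count_support (V : {set {ffun I -> G}}) D lab :
  (forall e, e \in V -> supported (origin M) D e /\
     popular (popularity lab) (Sel lab) base delta D e) ->
  #|V|%:R <= if (#|D| < m1)%N then short_count else short_count * (Cn / long_gain) ^+ n.
Proof.
move=> hV; have sg := short0; have lg := long0.
have Cn0 : 0 < Cn by apply: lt_le_trans Cn1.
have cs1 : 1 <= Cn / short_gain by rewrite ler_pdivlMr // mul1r (le_trans short1).
have [Db|bD] := leqP #|D| base.
  have Vb : #|V|%:R <= #|{: G}|%:R ^+ base :> R.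
    apply: (@le_trans _ _ (#|{: G}|%:R ^+ #|D|)); last by rewrite ler_weXn2l.
    rewrite -(card_supported R (origin M) D) -sum1_card natr_sum big_mkcond [leRHS]big_mkcond.
    apply: ler_sum => e _ /=; case: (boolP (e \in V)) => [/hV[-> _] //|_].
    by case: ifP.
  have bs : #|{: G}|%:R ^+ base <= short_count.
    by rewrite /short_count ler_peMr ?exprn_ge0 // exprn_ege1.
  case: ifP => // Dm; first exact: le_trans bs.
  have base_m1 : (base < m1)%N.
    apply: (@leq_trans (2 * L)); first by rewrite /base prednK // muln_gt0 L0.
    apply: leq_trans m1_large; have lab0 : (0 < #|label M h|)%N.
      by apply/card_gt0P; exists (class h (origin M)).
    by rewrite -[leqLHS]mul1n leq_mul // leq_mul2r leq_pmulr ?orbT.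
  by move: Dm; rewrite (leq_ltn_trans Db).
have [k cD] : exists k, #|D| = (base + k)%N by exists (#|D| - base)%N; rewrite subnKC // ltnW.
have kn : (k <= n)%N.
  by rewrite -[n]card_ord; apply: leq_trans (max_card (mem D)); rewrite cD leq_addl.
have cnt := popular_count (@popularity_ge0 lab) (@popularity_local lab) (@Sel_subset lab)
  (@Sel_nonempty lab) (ltW Cn0) (fun J j v _ _ => popularity_sum lab J j v) delta_ge0 hV cD.
case: ifP => Dm.
  have dE : \prod_(l < k) delta (base + l.+1) = short_gain ^+ k.
    rewrite -[k in RHS]card_ord -prodr_const; apply: eq_bigr => l _; rewrite /delta.
    rewrite (leq_ltn_trans _ Dm) // cD leq_add2l.
    exact: ltn_ord.
  rewrite dE -ler_pdivlMr ?exprn_gt0 // in cnt; apply: le_trans cnt _.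
  rewrite mulrAC -expr_div_n mulrC /short_count ler_wpM2l ?exprn_ge0 //.
  by rewrite ler_weXn2l // -(leq_add2l base) -cD (leq_trans (ltnW Dm)) // leq_addl.
have [->|[e eV]] := set_0Vmem V.
  rewrite cards0 mulr_ge0 ?short_count_ge0 // exprn_ge0 // divr_ge0 // ltW //.
(* Popularities are at most 1, and an element of [V] has mean popularity at least [long_gain] on
   [Sel lab D]. *)
have long1 : long_gain <= 1.
  have [_ /(_ _ (fintype.subxx _) bD)] := hV _ eV; rewrite /delta Dm => pD.
  have S0 : 0 < #|Sel lab D|%:R :> R by rewrite ltr0n Sel_nonempty.
  rewrite -(ler_pM2r S0) mul1r; apply: le_trans pD _.
  by rewrite -sumr_const; apply: ler_sum => j _; apply: popularity_le1.
have low := prod_two_levels base m1 short0 short1 long0 long1 kn.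
have {}cnt := le_trans (ler_wpM2l (ler0n _ _) low) cnt.
rewrite -ler_pdivlMr ?mulr_gt0 ?exprn_gt0 // in cnt; apply: le_trans cnt _.
have -> : short_count * (Cn / long_gain) ^+ n =
   (Cn ^+ m1 * Cn ^+ n) * #|{: G}|%:R ^+ base / (short_gain ^+ m1 * long_gain ^+ n).
  have gen (x a b c d : R) : x * (a / b) * (c / d) = (a * c) * x / (b * d).
    by rewrite invfM; ring.
  by rewrite /short_count !expr_div_n gen.
apply: ler_wpM2r; first by rewrite invr_ge0 ltW // mulr_gt0 // exprn_gt0.
apply: ler_wpM2r; first by rewrite exprn_ge0.
have Ck : Cn ^+ k <= Cn ^+ n by rewrite ler_weXn2l.
apply: le_trans Ck _; apply: ler_peMl; last exact: exprn_ege1.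
by apply: exprn_ge0; apply: ltW.
Qed.

Let popular_short lab lab' D e : (#|D| < m1)%N ->
  popular (popularity lab) (Sel lab) base delta D e ->
  popular (popularity lab') (Sel lab') base delta D e.
Proof.
move=> Dm pe J JD bJ; have := pe J JD bJ.
have Jm : (#|J| < m1)%N by apply: leq_ltn_trans Dm; apply: subset_leq_card.
rewrite /popularity /blk /Sel /part (selection_short lab lab' Jm).
exact.
Qed.

(** A small support only costs the choice of the support; a large one also costs a label for each
    coordinate. *)
Lemma admissible_cover :
  exists V : {set {ffun I -> G}},
    #|V|%:R <= (n.+1 ^ m1)%:R * short_count +
       (2 * #|label M h|%:R) ^+ n * (short_count * (Cn / long_gain) ^+ n) /\
    forall a, admissible a -> exists2 e, e \in V &
      forall i, normc (a i - gp R (e i)) <= (2 ^ h.+2)%:R.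
Proof.
pose V := [set e | `[< exists2 a, admissible a & e = enc a >]].
exists V; split; last first.
  move=> a adm; exists (enc a); first by rewrite inE; apply/asboolP; exists a.
  by move=> i; rewrite /enc ffunE; apply: encode_near; case: adm.
have sc0 := short_count_ge0.
have VP e lab : e \in V -> (forall i, i \in supp e -> lab i = class h (e i)) ->
    supported (origin M) (supp e) e /\
    popular (popularity lab) (Sel lab) base delta (supp e) e.
  rewrite inE => /asboolP[a adm ->] hl; split; last exact: enc_popular.
  by apply/supportedP => i; rewrite inE negbK => /eqP.
have key : #|V|%:R = \sum_(e in V | (#|supp e| < m1)%N) 1 + \sum_(e in V | ~~ (#|supp e| < m1)%N) 1 :> R.
  by rewrite -sum1_card natr_sum (bigID (fun e => (#|supp e| < m1)%N)).
have sum1_le (Q : pred {ffun I -> G}) (W : {set {ffun I -> G}}) :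
    (forall e, Q e -> e \in W) -> \sum_(e | Q e) 1 <= #|W|%:R :> R.
  move=> QW; rewrite -sum1_card natr_sum big_mkcond [leRHS]big_mkcond /=.
  by apply: ler_sum => e _; case: ifP => [/QW ->|_] //; case: ifP.
rewrite key; apply: lerD.
  rewrite (partition_big supp (fun D => (#|D| < m1)%N)) /=; last by move=> e /andP[].
  apply: (@le_trans _ _ (\sum_(D : {set I} | (#|D| < m1)%N) short_count)).
    apply: ler_sum => D Dm; pose lab0 : {ffun I -> label M h} := [ffun=> class h (origin M)].
    apply: le_trans (sum1_le _ [set e in V | supp e == D] _) _.
      by move=> e /andP[/andP[eV _] eD]; rewrite inE eV.
    have := @count_support [set e in V | supp e == D] D lab0; rewrite Dm; apply => e.
    rewrite inE => /andP[eV /eqP eD]; rewrite -eD.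
    pose lab1 : {ffun I -> label M h} := [ffun i => class h (e i)].
    have [i _|se pe] := VP e lab1 eV; first by rewrite ffunE.
    split; first exact: se.
    by apply: popular_short pe; rewrite eD.
  rewrite sumr_const -[leLHS]mulr_natl ler_wpM2r // ler_nat.
  apply: leq_trans (card_small_sets n m1); apply: subset_leq_card.
  by apply/fintype.subsetP => D; rewrite inE => /ltnW.
pose cl e : {ffun I -> label M h} := [ffun i => class h (e i)].
rewrite (partition_big (fun e => (supp e, cl e)) predT) //=.
apply: (@le_trans _ _ (\sum_(p : {set I} * {ffun I -> label M h}) short_count * (Cn / long_gain) ^+ n)).
  apply: ler_sum => -[D lab] _ /=.
  pose W := [set e in V | [&& (m1 <= #|supp e|)%N, supp e == D & cl e == lab]].
  apply: le_trans (sum1_le _ W _) _.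
    by move=> e /andP[/andP[eV em] /eqP[eD el]]; rewrite inE eV leqNgt em eD el !eqxx.
  have [W0|[e0]] := set_0Vmem W.
    rewrite W0 cards0 mulr_ge0 // exprn_ge0 // divr_ge0 // ?ltW // (lt_le_trans ltr01) //.
  rewrite inE => /and4P[_ e0m /eqP e0D _].
  have := @count_support W D lab; rewrite ltnNge -e0D e0m /= e0D; apply => e.
  rewrite inE => /and4P[eV _ /eqP <- /eqP <-]; apply: VP => // i _.
  by rewrite ffunE.
rewrite sumr_const -[leLHS]mulr_natl ler_wpM2r //.
  by rewrite mulr_ge0 // exprn_ge0 // divr_ge0 // ?ltW // (lt_le_trans ltr01).
by rewrite card_prod card_ffun -cardsT -powersetT card_powerset cardsT !card_ord natrM exprMn !natrX.
Qed.

End Counting.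

(** * Discretisation of the step *)

Local Open Scope classical_set_scope.

Section ComplexMeasurable.
Variable R : realType.

Lemma measurable_open_complex (U : set R[i]) : @open R[i]^o U -> measurable U.
Proof. by move=> oU; apply: sub_gen_smallest. Qed.

Let open_preimage (g : R[i] -> R) (a : R) :
  (forall u v, `|g u - g v| <= normc (u - v)) -> @open R[i]^o (g @^-1` `]a, +oo[).
Proof.
move=> gL; rewrite openE => u /=; rewrite in_itv /= andbT => au.
(* The norm of [R[i]] is valued in [R[i]], so the radius of the ball is a complex number. *)
rewrite /interior -nbhs_ballE; exists ((g u - a)%:C)%C.
  by rewrite /= ltcR subr_gt0.
move=> v /=; rewrite /ball /= => uv; rewrite in_itv /= andbT.
have {uv} : normc (u - v) < g u - a.
  by move: uv; rewrite normc_def ltcR; case: (u - v).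
have := gL u v; rewrite ler_norml => /andP[h1 h2] h3; lra.
Qed.

Let lipschitz_measurable (g : R[i] -> R) :
  (forall u v, `|g u - g v| <= normc (u - v)) -> measurable_fun [set: R[i]] g.
Proof.
move=> gL; apply: (measurability _ (measurable_realfun.RGenOInfty.measurableE R)).
move=> _ [_ [a ->] <-]; rewrite setTI.
by apply: measurable_open_complex; apply: open_preimage.
Qed.

Lemma measurable_Re : measurable_fun [set: R[i]] (@complex.Re R).
Proof.
apply: lipschitz_measurable => u v; apply: le_trans (normc_Re _).
by rewrite ReD ReN.
Qed.

Lemma measurable_Im : measurable_fun [set: R[i]] (@complex.Im R).
Proof.
apply: lipschitz_measurable => u v; apply: le_trans (normc_Im _).
by rewrite ImD ImN.
Qed.

Lemma normc_sqr (u : R[i]) : normc u ^+ 2 = complex.Re u ^+ 2 + complex.Im u ^+ 2.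
Proof. by case: u => a b /=; rewrite sqr_sqrtr // addr_ge0 // sqr_ge0. Qed.

Lemma normc_leE (u : R[i]) (r : R) : 0 <= r ->
  (normc u <= r) = (complex.Re u ^+ 2 + complex.Im u ^+ 2 <= r ^+ 2).
Proof. by move=> r0; rewrite -normc_sqr ler_sqr ?nnegrE ?normc_ge0. Qed.

End ComplexMeasurable.

Section FiniteUnion.
Context {R : realType} {d : measure_display} {T : measurableType d} (P : probability T R).

Lemma prob_union_bound (J : finType) (Q : pred J) (A : J -> set T) (E : set T) :
  measurable E -> (forall j, Q j -> measurable (A j)) ->
  (forall t, E t -> exists2 j, Q j & A j t) ->
  (P E <= \sum_(j | Q j) P (A j))%E.
Proof.
move=> mE mA EA.
have mU : measurable (\big[setU/set0]_(j | Q j) A j).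
  by apply: bigsetU_measurable => j Qj; apply: mA.
apply: (@le_trans _ _ (P (\big[setU/set0]_(j | Q j) A j))).
  apply: le_measure; rewrite ?inE // => t /EA[j Qj Aj].
  by rewrite (bigD1 j) //=; left.
have : measurable (\big[setU/set0]_(j | Q j) A j) /\
   (P (\big[setU/set0]_(j | Q j) A j) <= \sum_(j | Q j) P (A j))%E; last by case.
elim/big_rec2: _ => [|j x B Qj [mB le]]; first by rewrite measure0.
split; first by apply: measurableU => //; apply: mA.
apply: le_trans (leeD2l _ le); exact: measureU2 (mA _ Qj) mB.
Qed.

Lemma prob_partition (J : finType) (g : T -> J) :
  (forall j, measurable (g @^-1` [set j])) ->
  (\sum_j P (g @^-1` [set j]) = 1)%E.
Proof.
move=> mg; rewrite -(probability_setT P).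
have -> : [set: T] = \big[setU/set0]_(k < #|J|) (g @^-1` [set enum_val k]).
  apply/seteqP; split => // t _; rewrite (bigD1 (enum_rank (g t))) //=.
  by left; rewrite /= enum_rankK.
rewrite measure_bigsetU_ord // => [|k l _ _ [t [/= -> /enum_val_inj]]] //.
rewrite (reindex_onto (@enum_val J predT) enum_rank) /=.
  by apply: eq_bigl => k; rewrite enum_valK eqxx.
by move=> j _; rewrite enum_rankK.
Qed.

End FiniteUnion.

Section Discretise.
Variables (R : realType) (M0 N0 : nat).
Hypothesis N00 : (0 < N0)%N.
Local Notation mesh := (2 * M0 * N0)%N.
Local Notation F := (option ('I_mesh.+1 * 'I_mesh.+1)).

Let inbox (y : R) := (- M0%:R <= y < M0%:R)%R.
Let idx (y : R) : 'I_mesh.+1 := inord (Num.truncn ((y + M0%:R) * N0%:R)).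

Definition disc (u : R[i]) : F :=
  if inbox (complex.Re u) && inbox (complex.Im u)
  then Some (idx (complex.Re u), idx (complex.Im u)) else None.

Let dval (s : 'I_mesh.+1) : R := s%:R / N0%:R - M0%:R.

Definition disc_val (c : F) : R[i] :=
  if c is Some st then Complex (dval st.1) (dval st.2) else 0.

Let N0R : 0 < N0%:R :> R. Proof. by rewrite ltr0n. Qed.

Let idxE y s : inbox y -> (idx y == s) = (s%:R <= (y + M0%:R) * N0%:R < s%:R + 1)%R.
Proof.
move=> /andP[y1 y2]; set z := _ * _.
have z0 : 0 <= z by rewrite mulr_ge0 // -lerBlDr sub0r.
have zm : z < mesh%:R.
  by rewrite natrM ltr_pM2r // natrM; lra.
have tm : (Num.truncn z < mesh.+1)%N.
  rewrite ltnS -(ler_nat R); apply: le_trans (ltW zm); exact: (andP (truncn_itv z0)).1.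
have -> : (idx y == s) = (Num.truncn z == s).
  apply/eqP/eqP => [<-|e]; first by rewrite /idx inordK.
  by apply: val_inj; rewrite /= /idx inordK.
by rewrite natr1; apply/eqP/idP => [<-|]; [apply: truncn_itv | apply: truncn_def].
Qed.

Let idx_near y : inbox y -> `|y - dval (idx y)| <= N0%:R^-1.
Proof.
move=> yb; have := idxE (idx y) yb; rewrite eqxx => /esym/andP[h1 h2].
have e : y - dval (idx y) = ((y + M0%:R) * N0%:R - (idx y)%:R) / N0%:R.
  by rewrite /dval mulrBl mulfK ?lt0r_neq0 //; ring.
rewrite e normrM normfV (gtr0_norm N0R) ler_pdivrMr // mulVf ?lt0r_neq0 //.
by rewrite ler_norml; apply/andP; split; lra.
Qed.

Lemma disc_near u : disc u != None -> normc (u - disc_val (disc u)) <= 2 / N0%:R.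
Proof.
rewrite /disc; case: ifP => // /andP[h1 h2] _.
apply: le_trans (normc_le_ReIm _) _; rewrite ReD ImD ReN ImN /=.
by rewrite mulr_natl mulr2n lerD // idx_near.
Qed.

Lemma disc_some u : normc u < M0%:R -> disc u != None.
Proof.
move=> uM; rewrite /disc; case: ifP => // /negP; case; rewrite /inbox.
have h1 := le_lt_trans (normc_Re u) uM; have h2 := le_lt_trans (normc_Im u) uM.
by move: h1 h2; rewrite !ltr_norml => /andP[/ltW -> ->] /andP[/ltW -> ->].
Qed.

Let measurable_slab (g : R[i] -> R) (B : set R) :
  measurable_fun [set: R[i]] g -> measurable B -> measurable [set u | B (g u)].
Proof. by move=> mg mB; rewrite -[X in measurable X]setTI; apply: mg. Qed.

Let measurable_box (g : R[i] -> R) (a b : R) : measurable_fun [set: R[i]] g ->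
  measurable [set u | (a <= g u < b)%R].
Proof.
move=> mg; have := measurable_slab mg (measurable_itv (Interval (BLeft a) (BLeft b))).
by congr measurable; apply/seteqP; split => u /=; rewrite in_itv.
Qed.

Lemma measurable_disc c : measurable (disc @^-1` [set c]).
Proof.
have mbox : measurable [set u : R[i] | inbox (complex.Re u) && inbox (complex.Im u)].
  have := measurableI _ _ (measurable_box (- M0%:R) M0%:R (@measurable_Re R))
     (measurable_box (- M0%:R) M0%:R (@measurable_Im R)).
  by congr measurable; apply/seteqP; split => u /= => [[h1 h2]|/andP //]; apply/andP.
case: c => [[s t]|].
  have ms (g : R[i] -> R) (k : 'I_mesh.+1) : measurable_fun [set: R[i]] g ->
      measurable [set u | (k%:R <= (g u + M0%:R) * N0%:R < k%:R + 1)%R].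
    move=> mg.
    have := measurable_box (k%:R / N0%:R - M0%:R) ((k%:R + 1) / N0%:R - M0%:R) mg.
    by congr measurable; apply/seteqP; split => u /=;
      rewrite lerBlDr ler_pdivrMr // ltrBrDr ltr_pdivlMr.
  have := measurableI _ _ mbox (measurableI _ _ (ms _ s (@measurable_Re R)) (ms _ t (@measurable_Im R))).
  congr measurable; apply/seteqP; split => u /=.
    case=> /andP[h1 h2] []; rewrite -(idxE s h1) -(idxE t h2) => /eqP <- /eqP <-.
    by rewrite /disc h1 h2.
  rewrite /disc; case: ifP => // /andP[h1 h2] [<- <-].
  by rewrite -!idxE // !eqxx.
have := measurableC mbox; congr measurable; apply/seteqP; split => u /=; rewrite /disc.
  by move/negP => /negPf ->.
by case: ifP => // ->.
Qed.

End Discretise.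

Section DiscreteLaw.
Variables (R : realType) (M0 N0 : nat).
Hypothesis N00 : (0 < N0)%N.
Local Notation mesh := (2 * M0 * N0)%N.
Local Notation F := (option ('I_mesh.+1 * 'I_mesh.+1)).
Context {d : measure_display} {T : measurableType d} (P : probability T R).
Variable x : {RV P >-> R[i]}.

Lemma measurable_RV_preimage {d1 : measure_display} {T1 : measurableType d1}
    (P1 : probability T1 R) (y : {RV P1 >-> R[i]}) (B : set R[i]) :
  measurable B -> measurable (y @^-1` B).
Proof.
by move=> mB; rewrite -[X in measurable X]setTI; apply: measurable_funP.
Qed.

Definition disc_law (c : F) : R := fine (P (x @^-1` (disc M0 N0 @^-1` [set c]))).

Lemma disc_lawE c : (disc_law c)%:E = P (x @^-1` (disc M0 N0 @^-1` [set c])).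
Proof.
rewrite fineK // fin_num_measure //; apply: measurable_RV_preimage.
exact: measurable_disc.
Qed.

Lemma disc_law_ge0 c : 0 <= disc_law c.
Proof. by rewrite fine_ge0. Qed.

Lemma disc_law_sum : \sum_c disc_law c = 1.
Proof.
have h j : measurable ((disc M0 N0 \o x) @^-1` [set j]).
  exact: (measurable_RV_preimage x (measurable_disc N00 j)).
have e := prob_partition P h; apply/eqP; rewrite -eqe -sumEFin -e; apply/eqP.
by apply: eq_bigr => c _; rewrite disc_lawE.
Qed.

Lemma prob_le_disc_law (E : set R[i]) (Q : pred F) : measurable E ->
  (forall u, E u -> Q (disc M0 N0 u)) ->
  (P (x @^-1` E) <= (\sum_(c | Q c) disc_law c)%:E)%E.
Proof.
move=> mE EQ; rewrite -sumEFin; under eq_bigr do rewrite disc_lawE.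
apply: prob_union_bound => [|c _|t Et]; try exact: measurable_RV_preimage.
- by apply: measurable_RV_preimage; apply: measurable_disc.
- by exists (disc M0 N0 (x t)); first exact: EQ.
Qed.

Context {d' : measure_display} {T' : measurableType d'} (P' : probability T' R).
Variables (n : nat) (X : 'I_n -> {RV P' >-> R[i]}).
Hypothesis iidX : iid_copies x X.

Let ReM (y z : R[i]) : complex.Re (y * z) =
  complex.Re y * complex.Re z - complex.Im y * complex.Im z.
Proof. by case: y; case: z. Qed.

Let ImM (y z : R[i]) : complex.Im (y * z) =
  complex.Re y * complex.Im z + complex.Im y * complex.Re z.
Proof. by case: y; case: z. Qed.

Let measurable_walk (v : 'I_n -> R[i]) z r : 0 <= r ->
  measurable [set t | normc (\sum_i v i * X i t - z) <= r].
Proof.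
move=> r0.
have mRe i : measurable_fun [set: T'] (fun t => complex.Re (X i t)).
  apply: (@measurableT_comp _ _ _ _ _ _ _ _ (X i)); first exact: measurable_Re.
  exact: measurable_funP.
have mIm i : measurable_fun [set: T'] (fun t => complex.Im (X i t)).
  apply: (@measurableT_comp _ _ _ _ _ _ _ _ (X i)); first exact: measurable_Im.
  exact: measurable_funP.
pose re t := \sum_i (complex.Re (v i) * complex.Re (X i t) - complex.Im (v i) * complex.Im (X i t))
   - complex.Re z.
pose im t := \sum_i (complex.Re (v i) * complex.Im (X i t) + complex.Im (v i) * complex.Re (X i t))
   - complex.Im z.
have mre : measurable_fun [set: T'] re.
  apply: measurable_funB; last exact: measurable_cst.
  apply: measurable_sum => i; apply: measurable_funB; apply: measurable_funM => //.
have mim : measurable_fun [set: T'] im.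
  apply: measurable_funB; last exact: measurable_cst.
  apply: measurable_sum => i; apply: measurable_funD; apply: measurable_funM => //.
have mq : measurable_fun [set: T'] (fun t => re t ^+ 2 + im t ^+ 2).
  by apply: measurable_funD; apply: measurable_funX.
have := mq measurableT _ (measurable_itv (Interval -oo%O (BRight (r ^+ 2)))).
rewrite setTI; congr measurable; apply/seteqP; split => t /=; rewrite in_itv /= normc_leE //.
all: rewrite ReD ImD ReN ImN (big_morph _ (@ReD R) erefl) (big_morph _ (@ImD R) erefl).
all: by rewrite (eq_bigr _ (fun i _ => ReM (v i) (X i t))) (eq_bigr _ (fun i _ => ImM (v i) (X i t))).
Qed.

(** The event lies in a finite union: either some step leaves the box, or the steps lie in a product
    of cells whose representatives give a walk within [r']. Independence is applied to the products
    of cells. *)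
Lemma walk_prob_le (v : 'I_n -> R[i]) z r r' :
  0 <= r -> r + \sum_i normc (v i) * (2 / N0%:R) <= r' ->
  (P' [set t | (normc (\sum_i v i * X i t - z) <= r)%R] <=
   (n%:R * disc_law None + Ex disc_law (fun phi : {ffun 'I_n -> F} =>
      (normc (- z + \sum_i v i * disc_val R (phi i)) <= r')%R%:R))%:E)%E.
Proof.
move=> r0 rr'; have [indep same] := iidX.
have cellE i c : P' (X i @^-1` (disc M0 N0 @^-1` [set c])) = (disc_law c)%:E.
  by rewrite disc_lawE; apply: (same i); apply: measurable_disc.
pose good (phi : {ffun 'I_n -> F}) := normc (- z + \sum_i v i * disc_val R (phi i)) <= r'.
pose Q (j : 'I_n + {ffun 'I_n -> F}) := if j is inr phi then good phi else true.
pose A (j : 'I_n + {ffun 'I_n -> F}) : set T' := match j with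
  | inl i => X i @^-1` (disc M0 N0 @^-1` [set None])
  | inr phi => \bigcap_(i in [set` [set: 'I_n]%SET]) (X i @^-1` (disc M0 N0 @^-1` [set phi i]))
  end.
have mcell i c : measurable (X i @^-1` (disc M0 N0 @^-1` [set c])).
  by apply: measurable_RV_preimage; apply: measurable_disc.
have mA j : Q j -> measurable (A j).
  case: j => [i|phi] _ /=; first exact: mcell.
  by apply: fin_bigcap_measurable => // i _; apply: mcell.
apply: le_trans (prob_union_bound P' (measurable_walk v z r0) mA _) _.
  move=> t /= ht; case: (boolP [exists i, disc M0 N0 (X i t) == None]) => [/existsP[i /eqP e]|].
    by exists (inl i).
  rewrite negb_exists => /forallP ne.
  exists (inr [ffun i => disc M0 N0 (X i t)]); last first.
    by move=> i _ /=; rewrite ffunE.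
  rewrite /Q /good; apply: le_trans rr'.
  have -> : - z + \sum_i v i * disc_val R ([ffun i => disc M0 N0 (X i t)] i) =
     (\sum_i v i * X i t - z) + \sum_i v i * - (X i t - disc_val R (disc M0 N0 (X i t))).
    rewrite addrAC -big_split /= addrC; congr (_ + _); apply: eq_bigr => i _.
    by rewrite ffunE; ring.
  apply: le_trans (ler_normcD _ _) _; apply: lerD => //.
  apply: le_trans (normc_sum _ _ _) _; apply: ler_sum => i _.
  rewrite normcM normcN; apply: ler_wpM2l; first exact: normc_ge0.
  exact: disc_near.
rewrite big_sumType EFinD /A /Q /=; apply: leeD.
  rewrite (eq_bigr (fun=> (disc_law None)%:E)) => [|i _]; last exact: (cellE i None).
  rewrite sumEFin lee_fin sumr_const card_ord.
  by rewrite mulr_natl.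
rewrite /Ex -sumEFin big_mkcond /=; apply: lee_sum => phi _.
rewrite -/(good phi); case: ifP => _; last by rewrite mulr0.
rewrite mulr1 indep; last by move=> i; apply: measurable_disc.
rewrite (eq_bigr (fun i => (disc_law (phi i))%:E)) => [|i _]; last exact: cellE.
rewrite prodEFin lee_fin le_eqVlt; apply/orP; left; apply/eqP.
by apply: eq_bigl => i; rewrite inE.
Qed.

End DiscreteLaw.

(** * Consequences of the controlled second moment *)

Section Nondegenerate.
Variables (R : realType) (kappa : R).
Context {d : measure_display} {T : measurableType d} (P : probability T R).
Variable x : {RV P >-> R[i]}.
Hypothesis kappa1 : 1 <= kappa.
Hypothesis ctrl : controlled_second_moment kappa x.

Let mRe : measurable_fun [set: T] (fun t => complex.Re (x t)).
Proof.
apply: (@measurableT_comp _ _ _ _ _ _ _ _ x); first exact: measurable_Re.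
exact: measurable_funP.
Qed.

Let mIm : measurable_fun [set: T] (fun t => complex.Im (x t)).
Proof.
apply: (@measurableT_comp _ _ _ _ _ _ _ _ x); first exact: measurable_Im.
exact: measurable_funP.
Qed.

Let msq : measurable_fun [set: R[i]] (fun u : R[i] => complex.Re u ^+ 2 + complex.Im u ^+ 2).
Proof.
by apply: measurable_funD; apply: measurable_funX; [exact: measurable_Re|exact: measurable_Im].
Qed.

Lemma measurable_disk r : 0 <= r -> measurable [set u : R[i] | (normc u <= r)%R].
Proof.
move=> r0; have := msq measurableT (measurable_itv (Interval -oo%O (BRight (r ^+ 2)))).
by rewrite setTI; congr measurable; apply/seteqP; split => t /=; rewrite in_itv /= normc_leE.
Qed.

Definition spread (tau c1 : R) : set R[i] :=
  [set u | (normc u <= kappa)%R /\ (c1 <= `|tau - complex.Re u|)%R].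

Lemma measurable_spread tau c1 : measurable (spread tau c1).
Proof.
apply: measurableI; first by apply: measurable_disk; apply: le_trans kappa1.
have mg : measurable_fun [set: R[i]] (fun u : R[i] => `|tau - complex.Re u|).
  apply: measurableT_comp; first exact: normr_measurable.
  apply: measurable_funB; [exact: measurable_cst|exact: measurable_Re].
have := mg measurableT _ (measurable_itv (Interval (BLeft c1) +oo%O)).
by rewrite setTI; congr measurable; apply/seteqP; split => t /=; rewrite in_itv /= andbT.
Qed.

(** The second moment condition with z = 1 and w = [tau]: where |x| <= kappa, the square is at most
    c1^2 off the spread set and at most (2 kappa + 1)^2 on it. *)
Lemma spread_prob tau c1 : 0 <= c1 -> `|tau| <= kappa + 1 ->
  kappa^-1 - c1 ^+ 2 <= (2 * kappa + 1) ^+ 2 * fine (P (x @^-1` spread tau c1)).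
Proof.
move=> c10 tk; have [_ /(_ 1 (tau%:C)%C)] := ctrl; rewrite unlock /= expr1n mulr1.
set B := x @^-1` spread tau c1.
have mB : measurable B by apply: measurable_RV_preimage; apply: measurable_spread.
have PB : (P B = (fine (P B))%:E)%E by rewrite fineK // fin_num_measure.
move=> h; rewrite lerBlDl -lee_fin; apply: le_trans h _.
have mD : measurable [set s | normc (x s) <= kappa].
  have := measurable_RV_preimage x (measurable_disk (le_trans ler01 kappa1)).
  by [].
apply: (@le_trans _ _ (\int[P]_t (c1 ^+ 2 + (2 * kappa + 1) ^+ 2 * \1_B t)%:E)%E).
  apply: ge0_le_integral => //.
  - by move=> t _; rewrite lee_fin mulr_ge0 // sqr_ge0.
  - apply/measurable_EFinP; apply: measurable_funM; last exact: measurable_indic.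
    apply: measurable_funX.
    have e : (fun t => complex.Re (1 * x t - tau%:C%C)) = (fun t => complex.Re (x t) - tau).
      by apply/funext => t; rewrite mul1r ReD ReN.
    by rewrite e; apply: measurable_funB => //; exact: measurable_cst.
  - apply/measurable_EFinP; apply: measurable_funD; first exact: measurable_cst.
    by apply: measurable_funM; [exact: measurable_cst|exact: measurable_indic].
  move=> t _; rewrite lee_fin mul1r ReD ReN /= !indicE.
  case: (boolP (t \in [set s | normc (x s) <= kappa])) => [|_]; last first.
    by rewrite mulr0 addr_ge0 ?sqr_ge0 // mulr_ge0 // sqr_ge0.
  rewrite inE /= mulr1 => xk.
  have [hc|hc] := leP c1 `|tau - complex.Re (x t)|.
    have -> : t \in B by rewrite inE.
    rewrite mulr1 ler_wpDl ?sqr_ge0 // -real_normK ?num_real // ler_sqr ?nnegrE //.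
      apply: le_trans (ler_normD _ _) _; rewrite normrN.
      by have := le_trans (normc_Re (x t)) xk; lra.
    by rewrite addr_ge0 // mulr_ge0 // (le_trans ler01).
  apply: ler_wpDr; first by rewrite mulr_ge0 // sqr_ge0.
  rewrite -real_normK ?num_real // distrC ler_sqr ?nnegrE //; exact: ltW.
under eq_integral do rewrite EFinD.
rewrite ge0_integralD //=.
- rewrite EFinD; apply: leeD.
    rewrite integral_cst // -[leRHS]mule1 le_eqVlt; apply/orP; left; apply/eqP.
    by congr (_ * _)%E; exact: probability_setT.
  under eq_integral do rewrite EFinM.
  rewrite ge0_integralZl //=.
  + rewrite integral_indic // setIT le_eqVlt; apply/orP; left; apply/eqP.
    by rewrite [RHS]EFinM; congr (_ * _)%E; exact: PB.
  + by apply/measurable_EFinP; exact: measurable_indic.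
  + by rewrite lee_fin sqr_ge0.
- by move=> t _; rewrite lee_fin sqr_ge0.
- by move=> t _; rewrite lee_fin mulr_ge0 // sqr_ge0.
- apply/measurable_EFinP; apply: measurable_funM; [exact: measurable_cst|exact: measurable_indic].
Qed.

Lemma tail_prob (M : R) : 0 < M ->
  fine (P (x @^-1` ~` [set u | (normc u <= M)%R])) <= kappa / M ^+ 2.
Proof.
move=> M0; have [h _] := ctrl; move: h; rewrite unlock => h.
set B := x @^-1` _.
have mB : measurable B.
  by apply: measurable_RV_preimage; apply: measurableC; apply: measurable_disk; apply: ltW.
have PB : (P B = (fine (P B))%:E)%E by rewrite fineK // fin_num_measure.
rewrite ler_pdivlMr ?exprn_gt0 // mulrC -lee_fin; apply: le_trans h.
have -> : ((M ^+ 2 * fine (P B))%:E = \int[P]_t (M ^+ 2 * \1_B t)%:E)%E.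
  under eq_integral do rewrite EFinM.
  rewrite ge0_integralZl //=.
  + by rewrite integral_indic // setIT [LHS]EFinM; congr (_ * _)%E; rewrite -PB.
  + by apply/measurable_EFinP; exact: measurable_indic.
  + by rewrite lee_fin sqr_ge0.
apply: ge0_le_integral => //.
- by move=> t _; rewrite lee_fin mulr_ge0 // sqr_ge0.
- by apply/measurable_EFinP; apply: measurable_funM; [exact: measurable_cst|exact: measurable_indic].
- apply/measurable_EFinP; have e : (fun t => normc (x t) ^+ 2) =
     (fun t => complex.Re (x t) ^+ 2 + complex.Im (x t) ^+ 2).
    by apply/funext => t; rewrite normc_sqr.
  by rewrite e; apply: measurable_funD; apply: measurable_funX.
move=> t _; rewrite lee_fin indicE; case: (boolP (t \in B)) => [|_]; last first.
  by rewrite mulr0 sqr_ge0.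
rewrite inE /B /= => /negP; rewrite -ltNge mulr1 => h1.
by rewrite ler_sqr ?nnegrE ?normc_ge0 ?ltW.
Qed.

End Nondegenerate.

Section Bridge.
Variables (R : realType) (kappa : R).
Hypothesis kappa1 : 1 <= kappa.

(** With c1 = 2 [gap] = 1 / (2 kappa), [spread_prob] has left side at least 1 / (2 kappa), which
    gives [mass]. The other half of c1 pays for the discretisation. *)
Definition gap : R := (4 * kappa)^-1.
Definition mass : R := (2 * kappa * (2 * kappa + 1) ^+ 2)^-1.

Lemma gap_gt0 : 0 < gap.
Proof. by rewrite invr_gt0 mulr_gt0 // (lt_le_trans ltr01). Qed.

Let k0 : 0 < kappa := lt_le_trans ltr01 kappa1.

Lemma mass_gt0 : 0 < mass.
Proof. by rewrite invr_gt0 !mulr_gt0 ?exprn_gt0 // ltr_wpDl // mulr_ge0 // ltW. Qed.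

Lemma mass_le1 : mass <= 1.
Proof.
rewrite invf_le1; last by rewrite -invr_gt0 mass_gt0.
by move: kappa1; nra.
Qed.

(** [F] grows with [n] and 1 / [eta], but the later counts see only kappa + 1, [gap] and [mass]. The
    extra 1 in the bound on the values pays for the discretisation. *)
Lemma bridge {d : measure_display} {T : measurableType d} (P : probability T R)
    (x : {RV P >-> R[i]}) (n : nat) (eta : R) :
  controlled_second_moment kappa x -> 0 < eta ->
  exists (F : finType) (w : F -> R) (f : F -> R[i]) (bd : pred F),
    [/\ forall c, 0 <= w c, \sum_c w c = 1, forall c, bd c -> normc (f c) <= kappa + 1,
      forall t : R, `|t| <= kappa + 1 ->
        mass <= \sum_(c | bd c) w c * (gap <= `|t - complex.Re (f c)|)%R%:R &
      forall (d' : measure_display) (T' : measurableType d') (P' : probability T' R)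
        (X : 'I_n -> {RV P' >-> R[i]}), iid_copies x X ->
      forall (v : 'I_n -> R[i]) z r, (forall i, normc (v i) <= 1) -> 0 <= r ->
      (P' [set t | (normc (\sum_i v i * X i t - z) <= r)%R] <=
        (eta + Ex w (fun phi : {ffun 'I_n -> F} =>
          (normc (- z + \sum_i v i * f (phi i)) <= r + eta)%R%:R))%:E)%E].
Proof.
move=> ctrl eta0.
have frac (y b c : R) : 0 < b -> 0 < c -> y / c <= b -> y / b <= c.
  by move=> b0 c0; rewrite !ler_pdivrMr // mulrC.
(* Makes n kappa / (M0 / 2)^2 at most [eta]. The tail is cut at M0 / 2 because [disc_some] asks for
   a strict inequality. *)
pose B := n%:R * (4 * kappa) / eta + kappa + 1.
have B0 : 0 <= n%:R * (4 * kappa) / eta.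
  by rewrite divr_ge0 ?mulr_ge0 // ltW.
pose M0 := Num.bound B.
have BM : B < M0%:R.
  by have := archi_boundP (x := B); rewrite -/M0; apply; rewrite /B; move: B0 k0; lra.
(* Makes the error 2 / N0 of one step at most [gap] and at most 1, and the error of the walk at most
   [eta]. *)
pose D := 2 / gap + 2 * n%:R / eta + 2.
have D1 : 0 <= 2 / gap by rewrite divr_ge0 // ltW // gap_gt0.
have D2 : 0 <= 2 * n%:R / eta by rewrite divr_ge0 ?mulr_ge0 // ltW.
pose N0 := Num.bound D.
have DN : D < N0%:R.
  by have := archi_boundP (x := D); rewrite -/N0; apply; rewrite /D; lra.
have N00 : (0 < N0)%N by rewrite -(ltr_nat R); apply: le_lt_trans DN; rewrite /D; lra.
have N0R : 0 < N0%:R :> R by rewrite ltr0n.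
have mesh_gap : 2 / N0%:R <= gap.
  by apply: frac => //; [exact: gap_gt0|move: DN; rewrite /D; lra].
have mesh1 : 2 / N0%:R <= 1 :> R by rewrite ler_pdivrMr // mul1r; move: DN; rewrite /D; lra.
have mesh_eta : n%:R * (2 / N0%:R) <= eta.
  rewrite mulrA [n%:R * 2]mulrC; apply: frac => //.
  by move: DN; rewrite /D; lra.
have kM : kappa + 1 < M0%:R by move: BM; rewrite /B; lra.
have M00 : 0 < M0%:R :> R by move: kM k0; lra.
pose w := @disc_law R M0 N0 _ _ P x.
pose f := @disc_val R M0 N0.
have tail : n%:R * w None <= eta.
  have wN : w None <= kappa / (M0%:R / 2) ^+ 2.
    apply: le_trans (tail_prob ctrl _); last by rewrite divr_gt0.
    have mA : measurable (x @^-1` (disc M0 N0 @^-1` [set None])).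
      by apply: measurable_RV_preimage; apply: measurable_disc.
    have mB : measurable (x @^-1` ~` [set u | (normc u <= M0%:R / 2)%R]).
      apply: measurable_RV_preimage; apply: measurableC; apply: measurable_disk.
      by rewrite divr_ge0.
    rewrite /w /disc_law fine_le ?fin_num_measure //.
    apply: le_measure; rewrite ?inE //.
    move=> t /= e xM; move/eqP: e; apply/negP; apply: disc_some.
    by apply: le_lt_trans xM _; move: M00; lra.
  apply: le_trans (ler_wpM2l (ler0n _ _) wN) _.
  have -> : n%:R * (kappa / (M0%:R / 2) ^+ 2) = n%:R * (4 * kappa) / M0%:R ^+ 2.
    by field; rewrite lt0r_neq0.
  apply: frac => //; first by rewrite exprn_gt0.
  have : n%:R * (4 * kappa) / eta <= M0%:R by move: BM; rewrite /B; move: k0; lra.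
  move/le_trans; apply; rewrite expr2 ler_peMr ?ltW //.
  by move: kM k0; lra.
exists (option ('I_(2 * M0 * N0).+1 * 'I_(2 * M0 * N0).+1)), w, f,
  (fun c => normc (f c) <= kappa + 1).
split => //.
- by move=> c; apply: disc_law_ge0.
- exact: disc_law_sum.
- move=> t tk; have g0 := gap_gt0.
  have h2 : (P (x @^-1` spread kappa t (2 * gap)) <=
     (\sum_(c | (normc (f c) <= kappa + 1) && (gap <= `|t - complex.Re (f c)|)) w c)%:E)%E.
    apply: prob_le_disc_law => //; first exact: measurable_spread.
    move=> u [uk ug].
    have uN : disc M0 N0 u != None.
      by apply: disc_some; apply: le_lt_trans uk _; move: kM; lra.
    have un := disc_near N00 uN; rewrite -/f in un.
    apply/andP; split.
      have -> : f (disc M0 N0 u) = u - (u - f (disc M0 N0 u)) by ring.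
      apply: le_trans (ler_normcD _ _) _; rewrite normcN.
      by move: un uk mesh1; lra.
    have := le_trans (normc_Re _) un; rewrite ReD ReN => un'.
    have := ler_normD (t - complex.Re (f (disc M0 N0 u))) (complex.Re (f (disc M0 N0 u)) - complex.Re u).
    rewrite addrA subrK (distrC (complex.Re (f (disc M0 N0 u))) (complex.Re u)).
    by move: un' ug mesh_gap; lra.
  have g20 : 0 <= 2 * gap by rewrite mulr_ge0 // ltW.
  have := spread_prob kappa1 ctrl g20 tk.
  set pr := fine _ => h1.
  have {}h2 : pr <= \sum_(c | normc (f c) <= kappa + 1) w c * (gap <= `|t - complex.Re (f c)|)%R%:R.
    have PB : (P (x @^-1` spread kappa t (2 * gap)) = pr%:E)%E.
      rewrite /pr fineK // fin_num_measure //; apply: measurable_RV_preimage.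
      exact: measurable_spread.
    rewrite PB lee_fin in h2; apply: le_trans h2 _; rewrite big_mkcondr /=.
    by apply: ler_sum => c _; case: ifP; rewrite ?mulr1 ?mulr0.
  apply: le_trans h2; rewrite /mass.
  have K2 : 0 < (2 * kappa + 1) ^+ 2 by rewrite exprn_gt0 //; move: k0; lra.
  rewrite invfM ler_pdivrMr // [leRHS]mulrC; apply: le_trans h1.
  have -> : kappa^-1 - (2 * gap) ^+ 2 = (2 * kappa)^-1 + (2 * kappa)^-1 * (1 - (2 * kappa)^-1).
    by rewrite /gap; field; rewrite lt0r_neq0.
  rewrite lerDl mulr_ge0 ?invr_ge0 ?mulr_ge0 ?ltW // subr_gt0 invf_lt1.
    by move: kappa1; lra.
  by rewrite mulr_gt0.
move=> d' T' P' X iidX v z r v1 r0.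
have rr : r + \sum_i normc (v i) * (2 / N0%:R) <= r + eta.
  rewrite lerD2l; apply: le_trans mesh_eta.
  have -> : n%:R * (2 / N0%:R) = \sum_(i < n) (2 / N0%:R) :> R.
    by rewrite sumr_const card_ord mulr_natl.
  apply: ler_sum => i _; rewrite -[leRHS]mul1r ler_wpM2r // divr_ge0 //.
have hw := @walk_prob_le R M0 N0 N00 d T P x d' T' P' n X iidX v z r (r + eta) r0 rr.
apply: le_trans hw _.
by rewrite lee_fin lerD2r.
Qed.

End Bridge.

(** * The net *)


Section Net.
Variables (R : realType) (kappa : R).
Hypothesis kappa1 : 1 <= kappa.
Let k0 : 0 < kappa := lt_le_trans ltr01 kappa1.
Local Notation kap := (kappa + 1).
Local Notation c0 := (gap kappa).
Local Notation q := (mass kappa).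

Lemma net_exists {d : measure_display} {T : measurableType d} (P : probability T R)
    (x : {RV P >-> R[i]}) {d' : measure_display} {T' : measurableType d'}
    (P' : probability T' R) (n : nat) (X : 'I_n -> {RV P' >-> R[i]})
    (beta p : R) (M h L r m1 : nat) :
  controlled_second_moment kappa x -> iid_copies x X ->
  0 < beta -> 0 < p -> p <= 1 ->
  3 / (2 ^ h)%:R * (4 * kap) <= c0 ->
  (2 ^ h.+2)%:R / beta <= M%:R ->
  (0 < L)%N ->
  (#|label M h| * (2 * r.+1 * L) <= m1)%N ->
  r.+1%:R * (1 - q) ^+ (2 * L) + (2 ^ r.+1)%:R^-1 <= p / 4 / 4 ->
  relation_cost kap c0 q L r * (9 / 2 * (2 * r.+1%:R * (1 - q ^+ 2) ^+ L)) <= p / 4 / 4 ->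
  9 * (1 - q ^+ 2) ^+ L <= p / 4 / 2 ->
  exists S' : {fset 'rV[R[i]]_n},
    (#|` S'|%:R : R) <= (n.+1 ^ m1)%:R * short_count kap c0 ((2 ^ h.+2)%:R + 1) (p / 4) M L m1 +
      (2 * #|label M h|%:R) ^+ n *
      (short_count kap c0 ((2 ^ h.+2)%:R + 1) (p / 4) M L m1 *
       (choice_bound kap c0 ((2 ^ h.+2)%:R + 1) L / long_gain kap c0 q (p / 4) L r) ^+ n) /\
    forall v : 'rV[R[i]]_n, v \in concentrated_vectors X beta p ->
      exists2 v' : 'rV[R[i]]_n, v' \in S' & sup_norm (v - v') <= beta.
Proof.
move=> ctrl iidX beta0 p0 p1 hc0 hM L0 m1L err1 err2 err3.
(* At the scale [gam], the precision [beta] is the error made by [encode]. *)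
set gam : R := (2 ^ h.+2)%:R / beta.
have h0 : 1 <= (2 ^ h)%:R :> R by rewrite ler1n expn_gt0.
have h2E : (2 ^ h.+2)%:R = 4 * (2 ^ h)%:R :> R by rewrite !expnS mulnA natrM.
have gam0 : 0 < gam by rewrite divr_gt0 // ltr0n expn_gt0.
(* p / 4 limits the loss in probability and 1 / [gam] the loss in radius, so that the scaled radius
   gam * (beta + eta) is at most 2^(h + 2) + 1. *)
pose eta := Num.min (p / 4) gam^-1.
have eta0 : 0 < eta by rewrite lt_min divr_gt0 //= invr_gt0.
have eta1 : eta <= p / 4 by rewrite ge_min lexx.
have eta2 : gam * eta <= 1.
  by rewrite mulrC -ler_pdivlMr // div1r ge_min lexx orbT.
have [F [w [f [bd [w0 w1 fbd nd walkP]]]]] := bridge kappa1 n ctrl eta0.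
pose th := \sum_(c | bd c) w c.
have q0 := mass_gt0 kappa1; have q1 := mass_le1 kappa1; have g0 := gap_gt0 kappa1.
(* [th] depends on the law of [x], so the conditions on the parameters are stated with [q]; this
   inequality transfers them. *)
have qth : q <= th.
  apply: le_trans (nd 0 _) _; first by rewrite normr0; move: k0; lra.
  by apply: ler_sum => c _; rewrite -[leRHS]mulr1 ler_wpM2l // lern1 leq_b1.
have th0 : 0 < th by apply: lt_le_trans qth.
have th1 : th <= 1.
  rewrite -w1 /th [leRHS](bigID bd) /= lerDl; exact: sumr_ge0.
pose mu := cond_law w bd; pose g := trunc_val f bd.
have g_bound c : normc (g c) <= kap.
  rewrite /g /trunc_val; case: ifP => [/fbd //|_]; rewrite normc0.
  by move: k0; lra.
have nondeg c' : q <= \sum_c mu c * (c0 <= `|complex.Re (g c' - g c)|)%R%:R.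
  apply: le_trans (nd (complex.Re (g c')) (le_trans (normc_Re _) (g_bound c'))) _.
  rewrite big_mkcond /=; apply: ler_sum => c _; rewrite ReD ReN /mu /cond_law /g /trunc_val.
  case: (boolP (bd c)) => bc; last by rewrite mul0r.
  by rewrite ler_wpM2r // ler_pdivlMr // ler_piMr.
have kap0 : 0 <= kap by move: k0; lra.
have th01 : 0 <= th <= 1 by rewrite th1 ltW.
have rho0 : 0 < (2 ^ h.+2)%:R + 1 :> R by rewrite ltr_wpDr // ltr0n expn_gt0.
have rho_h : (2 ^ h.+2)%:R + 1 <= 5 * (2 ^ h)%:R :> R by rewrite h2E; lra.
have h3 : 3 / (2 ^ h)%:R <= 1 :> R.
  have a0 : 0 <= 3 / (2 ^ h)%:R :> R by rewrite divr_ge0.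
  have g1 : c0 <= 1.
    by rewrite /gap invf_le1 ?mulr_gt0 //; move: kappa1; lra.
  by move: hc0 g1 a0 kappa1; nra.
have p40 : 0 < p / 4 by rewrite divr_gt0.
have p41 : p / 4 <= 1 by move: p1; lra.
have qth2 : q ^+ 2 <= th * q by rewrite expr2 ler_wpM2r // ltW.
have thq1 : th * q <= 1 by rewrite -[leRHS]mul1r ler_pM // ltW.
have pw1 m : (1 - th) ^+ m <= (1 - q) ^+ m.
  by rewrite lerXn2r ?nnegrE ?subr_ge0 // lerB.
have pw2 m : (1 - th * q) ^+ m <= (1 - q ^+ 2) ^+ m.
  rewrite lerXn2r ?nnegrE ?subr_ge0 ?lerB //; exact: le_trans thq1.
have [||| V [cV hV]] := @admissible_cover R n F mu g kap c0 q th ((2 ^ h.+2)%:R + 1) (p / 4)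
  M h L r m1 (cond_law_ge0 w0 th0) (cond_law_sum th0) g_bound g0 q0 q1 kap0 nondeg th01 rho0
  rho_h h3 hc0 L0 m1L p40 p41.
- by apply: le_trans err1; rewrite lerD2r ler_wpM2l.
- apply: le_trans err2; apply: ler_wpM2l; last by rewrite !ler_wpM2l // mulr_ge0.
  exact: ltW (relation_cost_gt0 L r g0 q0 kap0).
- by apply: le_trans err3; rewrite ler_wpM2l.
pose dec (e : {ffun 'I_n -> 'I_M.*2.+1 * 'I_M.*2.+1}) : 'rV[R[i]]_n :=
  \row_i (gp R (e i) / gam%:C%C).
exists [fset dec e | e in V]%fset; split.
  apply: le_trans cV; rewrite ler_nat.
  by apply: leq_trans (leq_imfset_card _ _ _) _; rewrite /= -cardE.
move=> v; rewrite inE => -[vn vp].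
have normc_gam : normc (gam%:C%C) = gam by rewrite /= expr0n addr0 sqrtr_sqr gtr0_norm.
have gamC : gam%:C%C != 0 :> R[i].
  by apply/eqP => e; move: gam0; rewrite -normc_gam e normc0 ltxx.
have v1 i : normc (v 0 i) <= 1.
  rewrite -vn /euclidean_norm -[leLHS]ger0_norm ?normc_ge0 // -sqrtr_sqr ler_wsqrtr //.
  rewrite (bigD1 i) //= lerDl sumr_ge0 // => j _; exact: sqr_ge0.
pose a i := gam%:C%C * v 0 i.
have adm : admissible mu g th ((2 ^ h.+2)%:R + 1) (p / 4) M a.
  split=> [i|B hB].
    rewrite /a normcM normc_gam -[leRHS]mulr1 ler_pM ?normc_ge0 ?(ltW gam0) //.
  (* Passing to p / 2 makes the inequality strict and yields an actual centre [z]; the loss [eta]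
     then leaves p / 4. *)
  have : ((p / 2)%:E < small_ball beta X v)%E.
    by apply: lt_le_trans vp; rewrite lte_fin; move: p0; lra.
  move=> /ereal_sup_gt[_ [z _ <-]].
  have := walkP _ _ _ X iidX (fun i => v 0 i) z beta v1 (ltW beta0).
  rewrite /random_walk /closed_disk => hz1 hz2.
  have {hz1 hz2} := lt_le_trans hz2 hz1; rewrite lte_fin => hz.
  apply: le_trans (truncate w0 w1 th0 (- (gam%:C%C * z)) hB).
  apply: (@le_trans _ _ (Ex w (fun phi : {ffun 'I_n -> F} =>
      (normc (- z + \sum_i v 0 i * f (phi i)) <= beta + eta)%R%:R))).
    by move: hz eta1; lra.
  apply: Ex_le => // phi; case: (boolP (_ <= beta + eta)) => // hphi.
  have -> : - (gam%:C%C * z) + \sum_i a i * f (phi i) =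
      gam%:C%C * (- z + \sum_i v 0 i * f (phi i)).
    rewrite mulrDr mulrN mulr_sumr; congr (_ + _); apply: eq_bigr => i _.
    by rewrite mulrA.
  have -> // : normc (gam%:C%C * (- z + \sum_i v 0 i * f (phi i))) <= (2 ^ h.+2)%:R + 1.
  rewrite normcM normc_gam; apply: le_trans (ler_wpM2l (ltW gam0) hphi) _.
  by rewrite mulrDr lerD // /gam divfK // lt0r_neq0.
have [e eV he] := hV a adm.
exists (dec e); first by apply/imfsetP; exists e.
rewrite /sup_norm; apply: bigmax_le => [|i _]; first exact: ltW.
rewrite !mxE; have -> : v 0 i - gp R (e i) / gam%:C%C = (a i - gp R (e i)) / gam%:C%C.
  by rewrite mulrBl /a mulrAC divff // mul1r.
rewrite normcM normcV normc_gam ler_pdivrMr //; apply: le_trans (he i) _.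
by rewrite /gam mulrC divfK // lt0r_neq0.
Qed.

End Net.

(** * Choice of the parameters *)

Section Growth.
Variable R : realType.

Lemma ln_le_self (x : R) : 0 < x -> ln x <= x.
Proof.
move=> x0; rewrite -ler_expR lnK //; apply: le_trans (expR_ge1Dx x).
by rewrite lerDr.
Qed.

(** With b = a / 2, ln n <= n^b / b, and the constant is absorbed by a second factor n^b. *)
Lemma log_growth (a C : R) : 0 < a -> 0 <= C ->
  exists N : nat, forall n : nat, (N <= n)%N ->
    (0 < n)%N /\ C * (1 + ln n%:R) <= n%:R `^ a.
Proof.
move=> a0 C0; pose b := a / 2; have b0 : 0 < b by rewrite divr_gt0.
pose D := C * (1 + b^-1).
have D0 : 0 <= D by rewrite mulr_ge0 // addr_ge0 // invr_ge0 ltW.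
exists (Num.bound (D `^ b^-1)).+1 => n hn.
have n0 : (0 < n)%N by apply: leq_trans hn.
split=> //; set u : R := n%:R.
have u1 : 1 <= u by rewrite ler1n.
have u0 : 0 < u by apply: lt_le_trans u1.
have ub1 : 1 <= u `^ b.
  have <- : (1 : R) `^ b = 1 by rewrite powR1.
  by apply: ge0_ler_powR; rewrite ?nnegrE // ltW.
have Du : D <= u `^ b.
  rewrite -[leLHS](powRr1 D0) -(mulVf (lt0r_neq0 b0)) powRrM.
  apply: ge0_ler_powR; rewrite ?nnegrE ?powR_ge0 ?(ltW b0) ?(ltW u0) //.
  apply: le_trans (ltW (archi_boundP (powR_ge0 _ _))) _.
  by rewrite ler_nat ltnW.
have lu : ln u <= b^-1 * u `^ b.
  rewrite ler_pdivlMl // -ln_powR; apply: ln_le_self; exact: powR_gt0.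
apply: (@le_trans _ _ (D * u `^ b)).
  rewrite /D -mulrA ler_wpM2l // mulrDl mul1r lerD //.
have -> : u `^ a = u `^ b * u `^ b.
  rewrite -powRD; last by rewrite (gt_eqF u0) implybT.
  by rewrite /b -splitr.
by rewrite ler_wpM2r // powR_ge0.
Qed.

Lemma expR1_le4 : expR 1 <= 4 :> R.
Proof.
have h : expR (2^-1) <= 2 :> R.
  have h1 := expR_ge1Dx (- 2^-1 : R).
  rewrite -[leLHS]invrK -expRN invf_ple ?posrE ?expR_gt0 //.
  by apply: le_trans h1; lra.
have -> : 1 = 2^-1 + 2^-1 :> R by lra.
rewrite expRD; have := expR_gt0 (2^-1 : R) => h0.
by nra.
Qed.

Lemma half_pow_le (m : nat) : (2 ^ m)%:R^-1 <= expR (- (m%:R / 2)) :> R.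
Proof.
have -> : - (m%:R / 2) = - 2^-1 * m%:R :> R by lra.
rewrite natrX -exprVn expRM_natr lerXn2r ?nnegrE ?expR_ge0 ?invr_ge0 //.
by apply: le_trans (expR_ge1Dx _); lra.
Qed.

Lemma one_minus_pow_le (t : R) (m : nat) : 0 <= t -> t <= 1 ->
  (1 - t) ^+ m <= expR (- (t * m%:R)).
Proof.
move=> t0 t1; rewrite -mulNr expRM_natr lerXn2r ?nnegrE ?expR_ge0 ?subr_ge0 //.
by apply: le_trans (expR_ge1Dx _).
Qed.

Lemma trunc_log_le (m : nat) : (0 < m)%N -> (trunc_log 2 m)%:R <= 2 * ln (m%:R : R).
Proof.
move=> m0; have /andP[h _] := trunc_log_bounds (isT : (1 < 2)%N) m0.
set t := trunc_log 2 m in h *.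
have m0R : 0 < m%:R :> R by rewrite ltr0n.
have : expR (t%:R / 2) <= m%:R :> R.
  apply: (@le_trans _ _ (2 ^ t)%:R); last by rewrite ler_nat.
  rewrite -lef_pV2 ?posrE ?expR_gt0 ?ltr0n ?expn_gt0 // -expRN; exact: half_pow_le.
by rewrite -{1}[m%:R]lnK ?posrE // ler_expR; lra.
Qed.

End Growth.

(** * Parameters as powers of Y = n^(eps / 100) *)

Section Asymptotics.
Variables (R : realType) (kap c0 q A : R) (h : nat).
Definition side : R := (2 ^ h)%:R.
Local Notation H := side.

Definition label_const : R := (10 * H + 3) * (4 * H + 1) ^+ 2.
Definition cost_const : R := 8 / q * ((10 + 8 * kap) * 2 / c0 + 1).
Definition choice_const : R := 2 * (10 * H + 2 * kap) / c0 + 1.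
(** [A] comes from p >= n^(-A), 3 from the factor u^3 in [error_le], and the last summand dominates
    its own logarithm. *)
Definition error_const : R := A + 3 + (72 + 576 * cost_const).
Definition short_const : R := 128 * H + 2 * (576 * choice_const ^+ 2 + 1 + A) + 2.
Definition long_const : R :=
  8 * 16 * 72 * 8 * label_const ^+ 2 * choice_const ^+ 2 * cost_const.
(** The summands serve, in order: a positive number of blocks, decay in the half-block length, decay
    of 2^-[block_count], the exponent of the short count, and the constant of the long count. *)
Definition growth_const : R :=
  4 * label_const + error_const / q ^+ 2 + 16 * label_const * error_const +
  short_const + long_const.

Hypotheses (kap1 : 1 <= kap) (c00 : 0 < c0) (q0 : 0 < q) (q1 : q <= 1) (A0 : 0 < A).
Local Notation CK := label_const.
Local Notation Cc := cost_const.
Local Notation C2 := choice_const.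
Local Notation C1 := error_const.
Local Notation C4 := short_const.
Local Notation C5 := long_const.

Let H1 : 1 <= H.
Proof. by rewrite ler1n expn_gt0. Qed.

Let H0 : 0 < H.
Proof. exact: lt_le_trans H1. Qed.

Let CK1 : 1 <= CK.
Proof.
have h1 := H1; rewrite /label_const mulr_ege1 //; first by lra.
by rewrite exprn_ege1 //; lra.
Qed.

Let CK0 : 0 < CK.
Proof. exact: lt_le_trans CK1. Qed.

Let Cc1 : 1 <= Cc.
Proof.
have a1 : 1 <= 8 / q by rewrite ler_pdivlMr //; move: q1; lra.
have a2 : 0 <= (10 + 8 * kap) * 2 / c0.
  by rewrite divr_ge0 ?(ltW c00) //; move: kap1; lra.
by rewrite /cost_const mulr_ege1 // lerDr.
Qed.

Let C21 : 1 <= C2.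
Proof.
rewrite /choice_const lerDr divr_ge0 ?(ltW c00) //.
by move: kap1 H0; lra.
Qed.

Let C11 : 1 <= C1.
Proof. by rewrite /error_const; move: A0 Cc1; lra. Qed.

Let C22 : 1 <= C2 ^+ 2.
Proof. by rewrite exprn_ege1. Qed.

Lemma short_const_ge1 : 1 <= C4.
Proof. by rewrite /short_const; move: H0 C22 A0; lra. Qed.

Let C41 := short_const_ge1.

Let C51 : 1 <= C5.
Proof.
have CK2 : 1 <= CK ^+ 2 by rewrite exprn_ege1.
rewrite /long_const; move: (CK ^+ 2) CK2 (C2 ^+ 2) C22 Cc Cc1 => a a1 b b1 c c1.
by do ![apply: mulr_ege1 => //]; rewrite ler1n.
Qed.

Let C1q : 0 <= C1 / q ^+ 2.
Proof. by rewrite divr_ge0 ?sqr_ge0 //; move: C11; lra. Qed.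

Let KC : 1 <= CK * C1.
Proof. by rewrite mulr_ege1. Qed.

Lemma relation_cost_le (r m : nat) : (0 < m)%N ->
  relation_cost kap c0 q m r <= (Num.sqrt r.+1%:R)^-1 * r.+1%:R^-1 * (Cc * m%:R).
Proof.
move=> m0; rewrite /relation_cost; apply: ler_wpM2l.
  by rewrite mulr_ge0 ?invr_ge0 ?sqrtr_ge0.
have m1 : 1 <= m%:R :> R by rewrite ler1n.
have -> : 4 / (q / 2) = 8 / q by field; rewrite gt_eqF.
rewrite /cost_const -[leRHS]mulrA; apply: ler_wpM2l; first by rewrite divr_ge0 ?(ltW q0).
rewrite [leRHS]mulrDl mul1r; apply: lerD => //.
have -> : (2 * 5 + 8 * m%:R * kap) / (c0 / 2) = (10 + 8 * m%:R * kap) * 2 / c0.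
  by field; rewrite gt_eqF.
rewrite [leRHS]mulrAC; apply: ler_wpM2r; first by rewrite invr_ge0 ltW.
by move: m1 kap1; lra.
Qed.

Lemma growth_const_ge0 : 0 <= growth_const.
Proof. rewrite /growth_const -[16 * _ * _]mulrA; move: (C1 / _) C1q (CK * C1) KC => a a0 b b0.
move: CK1 C41 C51. lra. Qed.

Lemma growth_const_ge : [/\ 4 * CK <= growth_const, C1 / q ^+ 2 <= growth_const,
  16 * CK * C1 <= growth_const, C4 <= growth_const & C5 <= growth_const].
Proof.
rewrite /growth_const -[16 * _ * _]mulrA; move: (C1 / _) C1q (CK * C1) KC => a ? b ?.
by move: CK1 C41 C51; split; lra.
Qed.

Variables (n : nat) (Y p beta : R).
(* The parameters below are small powers of [Y], which will be [n^(eps / 100)]. *)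
Local Notation u := (n%:R : R).
Local Notation l := (ln u).
Hypotheses (n0 : (0 < n)%N) (Y1 : 1 <= Y) (Yu : Y ^+ 100 <= u).
Hypothesis budget : growth_const * (1 + l) <= Y.
Hypotheses (pA : expR (- (A * l)) <= p) (p1 : p <= 1) (bY : expR (- Y ^+ 50) <= beta).

(** Up to constants, the half-block length is Y, the logarithm of the radius Y^50, the threshold u /
    Y. With at most about Y^50 labels, the number of blocks is at least of order u / Y^52. *)
Definition half_block : nat := (Num.truncn Y).+1.
Definition radius : nat := (Num.truncn (4 * H * expR (Y ^+ 50))).+1.
Definition threshold : nat := (Num.truncn (u / Y)).+1.
Definition block_count : nat := (threshold %/ (2 * #|label radius h| * half_block))%N.
Local Notation L := half_block.
Local Notation M := radius.
Local Notation m1 := threshold.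
Local Notation K := #|label radius h|.

Let u1 : 1 <= u. Proof. by rewrite ler1n. Qed.
Let u0 : 0 < u. Proof. by rewrite ltr0n. Qed.
Let Y0 : 0 < Y. Proof. exact: lt_le_trans Y1. Qed.
Let l0 : 0 <= l. Proof. exact: ln_ge0. Qed.
Let p0 : 0 < p. Proof. exact: lt_le_trans (expR_gt0 _) pA. Qed.

Let budget_le c : c <= growth_const -> c * (1 + l) <= Y.
Proof. by move=> hc; apply: le_trans budget; rewrite ler_wpM2r //; move: l0; lra. Qed.

Let Y_pow k : (k <= 100)%N -> Y ^+ k <= u.
Proof. by move=> hk; apply: le_trans Yu; exact: ler_weXn2l. Qed.

Let ceilN (x : R) : 1 <= x -> x <= (Num.truncn x).+1%:R <= 2 * x.
Proof.
move=> x1; have /andP[a b] := truncn_itv (le_trans ler01 x1).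
by rewrite (ltW b) /= -[X in X%:R]addn1 natrD; lra.
Qed.

Lemma half_block_itv : Y <= L%:R <= 2 * Y.
Proof. exact: ceilN. Qed.

Let uY1 : 1 <= u / Y.
Proof. by rewrite ler_pdivlMr // mul1r; exact: (Y_pow (k := 1)). Qed.

Lemma threshold_itv : u / Y <= m1%:R <= 2 * (u / Y).
Proof. exact: ceilN. Qed.

Lemma radius_itv : 4 * H * expR (Y ^+ 50) <= M%:R <= 5 * H * expR (Y ^+ 50).
Proof.
have e1 : 1 <= H * expR (Y ^+ 50).
  by rewrite mulr_ege1 // -expR0 ler_expR exprn_ge0 // ltW.
have /andP[a b] := truncn_itv (x := 4 * H * expR (Y ^+ 50)) ltac:(lra).
rewrite /radius (ltW b) /= -[X in X%:R]addn1 natrD.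
by lra.
Qed.

Lemma radius_beta : (2 ^ h.+2)%:R / beta <= M%:R.
Proof.
have /andP[a _] := radius_itv; apply: le_trans a.
have b0 : 0 < beta by apply: lt_le_trans bY; exact: expR_gt0.
rewrite !expnS mulnA natrM ler_wpM2l ?mulr_ge0 //.
by rewrite -[leRHS]invrK -expRN lef_pV2 ?posrE ?expR_gt0.
Qed.

Lemma card_label_le : K%:R <= CK * Y ^+ 50.
Proof.
rewrite /label !card_prod !card_ord !natrM -!expr2.
have /andP[_ b] := radius_itv.
have Y50 : 1 <= Y ^+ 50 by exact: exprn_ege1.
have tl : (trunc_log 2 M)%:R <= 2 * (5 * H + Y ^+ 50).
  apply: le_trans (trunc_log_le R (isT : (0 < M)%N)) _.
  have M0 : 0 < M%:R :> R by rewrite ltr0n.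
  rewrite ler_wpM2l //.
  have : ln (M%:R : R) <= ln (5 * H * expR (Y ^+ 50)).
    by rewrite ler_ln ?posrE // (lt_le_trans M0 b).
  move/le_trans; apply.
  rewrite lnM ?posrE ?expR_gt0 ?mulr_gt0 ?H0 // expRK lerD2r.
  by apply: ln_le_self; rewrite mulr_gt0.
have -> : (2 ^ h.+2).+1%:R = 4 * H + 1 :> R.
  by rewrite -addn1 natrD !expnS mulnA natrM.
have t1 : (trunc_log 2 M).+1%:R <= (10 * H + 3) * Y ^+ 50.
  rewrite -addn1 natrD.
  have : 10 * H + 1 <= (10 * H + 1) * Y ^+ 50 by rewrite ler_peMr //; move: H0; lra.
  by move: tl; lra.
by rewrite /label_const mulrAC ler_wpM2r // sqr_ge0.
Qed.

Let K0 : (0 < K)%N.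
Proof. by rewrite /label !card_prod !card_ord. Qed.

Let Y_const c : 0 <= c -> c <= growth_const -> c <= Y.
Proof.
move=> c0' hc; apply: le_trans (budget_le hc).
by rewrite ler_peMr // lerDl.
Qed.

Let CK_Y : 4 * CK <= Y.
Proof. by apply: Y_const; [move: CK1; lra | case: growth_const_ge]. Qed.

Let cost_le : (2 * K * L)%:R <= 4 * CK * Y ^+ 51.
Proof.
have /andP[_ hL] := half_block_itv.
have := ler_pM (ler0n _ _) (ler0n _ _) card_label_le hL.
by rewrite exprS natrM natrM; lra.
Qed.

Lemma block_count_gt0 : (0 < block_count)%N.
Proof.
rewrite divn_gt0; last by rewrite !muln_gt0 K0.
rewrite -(ler_nat R); apply: le_trans cost_le _.
have /andP[hm _] := threshold_itv; apply: le_trans hm.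
rewrite ler_pdivlMr //; apply: le_trans (Y_pow (k := 53) isT).
by rewrite -[_ * _ * Y]mulrA -exprSr [Y ^+ 53]exprS ler_wpM2r // exprn_ge0 // ltW.
Qed.

Lemma block_count_itv : u / (8 * CK * Y ^+ 52) <= block_count%:R <= u.
Proof.
have /andP[hm hm2] := threshold_itv; apply/andP; split; last first.
  apply: le_trans (_ : m1%:R <= _); first by rewrite ler_nat leq_div.
  apply: le_trans hm2 _; rewrite mulrCA ler_piMr ?(ltW u0) //.
  by rewrite ler_pdivrMr // mul1r; move: CK_Y CK1; lra.
have b1 : 1 <= block_count%:R :> R by rewrite ler1n block_count_gt0.
have k0 : (0 < 2 * K * L)%N.
  by rewrite !muln_gt0 K0.
have : u / Y <= (block_count%:R + 1) * (4 * CK * Y ^+ 51).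
  apply: le_trans hm _.
  apply: (@le_trans _ _ ((block_count.+1 * (2 * K * L))%:R)).
    by rewrite ler_nat ltnW // ltn_ceil.
  by rewrite natrM -addn1 natrD ler_wpM2l.
rewrite ler_pdivrMr // => hu.
have Y51 : 0 < Y ^+ 51 by rewrite exprn_gt0.
rewrite ler_pdivrMr; last by rewrite pmulr_rgt0 ?exprn_gt0 // pmulr_rgt0.
apply: le_trans hu _; rewrite [Y ^+ 52]exprSr.
have t0 : 0 <= CK * Y ^+ 51 * Y by apply: mulr_ge0 (ltW Y0); apply: mulr_ge0; apply: ltW.
move: (block_count%:R : R) b1 => b b1.
have -> : (b + 1) * (4 * CK * Y ^+ 51) * Y = (b + 1) * 4 * (CK * Y ^+ 51 * Y) by ring.
have -> : b * (8 * CK * (Y ^+ 51 * Y)) = b * 8 * (CK * Y ^+ 51 * Y) by ring.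
by rewrite ler_wpM2r //; lra.
Qed.

Lemma block_budget : (K * (2 * block_count.-1.+1 * L) <= m1)%N.
Proof.
rewrite prednK ?block_count_gt0 //.
have -> : (K * (2 * block_count * L) = block_count * (2 * K * L))%N by ring.
exact: leq_trunc_div.
Qed.

Let D1 : 1 <= 72 + 576 * Cc.
Proof. by move: Cc1; lra. Qed.

Let D72 : 72 <= 72 + 576 * Cc.
Proof. by move: Cc1; lra. Qed.

Let error_le t : C1 * (1 + l) <= t -> expR (- t) <= p / ((72 + 576 * Cc) * u ^+ 3).
Proof.
move=> ht; have D0 : 0 < 72 + 576 * Cc by apply: lt_le_trans D1.
have u3 : 0 < u ^+ 3 by rewrite exprn_gt0.
rewrite ler_pdivlMr ?mulr_gt0 //; apply: le_trans pA.
have -> : u ^+ 3 = expR (l * 3%:R) by rewrite expRM_natr lnK.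
have hD : 72 + 576 * Cc <= expR (72 + 576 * Cc).
  by apply: le_trans (expR_ge1Dx _); rewrite lerDr.
apply: (@le_trans _ _ (expR (- t) * (expR (72 + 576 * Cc) * expR (l * 3%:R)))).
  by rewrite ler_wpM2l ?expR_ge0 // ler_wpM2r ?expR_ge0.
rewrite -!expRD ler_expR; move: ht; rewrite /error_const; move: l0 A0 D0.
by move: (576 * Cc) => D; nra.
Qed.

Let mass_decay t : q ^+ 2 * Y <= t -> expR (- t) <= p / ((72 + 576 * Cc) * u ^+ 3).
Proof.
move=> ht; apply: error_le; apply: le_trans ht.
have q20 : 0 < q ^+ 2 by rewrite exprn_gt0.
rewrite [leRHS]mulrC -ler_pdivrMr // [leLHS]mulrAC.
by apply: budget_le; case: growth_const_ge.
Qed.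

Let L_ge1 : 1 <= L%:R :> R.
Proof. by rewrite ler1n. Qed.

Let q2q : q ^+ 2 <= q.
Proof. by rewrite expr2 ler_piMr // ltW. Qed.

Let decay1 : (1 - q) ^+ (2 * L) <= p / ((72 + 576 * Cc) * u ^+ 3).
Proof.
apply: le_trans (one_minus_pow_le _ (ltW q0) q1) _; apply: mass_decay.
have /andP[hL _] := half_block_itv; rewrite natrM.
apply: ler_pM => //; [exact: sqr_ge0 | exact: ltW|].
by apply: le_trans hL _; rewrite ler_peMl ?ler1n.
Qed.

Let decay2 : (1 - q ^+ 2) ^+ L <= p / ((72 + 576 * Cc) * u ^+ 3).
Proof.
apply: le_trans (one_minus_pow_le _ (sqr_ge0 _) (le_trans q2q q1)) _.
by apply: mass_decay; rewrite ler_wpM2l ?sqr_ge0 //; case/andP: half_block_itv.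
Qed.

Let decay3 : (2 ^ block_count)%:R^-1 <= p / ((72 + 576 * Cc) * u ^+ 3).
Proof.
apply: le_trans (half_pow_le R _) _; apply: error_le.
have h16 : 16 * CK * C1 * (1 + l) <= Y by apply: budget_le; case: growth_const_ge.
have /andP[hR _] := block_count_itv.
rewrite ler_pdivlMr //; apply: le_trans hR.
rewrite ler_pdivlMr; last by rewrite pmulr_rgt0 ?exprn_gt0 // pmulr_rgt0.
apply: le_trans (Y_pow (k := 53) isT); rewrite [Y ^+ 53]exprS.
rewrite mulrA ler_wpM2r ?exprn_ge0 ?(ltW Y0) //.
by apply: le_trans h16; rewrite le_eqVlt; apply/orP; left; apply/eqP; ring.
Qed.

Lemma error1 :
  block_count%:R * (1 - q) ^+ (2 * L) + (2 ^ block_count)%:R^-1 <= p / 4 / 4.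
Proof.
have /andP[_ hR] := block_count_itv.
apply: (@le_trans _ _ ((u + 1) * (p / ((72 + 576 * Cc) * u ^+ 3)))).
  rewrite mulrDl mul1r lerD ?decay3 // ler_pM ?decay1 //.
  by rewrite exprn_ge0 // subr_ge0.
have D0 : 0 < 72 + 576 * Cc by apply: lt_le_trans D1.
have u3 : u <= u ^+ 3 by rewrite exprSr ler_peMl // ?(ltW u0) // exprn_ege1.
rewrite mulrA ler_pdivrMr; last by rewrite mulr_gt0 // exprn_gt0.
have t : 72 * u <= (72 + 576 * Cc) * u ^+ 3.
  exact: ler_pM (ler0n _ 72) (ltW u0) D72 u3.
apply: le_trans (ler_wpM2l _ t); last by rewrite !divr_ge0 // ltW.
have -> : p / 4 / 4 * (72 * u) = (72 / 16 * u) * p by field.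
by apply: ler_wpM2r; [exact: ltW | move: u1; lra].
Qed.

Lemma error3 : 9 * (1 - q ^+ 2) ^+ L <= p / 4 / 2.
Proof.
apply: le_trans (ler_wpM2l _ decay2) _ => //.
have D0 : 0 < 72 + 576 * Cc by apply: lt_le_trans D1.
have u3 : 1 <= u ^+ 3 by rewrite exprn_ege1.
rewrite mulrA ler_pdivrMr; last by rewrite mulr_gt0 // exprn_gt0.
have t : 72 * 1 <= (72 + 576 * Cc) * u ^+ 3.
  exact: ler_pM (ler0n _ 72) ler01 D72 u3.
apply: le_trans (ler_wpM2l _ t); last by rewrite !divr_ge0 // ltW.
by lra.
Qed.

Let cost_bound : relation_cost kap c0 q L block_count.-1 <=
  (Num.sqrt block_count%:R)^-1 * block_count%:R^-1 * (Cc * L%:R).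
Proof.
have := relation_cost_le block_count.-1 (isT : (0 < L)%N).
by rewrite prednK // block_count_gt0.
Qed.

(** Crude bounds suffice: the cost is at most 2 [cost_const] u and the number of blocks at most u,
    against the u^3 in [decay2]. *)
Lemma error2 : relation_cost kap c0 q L block_count.-1 *
  (9 / 2 * (2 * block_count%:R * (1 - q ^+ 2) ^+ L)) <= p / 4 / 4.
Proof.
have hL : L%:R <= 2 * u.
  have /andP[_ hL] := half_block_itv; apply: le_trans hL _.
  by rewrite ler_wpM2l //; exact: (Y_pow (k := 1)).
have C0 : 0 <= Cc by apply: le_trans Cc1.
move: block_count block_count_gt0 block_count_itv cost_bound => b b0 /andP[_ hR] hb.
have R1 : 1 <= b%:R :> R by rewrite ler1n.
have hc : relation_cost kap c0 q L b.-1 <= Cc * (2 * u).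
  apply: le_trans hb _.
  apply: (@le_trans _ _ (Cc * L%:R)); last by apply: ler_wpM2l.
  apply: ler_piMl; first by apply: mulr_ge0.
  apply: mulr_ile1; rewrite ?invr_ge0 ?sqrtr_ge0 //.
    rewrite invf_le1 ?sqrtr_gt0 ?ltr0n //.
    by rewrite -[leLHS]sqrtr1 ler_wsqrtr.
  by rewrite invf_le1 // ltr0n.
have D0 : 0 < 72 + 576 * Cc by apply: lt_le_trans D1.
have u3 : 0 < u ^+ 3 by rewrite exprn_gt0.
have d0 : 0 <= (1 - q ^+ 2) ^+ L by rewrite exprn_ge0 // subr_ge0 (le_trans q2q).
move: ((1 - q ^+ 2) ^+ L) decay2 d0 => z hz z0.
set W := p / ((72 + 576 * Cc) * u ^+ 3) in hz.
have W0 : 0 <= W by apply: le_trans hz.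
apply: (@le_trans _ _ (Cc * (2 * u) * (9 / 2 * (2 * u * W)))).
  apply: ler_pM => //.
  - by apply: ltW; apply: relation_cost_gt0 => //; rewrite (le_trans ler01 kap1).
  - by rewrite !mulr_ge0.
  apply: ler_wpM2l => //; apply: ler_pM => //.
  by apply: ler_wpM2l.
have -> : Cc * (2 * u) * (9 / 2 * (2 * u * W)) = (Cc * 18 * u ^+ 2) * W by field.
rewrite /W mulrA ler_pdivrMr; last by rewrite mulr_gt0.
move: Cc C0 D0 => c hc0 D0.
have t : 288 * c * u ^+ 2 <= (72 + 576 * c) * u ^+ 3.
  have -> : (72 + 576 * c) * u ^+ 3 = (72 + 576 * c) * u * u ^+ 2 by ring.
  apply: ler_wpM2r; first by rewrite exprn_ge0.
  have h1 : 288 * c <= 72 + 576 * c by move: hc0; lra.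
  by rewrite -[leLHS]mulr1; exact: ler_pM (mulr_ge0 (ler0n _ 288) hc0) ler01 h1 u1.
apply: le_trans (ler_wpM2l _ t); last by rewrite !divr_ge0 // ltW.
by rewrite le_eqVlt; apply/orP; left; apply/eqP; field.
Qed.


Local Notation rho := (4 * H + 1).
Local Notation Cn := (choice_bound kap c0 rho L).

Let choice_le : Cn <= (C2 * L%:R) ^+ 2.
Proof.
have L1 := L_ge1; rewrite /choice_bound; move: (L%:R) L1 => v v1.
have c0i : 0 <= c0^-1 by rewrite invr_ge0 ltW.
have a1 : 0 <= 2 * (4 * H + 1) + v * (2 * kap).
  by apply: addr_ge0; [move: H0; lra | apply: mulr_ge0; move: v1 kap1; lra].
rewrite lerXn2r ?nnegrE.
- by [].
- by apply: addr_ge0 => //; apply: mulr_ge0 => //; exact: mulr_ge0.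
- by apply: mulr_ge0; [exact: le_trans C21 | exact: le_trans v1].
rewrite /choice_const [leRHS]mulrDl mul1r; apply: lerD => //.
rewrite mulrA [leRHS]mulrAC; apply: ler_wpM2r => //.
by move: H1 v1 kap1; nra.
Qed.

Let ln_budget : C4 * (1 + l) <= Y.
Proof. by apply: budget_le; case: growth_const_ge. Qed.

(** About u / Y removals, each costing a fixed power of n; this is o(u) since Y is a positive power
    of u. *)
Definition small_exponent : R := C4 * u * (1 + l) / Y.

Let card_grid : (#|{: 'I_M.*2.+1 * 'I_M.*2.+1}|%:R : R) <= expR (32 * H * Y ^+ 50).
Proof.
have /andP[_ hM] := radius_itv; have Y50 : 1 <= Y ^+ 50 by exact: exprn_ege1.
have M1 : 1 <= M%:R :> R by rewrite ler1n.
have side_le : M.*2.+1%:R <= expR (15 * H + Y ^+ 50).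
  rewrite expRD -addn1 -muln2 natrD natrM.
  apply: (@le_trans _ _ (15 * H * expR (Y ^+ 50))); first by move: hM M1; lra.
  apply: ler_wpM2r; first exact: expR_ge0.
  by apply: le_trans (expR_ge1Dx _); rewrite lerDr.
rewrite card_prod card_ord natrM -expr2.
apply: (@le_trans _ _ (expR (15 * H + Y ^+ 50) ^+ 2)).
  by rewrite lerXn2r ?nnegrE ?expR_ge0.
rewrite -expRM_natr ler_expR; move: (Y ^+ 50) Y50 => y y1.
have t : H * 1 <= H * y by rewrite ler_wpM2l // ltW.
have t' : 1 * y <= H * y by rewrite ler_wpM2r // (le_trans ler01).
by move: t t'; lra.
Qed.

Let C576 : 0 <= 576 * C2 ^+ 2.
Proof. exact: mulr_ge0 (ler0n _ _) (sqr_ge0 _). Qed.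

Let gain_ratio : Cn / short_gain (p / 4) L <=
  expR ((576 * C2 ^+ 2 + 1 + A) * (1 + l)).
Proof.
have /andP[_ hL] := half_block_itv.
have L0 : 0 < L%:R :> R by rewrite ltr0n.
have -> : Cn / short_gain (p / 4) L = Cn * (72 * L%:R) / p.
  by rewrite /short_gain; field; rewrite !gt_eqF.
have C2L : C2 * L%:R <= C2 * (2 * Y) by apply: ler_wpM2l => //; exact: le_trans C21.
have C20 : 0 <= C2 * L%:R by apply: mulr_ge0; [exact: le_trans C21 | exact: ltW].
have h1 : Cn <= (C2 * (2 * Y)) ^+ 2.
  by apply: le_trans choice_le _; rewrite lerXn2r ?nnegrE // (le_trans C20).
have h2 : Cn * (72 * L%:R) <= 576 * C2 ^+ 2 * u.
  apply: (@le_trans _ _ ((C2 * (2 * Y)) ^+ 2 * (72 * (2 * Y)))).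
    apply: ler_pM => //; first exact: sqr_ge0.
    by rewrite ler_wpM2l.
  have -> : (C2 * (2 * Y)) ^+ 2 * (72 * (2 * Y)) = 576 * C2 ^+ 2 * Y ^+ 3 by ring.
  have := ler_wpM2l C576 (Y_pow (k := 3) isT). exact.
rewrite ler_pdivrMr //; apply: le_trans h2 _.
set c := 576 * C2 ^+ 2.
have c_ge0 : 0 <= c := C576.
apply: (@le_trans _ _ (expR (c + l + A * l) * expR (- (A * l)))).
  rewrite -expRD addrK expRD lnK ?posrE // ler_wpM2r ?(ltW u0) //.
  by apply: le_trans (expR_ge1Dx _); rewrite lerDr.
apply: ler_pM; rewrite ?expR_ge0 // ler_expR.
have t : 0 <= c * l by exact: mulr_ge0.
by move: t A0; lra.
Qed.

Local Notation C3 := (576 * C2 ^+ 2 + 1 + A).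

Let C31 : 1 <= C3.
Proof. by move: C22 A0; lra. Qed.

Let Cn_ge0 : 0 <= Cn.
Proof. exact: sqr_ge0. Qed.

Let ratio_ge0 : 0 <= Cn / short_gain (p / 4) L.
Proof.
apply: divr_ge0 => //; rewrite /short_gain; apply: divr_ge0 => //.
by apply: divr_ge0 => //; exact: ltW.
Qed.

Let sc_ge0 : 0 <= short_count kap c0 rho (p / 4) M L m1.
Proof.
by rewrite /short_count; apply: mulr_ge0; apply: exprn_ge0.
Qed.

Let count_exponent : short_count kap c0 rho (p / 4) M L m1 <=
  expR (128 * H * Y ^+ 51 + C3 * (1 + l) * m1%:R).
Proof.
have /andP[_ hL] := half_block_itv.
rewrite /short_count expRD; apply: ler_pM.
- by rewrite exprn_ge0.
- exact: exprn_ge0.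
- have E1 : 1 <= expR (32 * H * Y ^+ 50).
    rewrite -[leLHS]expR0 ler_expR; apply: mulr_ge0; last by rewrite exprn_ge0 // ltW.
    by apply: mulr_ge0 => //; exact: ltW.
  apply: (@le_trans _ _ (expR (32 * H * Y ^+ 50) ^+ (2 * L))).
    apply: (@le_trans _ _ (expR (32 * H * Y ^+ 50) ^+ (2 * L).-1)).
      by rewrite lerXn2r ?nnegrE ?expR_ge0.
    by rewrite ler_weXn2l // leq_pred.
  rewrite -expRM_natr ler_expR natrM.
  have -> : 128 * H * Y ^+ 51 = 32 * H * Y ^+ 50 * (2 * (2 * Y)) by ring.
  apply: ler_wpM2l; last by rewrite ler_wpM2l.
  by apply: mulr_ge0; [apply: mulr_ge0 => //; exact: ltW | rewrite exprn_ge0 // ltW].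
by rewrite expRM_natr lerXn2r ?nnegrE ?expR_ge0.
Qed.

Let exponent_le : 128 * H * Y ^+ 51 + C3 * (1 + l) * m1%:R + (1 + l) * m1%:R <=
  small_exponent.
Proof.
have /andP[_ hm] := threshold_itv.
have Y51 : Y ^+ 51 <= (1 + l) * (u / Y).
  apply: (@le_trans _ _ (u / Y)); last by rewrite ler_peMl ?lerDl // divr_ge0 ?ltW.
  by rewrite ler_pdivlMr // -exprSr Y_pow.
have hm' : (1 + l) * m1%:R <= 2 * ((1 + l) * (u / Y)).
  by rewrite mulrCA ler_wpM2l // addr_ge0.
have -> : small_exponent = C4 * ((1 + l) * (u / Y)).
  by rewrite /small_exponent; field; rewrite gt_eqF.
rewrite -[C3 * _ * _]mulrA -[128 * _ * _]mulrA /short_const.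
have a1 := ler_wpM2l (ltW H0) Y51.
have a2 := ler_wpM2l (le_trans ler01 C31) hm'.
move: ((1 + l) * (u / Y)) ((1 + l) * m1%:R) hm' a1 a2 => x y hxy.
move: (576 * C2 ^+ 2) (Y ^+ 51) => c z a1 a2; move: a1 a2 hxy.
by lra.
Qed.

Lemma short_count_le :
  (n.+1 ^ m1)%:R * short_count kap c0 rho (p / 4) M L m1 <= expR small_exponent.
Proof.
apply: (@le_trans _ _ (expR ((1 + l) * m1%:R) *
    expR (128 * H * Y ^+ 51 + C3 * (1 + l) * m1%:R))); last first.
  by rewrite -expRD ler_expR addrC.
apply: ler_pM => //.
rewrite natrX expRM_natr lerXn2r ?nnegrE ?expR_ge0 //.
rewrite expRD lnK ?posrE // -addn1 natrD.
have := expR_ge1Dx (1 : R); have := u1; move: (expR 1) (u) => e v v1 e1.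
by apply: (@le_trans _ _ (2 * v)); [lra | rewrite ler_wpM2r //; lra].
Qed.

(** In the long count a factor e^n is harmless: it is at most 4^n and becomes the 4 in
    [long_ratio]. *)
Lemma short_count_le_exp :
  short_count kap c0 rho (p / 4) M L m1 <= expR u.
Proof.
apply: le_trans count_exponent _; rewrite ler_expR.
apply: (@le_trans _ _ small_exponent).
  by apply: le_trans exponent_le; rewrite lerDl mulr_ge0 // addr_ge0.
rewrite /small_exponent ler_pdivrMr // mulrAC [leRHS]mulrC.
by apply: ler_wpM2r => //; exact: ltW.
Qed.

Let inv_sqrt_le : (Num.sqrt block_count%:R)^-1 <= 8 * CK * Y ^+ 26 / Num.sqrt u.
Proof.
have /andP[hR _] := block_count_itv; have b0 := block_count_gt0.
move: block_count hR b0 => b hR b0.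
have sb : 0 < Num.sqrt b%:R :> R by rewrite sqrtr_gt0 ltr0n.
have su : 0 < Num.sqrt u by rewrite sqrtr_gt0.
have CK8 : 1 <= 8 * CK by move: CK1; lra.
have Y26 : 0 < Y ^+ 26 by rewrite exprn_gt0.
move: (8 * CK) CK8 hR => c c1 hR; have cp : 0 < c by apply: lt_le_trans c1.
rewrite ler_pdivlMr // mulrC ler_pdivrMr //.
have -> : c * Y ^+ 26 * Num.sqrt b%:R = Num.sqrt ((c * Y ^+ 26) ^+ 2 * b%:R).
  by rewrite sqrtrM ?sqr_ge0 // sqrtr_sqr ger0_norm // mulr_ge0 ?ltW.
apply: ler_wsqrtr; have := hR; rewrite ler_pdivrMr; last first.
  by rewrite mulr_gt0 // exprn_gt0.
move/le_trans; apply; rewrite mulrC ler_wpM2r //.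
rewrite exprMn -exprM ler_wpM2r ?exprn_ge0 ?(ltW Y0) //.
by rewrite expr2 ler_peMr // ltW.
Qed.

(** Powers of Y: 50 from the labels, 2 from the choices, 1 from the length in the gain, 1 from the
    length in the cost, 26 from the square root of the number of blocks, and 1 for the constants.
    The total 81 is below 100. *)
Let long_ratio : 2 * K%:R * (4 * (Cn / long_gain kap c0 q (p / 4) L block_count.-1)) <=
  Y ^+ 100 / Num.sqrt u / p.
Proof.
have /andP[_ hL] := half_block_itv.
have L0 : 0 < L%:R :> R by rewrite ltr0n.
have K_le := card_label_le; have Kge0 : 0 <= K%:R :> R by [].
move: (K%:R : R) K_le Kge0 => k hk k0.
have s0 := inv_sqrt_le.
have := relation_cost_gt0 L block_count.-1 c00 q0 (le_trans ler01 kap1).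
have := cost_bound; rewrite /long_gain prednK ?block_count_gt0 //.
have b0 : 0 < block_count%:R :> R by rewrite ltr0n block_count_gt0.
have sb : 0 < (Num.sqrt block_count%:R)^-1 :> R by rewrite invr_gt0 sqrtr_gt0.
move: (relation_cost _ _ _ _ _) (block_count%:R : R) b0 sb s0 => rc b b0 sb s0 hrc rc0.
move: (Num.sqrt b)^-1 sb s0 hrc => sb sb0 s0 hrc.
have C0 : 0 <= Cc by apply: le_trans Cc1.
have C20 : 0 <= C2 by apply: le_trans C21.
have hrb : rc * b <= sb * (Cc * (2 * Y)).
  apply: (@le_trans _ _ (sb * b^-1 * (Cc * L%:R) * b)); first by rewrite ler_wpM2r // ltW.
  rewrite mulrAC divfK ?gt_eqF //.
  by apply: ler_wpM2l; [exact: ltW | apply: ler_wpM2l].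
have hC : Cn <= (C2 * (2 * Y)) ^+ 2.
  apply: le_trans choice_le _; rewrite lerXn2r ?nnegrE.
  - by [].
  - by apply: mulr_ge0 => //; exact: ltW.
  - by apply: mulr_ge0 => //; rewrite mulr_ge0 // ltW.
  by apply: ler_wpM2l.
move: Cn Cn_ge0 hC (L%:R : R) hL L0 => c c0' hC v hv v0.
have -> : 2 * k * (4 * (c / (p / 4 / (9 * rc * (2 * v * b))))) =
    8 * k * c * (72 * v * (rc * b)) / p.
  by field; rewrite !gt_eqF.
apply: ler_wpM2r; first by rewrite invr_ge0 ltW.
have su : 0 < Num.sqrt u by rewrite sqrtr_gt0.
have kc : 8 * k * c <= 8 * (CK * Y ^+ 50) * (C2 * (2 * Y)) ^+ 2.
  apply: ler_pM => //; first exact: mulr_ge0.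
  exact: ler_wpM2l.
have vb : 72 * v * (rc * b) <=
    72 * (2 * Y) * (8 * CK * Y ^+ 26 / Num.sqrt u * (Cc * (2 * Y))).
  apply: ler_pM.
  - exact: mulr_ge0 (ler0n _ 72) (ltW v0).
  - exact: mulr_ge0 (ltW rc0) (ltW b0).
  - exact: ler_wpM2l (ler0n _ 72) _ _ hv.
  apply: le_trans hrb _; apply: ler_wpM2r => //.
  by apply: mulr_ge0 => //; rewrite mulr_ge0 // ltW.
have kc0 : 0 <= 8 * k * c by apply: mulr_ge0 => //; exact: mulr_ge0.
have vb0 : 0 <= 72 * v * (rc * b).
  exact: mulr_ge0 (mulr_ge0 (ler0n _ 72) (ltW v0)) (mulr_ge0 (ltW rc0) (ltW b0)).
apply: le_trans (ler_pM kc0 vb0 kc vb) _.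
have -> : 8 * (CK * Y ^+ 50) * (C2 * (2 * Y)) ^+ 2 *
    (72 * (2 * Y) * (8 * CK * Y ^+ 26 / Num.sqrt u * (Cc * (2 * Y)))) =
    C5 * Y ^+ 80 / Num.sqrt u.
  by rewrite /long_const; field; rewrite gt_eqF.
apply: ler_wpM2r; first by rewrite invr_ge0 ltW.
have C5Y : C5 <= Y.
  by apply: Y_const; [exact: le_trans C51 | case: growth_const_ge].
apply: (@le_trans _ _ (Y ^+ 81)); last exact: ler_weXn2l.
by rewrite [leRHS]exprS; apply: ler_wpM2r => //; rewrite exprn_ge0 // ltW.
Qed.

Lemma long_count_le :
  (2 * K%:R) ^+ n * (short_count kap c0 rho (p / 4) M L m1 *
    (Cn / long_gain kap c0 q (p / 4) L block_count.-1) ^+ n) <=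
  (Y ^+ 100 / Num.sqrt u) ^+ n * p ^- n.
Proof.
have lg0 : 0 < long_gain kap c0 q (p / 4) L block_count.-1.
  have rc0 := relation_cost_gt0 L block_count.-1 c00 q0 (le_trans ler01 kap1).
  rewrite /long_gain; move: (relation_cost _ _ _ _ _) rc0 => rc rc0.
  by rewrite divr_gt0 ?divr_gt0 // !mulr_gt0.
have t0 : 0 <= Cn / long_gain kap c0 q (p / 4) L block_count.-1.
  by apply: divr_ge0 => //; exact: ltW.
have ht := long_ratio.
move: (Cn / _) t0 ht => t t0 ht.
apply: (@le_trans _ _ ((2 * K%:R) ^+ n * (4 ^+ n * t ^+ n))).
  apply: ler_wpM2l; first by rewrite exprn_ge0 // mulr_ge0.
  apply: ler_wpM2r; first by rewrite exprn_ge0.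
  apply: le_trans short_count_le_exp _.
  by rewrite -[u]mul1r expRM_natr lerXn2r ?nnegrE ?expR_ge0 // expR1_le4.
rewrite -!exprMn -exprVn -exprMn lerXn2r ?nnegrE //.
  by apply: mulr_ge0; apply: mulr_ge0.
by rewrite !divr_ge0 ?sqrtr_ge0 ?exprn_ge0 // ltW.
Qed.

End Asymptotics.

Local Open Scope complex_scope.

Theorem theorem3p2 (R : realType) (kappa eps A : R) :
  1 <= kappa -> 0 < eps -> eps <= 1 -> 0 < A ->
  exists (n0 : nat) (tau : nat -> R),
    tau =o_\oo (fun n : nat => n%:R : R) /\
    forall n : nat, (n0 <= n)%N ->
    forall (d : measure_display) (T : measurableType d) (P : probability T R)
      (x : {RV P >-> R[i]}),
    controlled_second_moment kappa x ->
    forall (d' : measure_display) (T' : measurableType d')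
      (P' : probability T' R) (X : 'I_n -> {RV P' >-> R[i]}),
    iid_copies x X ->
    forall beta p : R,
    expR (- (n%:R `^ (eps / 2))) <= beta ->
    n%:R `^ (- A) <= p -> p <= 1 ->
    exists S' : {fset 'rV[R[i]]_n},
      (#|` S'|%:R : R) <=
        n%:R `^ ((- (1 / 2) + eps) * n%:R) * p ^- n + expR (tau n) /\
      forall v : 'rV[R[i]]_n, v \in concentrated_vectors X beta p ->
        exists2 v' : 'rV[R[i]]_n, v' \in S' & sup_norm (v - v') <= beta.
Proof.
move=> kappa1 eps0 eps1 A0.
pose kap := kappa + 1; pose c0 := gap kappa; pose q := mass kappa.
have kap1 : 1 <= kap by rewrite lerDr (le_trans ler01).
have c00 : 0 < c0 by exact: gap_gt0.
have q0 : 0 < q by exact: mass_gt0.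
have q1 : q <= 1 by exact: mass_le1.
(* The relative precision 3 / 2^h of a class has to be small against the gap, as [step_large]
   requires; [h] depends on kappa alone. *)
pose h := Num.bound (3 * (4 * kap) / c0).
have hh : 3 / (2 ^ h)%:R * (4 * kap) <= c0.
  have pos : 0 <= 3 * (4 * kap) / c0.
    by apply: divr_ge0; [apply: mulr_ge0 => //; apply: mulr_ge0 => //; exact: le_trans kap1 | exact: ltW].
  rewrite mulrAC ler_pdivrMr ?ltr0n ?expn_gt0 // [leRHS]mulrC -ler_pdivrMr //.
  apply: le_trans (ltW (archi_boundP pos)) _.
  by rewrite ler_nat ltnW // ltn_expl.
(* With Y = n^s, Y^100 = n^eps is the loss allowed per coordinate, and Y^50 = n^(eps / 2) is the
   exponent in the bound on [beta]. *)
pose s := eps / 100; have s0 : 0 < s by apply: divr_gt0.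
have Cge0 := growth_const_ge0 h kap1 c00 q0 q1 A0.
have [N hN] := log_growth s0 Cge0.
pose tau (n : nat) : R := small_exponent kap c0 A h n (n%:R `^ s).
have short0 : 0 <= short_const kap c0 A h := le_trans ler01 (short_const_ge1 h kap1 c00 A0).
exists N, tau; split.
  apply/eqoP => e e0.
  have [N' hN'] := log_growth s0 (divr_ge0 short0 (ltW e0)).
  exists N' => // n /= /hN'[n_gt0 hn].
  have l0 : 0 <= ln (n%:R : R) by rewrite ln_ge0 // ler1n.
  have Y0 : 0 < (n%:R : R) `^ s by rewrite powR_gt0 // ltr0n.
  rewrite ger0_norm; last first.
    rewrite /tau /small_exponent; apply: divr_ge0; last exact: ltW.
    by apply: mulr_ge0; [apply: mulr_ge0 | apply: addr_ge0].
  rewrite ger0_norm // /tau /small_exponent ler_pdivrMr //.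
  have := ler_wpM2l (mulr_ge0 (ltW e0) (ler0n R n)) hn.
  by apply: le_trans; rewrite le_eqVlt; apply/orP; left; apply/eqP; field; rewrite gt_eqF.
move=> n /hN[n_gt0 budget] d T P x ctrl d' T' P' X iidX beta p hbeta hp p1.
set u : R := n%:R in budget hbeta hp *; set Y := u `^ s in budget.
have u1 : 1 <= u by rewrite ler1n.
have u0 : 0 < u by rewrite ltr0n.
have Y1 : 1 <= Y by rewrite -[leLHS](powRr0 u) ler_powR // ltW.
have YX k : Y ^+ k = u `^ (s * k%:R) by rewrite -powR_mulrn ?powR_ge0 // -powRrM.
have Y100 : Y ^+ 100 = u `^ eps by rewrite YX /s divfK.
have Yu : Y ^+ 100 <= u by rewrite Y100 -[leRHS]powRr1 ?ler_powR // ltW.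
have Y50 : Y ^+ 50 = u `^ (eps / 2).
  by rewrite YX; congr (_ `^ _); rewrite /s; lra.
have pA : expR (- (A * ln u)) <= p.
  by move: hp; rewrite /powR gt_eqF // mulNr.
have p0 : 0 < p by apply: lt_le_trans pA; exact: expR_gt0.
rewrite -Y50 in hbeta.
have beta0 : 0 < beta by apply: lt_le_trans hbeta; exact: expR_gt0.
have rhoE : (2 ^ h.+2)%:R = 4 * side R h :> R by rewrite /side !expnS mulnA natrM.
have b0 := block_count_gt0 kap1 c00 q0 q1 A0 n_gt0 Y1 Yu budget.
have := @net_exists R kappa kappa1 _ _ P x _ _ P' n X beta p (radius h Y) h (half_block Y)
  (block_count h n Y).-1 (threshold n Y) ctrl iidX beta0 p0 p1 hh
  (radius_beta h Y1 hbeta) (isT : (0 < half_block Y)%N).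
move=> /(_ (block_budget kap1 c00 q0 q1 A0 n_gt0 Y1 Yu budget)).
rewrite (prednK b0) rhoE.
move=> /(_ (error1 kap1 c00 q0 q1 A0 n_gt0 Y1 Yu budget pA)).
move=> /(_ (error2 kap1 c00 q0 q1 A0 n_gt0 Y1 Yu budget pA)).
move=> /(_ (error3 kap1 c00 q0 q1 A0 n_gt0 Y1 budget pA)).
move=> [S' [cS hS]]; exists S'; split=> //.
apply: le_trans cS _; rewrite addrC; apply: lerD; last first.
  exact: (short_count_le h kap1 c00 A0 n_gt0 Y1 Yu pA).
apply: le_trans (long_count_le kap1 c00 q0 q1 A0 n_gt0 Y1 Yu budget pA) _.
apply: ler_wpM2r; first by rewrite invr_ge0 exprn_ge0 // ltW.
rewrite powRrM powR_mulrn ?powR_ge0 // powRD; last by rewrite (gt_eqF u0) implybT.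
by rewrite div1r powRN powR12_sqrt ?(ltW u0) // Y100 mulrC.
Qed.
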